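(* For each integer $d\ge 1$ let $\alpha_d\in\mathbb{R}$ and let $\mu_{\alpha_d}$ be the Borel measure on $\mathbb{R}^d$ given by $d\mu_{\alpha_d}(x)=\|x\|_2^{-\alpha_d}\,dx$. Let $M_{\mu_{\alpha_d}}$ be the centered Hardy–Littlewood maximal operator associated to $\mu_{\alpha_d}$ and euclidean balls, acting on radial functions, and for $1\le p<\infty$ let $c_{p,d}$ denote the best constant in the weak type $(p,p)$ inequality $$\sup_{\lambda>0}\lambda\,\mu_{\alpha_d}(\{M_{\mu_{\alpha_d}} f>\lambda\})^{1/p}\le c_{p,d}\|f\|_{L^p(\mu_{\alpha_d})}$$ over all radial $f\in L^p(\mu_{\alpha_d})$ on $\mathbb{R}^d$; similarly let $C_{p,d}$ denote the best constant in the strong type $(p,p)$ inequality $\|M_{\mu_{\alpha_d}}f\|_{L^p(\mu_{\alpha_d})}\le C_{p,d}\|f\|_{L^p(\mu_{\alpha_d})}$ over radial $f$. Then: 1) If $\alpha$ is a fixed constant with $1/2<\alpha<1$ and $\alpha_d=\alpha d$ for all $d$, then for every $p\in[1,\infty)$ there exists $b=b(p)>1$ such that $c_{p,d}\ge \Theta(b^d)$; that is, the weak type $(p,p)$ constants grow exponentially in $d$ for all $p<\infty$. 2) If $\alpha_d\le d/2$, then $c_{1,d}\ge \Theta\big((5^{1/2}/2)^{\alpha_d}\big)$. In particular, if $\alpha_d\le d/2$ for all $d$ and $\limsup_d\alpha_d=\infty$, then $\limsup_d c_{1,d}=\infty$. 3) If $\sup_d\alpha_d\le\alpha<\infty$,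 then there exists $C=C(\alpha)$ such that $c_{1,d}\le C$ for every $d\ge 1$; consequently (by interpolation) for each $1<p<\infty$ the strong type constants $C_{p,d}$ are bounded uniformly in $d$.
   Context: A function $f:\mathbb{R}^d\to\mathbb{R}$ is radial if there is $f_0:(0,\infty)\to\mathbb{R}$ with $f(x)=f_0(\|x\|_2)$ for all $x\neq0$, where $\|x\|_2$ is the euclidean norm. For a Borel measure $\mu$ on $\mathbb{R}^d$ (possibly assigning infinite measure to some balls) and locally integrable $g$, the centered maximal operator is $M_\mu g(x)=\sup_{\{r>0:\,0<\mu(B(x,r))\}}\frac{1}{\mu(B(x,r))}\int_{B(x,r)}|g|\,d\mu$, where $B(x,r)$ is the closed euclidean ball of center $x$ and radius $r$, with the convention $\infty/\infty=\infty\cdot 0=0$. $\Theta$ denotes exact order of growth (up to multiplicative constants independent of $d$). *)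

(* Defs.v *)
From HB Require Import structures.
From mathcomp Require Import all_boot all_order all_algebra.
From mathcomp Require Import all_classical all_reals all_analysis.
Set Implicit Arguments. Unset Strict Implicit. Unset Printing Implicit Defensive.
Import Order.TTheory GRing.Theory Num.Theory.
Import numFieldNormedType.Exports.
Local Open Scope classical_set_scope.
Local Open Scope ring_scope.

Section Defs.
Variable R : realType.

(* Lebesgue integral over R^d = 'rV[R]_d, defined as the iterated
   one-dimensional Lebesgue integral (Tonelli); intended for nonnegative
   integrands. *)
Fixpoint intd (d : nat) : ('rV[R]_d -> \bar R) -> \bar R :=
  match d return ('rV[R]_d -> \bar R) -> \bar R with
  | 0 => fun g => g 0
  | d'.+1 => fun g =>
      (\int[@lebesgue_measure R]_t
          intd (fun v : 'rV[R]_d' => g (row_mx (const_mx t : 'rV[R]_1) v)))%E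
  end.

Definition norm2 (d : nat) (x : 'rV[R]_d) : R :=
  Num.sqrt (\sum_(i < d) x ord0 i ^+ 2).

Definition ball2 (d : nat) (x : 'rV[R]_d) (r : R) : set 'rV[R]_d :=
  [set y | norm2 (y - x) <= r].

Definition wt (d : nat) (a : R) (x : 'rV[R]_d) : R := norm2 x `^ (- a).

Definition intmu (d : nat) (a : R) (A : set 'rV[R]_d) (g : 'rV[R]_d -> \bar R)
  : \bar R := intd (fun x => ((\1_A x)%:E * (wt a x)%:E * g x)%E).

Definition mu (d : nat) (a : R) (A : set 'rV[R]_d) : \bar R :=
  intmu a A (fun _ => 1%E).

(* centered maximal operator M_{mu_a} (Euclidean closed balls); the
   conventions oo/oo = oo*0 = 0 are those of \bar R (inve +oo = 0,
   +oo * 0 = 0). *)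
Definition maxop (d : nat) (a : R) (f : 'rV[R]_d -> R) (x : 'rV[R]_d)
  : \bar R :=
  ereal_sup [set (intmu a (ball2 x r) (fun y => (`|f y|)%:E)
                   * (mu a (ball2 x r))^-1)%E
            | r in [set r : R | 0 < r /\ (0 < mu a (ball2 x r))%E]].

Definition Lpnorm (d : nat) (a p : R) (g : 'rV[R]_d -> \bar R) : \bar R :=
  ((intd (fun x => ((`|g x|) `^ p * (wt a x)%:E)%E)) `^ p^-1)%E.

Definition radial (d : nat) (f0 : R -> R) : 'rV[R]_d -> R :=
  fun x => f0 (norm2 x).

Definition weak_const (d : nat) (a p : R) : \bar R :=
  ereal_inf [set c%:E | c in [set c : R | 0 <= c /\
    forall f0 : R -> R, measurable_fun setT f0 ->
      (Lpnorm a p (fun x => (@radial d f0 x)%:E) < +oo)%E ->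
      forall l : R, 0 < l ->
        (l%:E * (mu a [set x | (l%:E < maxop a (@radial d f0) x)%E]) `^ p^-1
          <= c%:E * Lpnorm a p (fun x => (@radial d f0 x)%:E))%E]].

Definition strong_const (d : nat) (a p : R) : \bar R :=
  ereal_inf [set c%:E | c in [set c : R | 0 <= c /\
    forall f0 : R -> R, measurable_fun setT f0 ->
      (Lpnorm a p (fun x => (@radial d f0 x)%:E) < +oo)%E ->
      (Lpnorm a p (maxop a (@radial d f0))
          <= c%:E * Lpnorm a p (fun x => (@radial d f0 x)%:E))%E]].

End Defs.

(* Main.v *)
(* For a unit vector theta, the restriction of the measure to the ray through theta
   is t^(d-1-a) dt, whatever theta is; and in one dimension the uncentered maximal
   operator of an arbitrary measure is of weak type (1,1) with constant 2.

   Bounded exponents.  Let B be a ball centred at x and D its inner shadow.  Every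
   ray meets B u D in an interval containing |x|, so that the integral of a radial
   f over B is at most M f(|x|) mu(B u D), with M the one-dimensional uncentered
   operator on rays.  As mu(D) <= 2 * 16^alpha mu(B), the maximal operator is bounded
   by a multiple of M f(|x|), independently of d; the strong type follows from the
   layer cake formula.

   Lower bounds.  For a <= d/2 let f be the indicator of a very small ball around the
   origin, and use at x the ball of radius slightly larger than |x|: by concentration
   of measure its mass is smaller by (2/5^(1/2))^a than that of the ball of the same
   radius around the origin.  For a = b d with 1/2 < b < 1 let f be the indicator of
   the unit ball, and let |x| exceed 1 slightly: the weight pulls most of the mass of
   the ball of radius q^(1/2) |x| around x towards its centre of mass (1 - b q) x, well
   inside the unit ball, so that M f > 1/3 on a ball of radius > 1, whose mass is
   exponentially larger than that of the unit ball. *)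
Require Import Defs.
From HB Require Import structures.
From mathcomp Require Import all_boot all_order all_algebra.
From mathcomp Require Import all_classical all_reals all_analysis.
From mathcomp Require Import measurable_realfun ring lra.
Set Implicit Arguments. Unset Strict Implicit. Unset Printing Implicit Defensive.
Import Order.TTheory GRing.Theory Num.Theory.
Import numFieldNormedType.Exports.
Local Open Scope classical_set_scope.
Local Open Scope ring_scope.

(** Integration over R^d is an iterated integral, so polar coordinates are obtained by averaging
    over dilations: the sphere is replaced by the shell 1 < |z| <= 2 and the radial variable is
    averaged against the scale-invariant measure dt/t.

    The shadow is forced by the rays that cross B without reaching the distance |x|: their chords do
    not compete in M f(|x|). Bounding mu(D) is then the only place where the dimension could enter.
    Near the origin the weight is singular when a > 0, and three mechanisms keep the constant free
    of d. If B is small compared with |x|, the weights on B and D are comparable. If 2a <= d, the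
    average of the weight over a truncated cone is at most twice its value at the outer radius. If d
    <= 2a, then 4^d <= 16^a, so that losses exponential in d are harmless.

    Superlevel sets of the maximal operator enter only through inclusions between them and
    measurable sets; monotonicity of the integral of nonnegative functions does the rest. The
    origin, where the bound by M f(|x|) is not stated, is discarded as a null point. *)

(** * The sigma-algebra on row vectors generated by the coordinates *)

Section rV_measurable.
Variable R : realType.

Let coors d : 'I_d -> 'rV[R]_d -> R := fun i x => x ord0 i.

Let rV_set0 d : g_sigma_preimage (@coors d) set0.
Proof. exact: sigma_algebra0. Qed.

Let rV_setC d A : g_sigma_preimage (@coors d) A ->
  g_sigma_preimage (@coors d) (~` A).
Proof. exact: sigma_algebraC. Qed.

Let rV_bigcup d (F : _^nat) : (forall i, g_sigma_preimage (@coors d) (F i)) ->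
  g_sigma_preimage (@coors d) (\bigcup_i (F i)).
Proof. exact: sigma_algebra_bigcup. Qed.

HB.instance Definition _ d := @isMeasurable.Build default_measure_display
  'rV[R]_d (g_sigma_preimage (@coors d)) (@rV_set0 d) (@rV_setC d)
  (@rV_bigcup d).

Lemma measurable_coord d (i : 'I_d) :
  measurable_fun [set: 'rV[R]_d] (fun x => x ord0 i).
Proof.
move=> _ Y mY; rewrite setTI; apply: sub_sigma_algebra => /=.
rewrite -bigcup_seq/=; exists i => /=; first by rewrite mem_index_enum.
by exists Y => //; rewrite setTI.
Qed.

Lemma measurable_fun_rV disp (T : measurableType disp) d (f : T -> 'rV[R]_d) :
  (forall i, measurable_fun [set: T] (fun t => f t ord0 i)) ->
  measurable_fun [set: T] f.
Proof.
move=> mf; rewrite /measurable_fun => _ B mB; rewrite setTI.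
suff : preimage_set_system [set: T] f (g_sigma_preimage (@coors d))
    `<=` measurable.
  by apply; exists B => //; rewrite setTI.
rewrite -g_sigma_preimageE; apply: smallest_sub.
  exact: sigma_algebra_measurable.
move=> _ [C + <-]; rewrite -bigcup_seq/= => -[i _ [A mA <-]].
by rewrite !setTI -comp_preimage -[X in measurable X]setTI; exact: mf.
Qed.

End rV_measurable.

(** * Change of variables for the Lebesgue integral on the line *)

Section real_line.
Variable R : realType.
Local Open Scope ereal_scope.
Notation leb := (@lebesgue_measure R).

(** The integral of a nonnegative function is a supremum over the simple functions below it, hence
    monotone for arbitrary functions. This is what lets superlevel sets of [maxop] be handled by
    inclusion. *)
Lemma le_lower_integral disp (T : measurableType disp)
    (m : {measure set T -> \bar R}) (f g : T -> \bar R) :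
  (forall x, 0 <= f x) -> (forall x, f x <= g x) ->
  \int[m]_x f x <= \int[m]_x g x.
Proof.
move=> f0 fg; rewrite !ge0_integralTE//; last first.
  by move=> x; exact: le_trans (fg x).
apply: le_ereal_sup => _ [h /= hf <-]; exists h => //= x.
exact: le_trans (hf x) (fg x).
Qed.

(** The image of Lebesgue measure under the translation agrees with it on half-open intervals, and
    these determine the measure. Dilations below are treated alike, up to the factor [l]. *)
Lemma integral_shift (c : R) (f : R -> \bar R) :
  measurable_fun setT f -> (forall t, 0 <= f t) ->
  \int[leb]_t f (t + c)%R = \int[leb]_t f t.
Proof.
move=> mf f0.
have mphi : measurable_fun setT ((fun t : R => t + c)%R : measurableTypeR R -> measurableTypeR R).
  by apply: measurable_funD.
rewrite -[LHS](@ge0_integral_pushforward _ _ _ _ R _ mphi leb setT f)//.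
pose mphi_mixin := isMeasurableFun.Build _ _ _ _ _ mphi.
pose phi : {mfun _ >-> _} := HB.pack ((fun t : R => t + c)%R : measurableTypeR R -> measurableTypeR R) mphi_mixin.
apply: (@eq_measure_integral _ _ _ _ leb (pushforward leb phi)) => //= A mA _.
apply/esym/(@lebesgue_measure_unique R (pushforward leb phi)) => //= _ [[a b]] _ <-.
rewrite /pushforward.
rewrite (_ : _ @^-1` _ = `](a - c)%R, (b - c)%R]%classic); last first.
  by apply/seteqP; split=> x /=; rewrite !in_itv/= ltrBlDr lerBrDr.
rewrite !lebesgue_measure_itv/= !lte_fin ltrD2r; case: ifPn => // _.
by rewrite -!EFinB; congr EFin; ring.
Qed.

Lemma integral_opp (f : R -> \bar R) :
  measurable_fun setT f -> (forall t, 0 <= f t) ->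
  \int[leb]_t f (- t)%R = \int[leb]_t f t.
Proof.
move=> mf f0.
have mphi : measurable_fun setT ((fun t : R => - t)%R : measurableTypeR R -> measurableTypeR R).
  exact: oppr_measurable.
rewrite -[LHS](@ge0_integral_pushforward _ _ _ _ R _ mphi leb setT f)//.
pose mphi_mixin := isMeasurableFun.Build _ _ _ _ _ mphi.
pose phi : {mfun _ >-> _} := HB.pack ((fun t : R => - t)%R : measurableTypeR R -> measurableTypeR R) mphi_mixin.
apply: (@eq_measure_integral _ _ _ _ leb (pushforward leb phi)) => //= A mA _.
exact: lebesgue_measureN.
Qed.

Lemma integral_scale_pos (l : R) (f : R -> \bar R) : (0 < l)%R ->
  measurable_fun setT f -> (forall t, 0 <= f t) ->
  l%:E * \int[leb]_t f (l * t)%R = \int[leb]_t f t.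
Proof.
move=> l0 mf f0.
have mphi : measurable_fun setT ((fun t : R => l * t)%R : measurableTypeR R -> measurableTypeR R).
  exact: mulrl_measurable.
rewrite -[X in _ * X](@ge0_integral_pushforward _ _ _ _ R _ mphi leb setT f)//.
pose mphi_mixin := isMeasurableFun.Build _ _ _ _ _ mphi.
pose phi : {mfun _ >-> _} := HB.pack ((fun t : R => l * t)%R : measurableTypeR R -> measurableTypeR R) mphi_mixin.
pose k : {nonneg R} := NngNum (ltW l0).
rewrite -(@ge0_integral_mscale _ _ _ (pushforward leb phi) setT measurableT k)//.
apply: (@eq_measure_integral _ _ _ _ leb (mscale k (pushforward leb phi))) => //= A mA _.
apply/esym/(@lebesgue_measure_unique R (mscale k (pushforward leb phi))) => //= _ [[a b]] _ <-.
have E : (fun t : R => l * t)%R @^-1` `]a, b]%classic = `](l^-1 * a)%R, (l^-1 * b)%R]%classic.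
  by apply/seteqP; split=> x /=; rewrite !in_itv/= ltr_pdivrMl// ler_pdivlMl.
change (leb `]a, b]%classic = l%:E * leb ((fun t : R => l * t)%R @^-1` `]a, b]%classic)).
rewrite E.
rewrite !lebesgue_measure_itv/= !lte_fin ltr_pM2l ?invr_gt0//.
case: ifPn => // _; last by rewrite mule0.
by rewrite -!EFinB -EFinM; congr EFin; field; rewrite gt_eqF.
Qed.

Lemma integral_scale (l : R) (f : R -> \bar R) : l != 0%R ->
  measurable_fun setT f -> (forall t, 0 <= f t) ->
  `|l|%:E * \int[leb]_t f (l * t)%R = \int[leb]_t f t.
Proof.
move=> l0 mf f0; have [lp|ln|l00] := ltgtP l 0%R; last by rewrite l00 eqxx in l0.
- rewrite ltr0_norm// -[RHS](@integral_scale_pos (- l))// ?oppr_gt0//.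
  congr (_ * _).
  rewrite -[LHS]integral_opp//; last first.
    by apply: (measurableT_comp mf); exact: mulrl_measurable.
  by apply: eq_integral => t _; rewrite mulrN mulNr.
- by rewrite gtr0_norm// integral_scale_pos.
Qed.

Lemma integral_null0 (f : R -> \bar R) : measurable_fun setT f ->
  (forall t, 0 <= f t) ->
  \int[leb]_t f t = \int[leb]_t (f t * (t != 0%R)%:R%:E).
Proof.
move=> mf f0.
have mD : measurable ([set: R] `\ 0%R) by exact: measurableD.
rewrite -(@integral_setD1 _ _ 0%R setT)//; last exact: measurable_funTS.
rewrite integral_mkcond; apply: eq_integral => t _.
rewrite patchE; case: ifPn => [|].
  by rewrite inE/= => -[_ /eqP ->]; rewrite mule1.
by rewrite notin_setE/=; case: eqVneq => [->|/eqP ? []//]; rewrite mule0.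
Qed.

End real_line.

(** * Iterated integrals over R^d: measurability, linearity, Tonelli, dilations *)

Lemma measurable_comp2 d1 d2 d3 d4 (S : measurableType d1)
    (T : measurableType d2) (U : measurableType d3) (V : measurableType d4)
    (G : T -> U -> V) (f : S -> T) (g : S -> U) :
  measurable_fun setT (fun z => G z.1 z.2) ->
  measurable_fun setT f -> measurable_fun setT g ->
  measurable_fun setT (fun s => G (f s) (g s)).
Proof.
move=> mG mf mg; apply: (measurableT_comp mG (g := fun s => (f s, g s))).
exact: measurable_fun_pair.
Qed.

Section intd_theory.
Variable R : realType.
Local Open Scope ereal_scope.
Notation leb := (@lebesgue_measure R).

Lemma measurable_row_mx disp (T : measurableType disp) d (f : T -> R) (g : T -> 'rV[R]_d) :
  measurable_fun setT f -> measurable_fun setT g ->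
  measurable_fun setT (fun t => row_mx (const_mx (f t) : 'rV_1) (g t) : 'rV[R]_d.+1).
Proof.
move=> mf mg; apply: measurable_fun_rV => i.
have [j ->|j ->] := fintype.split_ordP (i : 'I_(1 + d)).
  by under eq_fun do rewrite (@row_mxEl _ 1 1 d) mxE.
under eq_fun do rewrite (@row_mxEr _ 1 1 d).
by apply: (measurableT_comp (measurable_coord j)).
Qed.

Lemma intd_ge0 d (G : 'rV[R]_d -> \bar R) : (forall x, 0 <= G x) -> 0 <= intd G.
Proof.
elim: d G => [|d IH] G G0 /=; first exact: G0.
by apply: integral_ge0 => t _; exact: IH.
Qed.

Lemma le_intd d (F G : 'rV[R]_d -> \bar R) : (forall x, 0 <= F x) ->
  (forall x, F x <= G x) -> intd F <= intd G.
Proof.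
elim: d F G => [|d IH] F G F0 FG /=; first exact: FG.
by apply: le_lower_integral => t; [exact: intd_ge0|exact: IH].
Qed.

Lemma eq_intd d (F G : 'rV[R]_d -> \bar R) : F =1 G -> intd F = intd G.
Proof. by move=> /funext ->. Qed.

(** The parameter space [T] is kept general because the induction on d moves one coordinate after
    another from the vector into the parameter. *)
Lemma measurable_intd disp (T : measurableType disp) d
    (G : T -> 'rV[R]_d -> \bar R) :
  measurable_fun setT (fun z => G z.1 z.2) -> (forall t x, 0 <= G t x) ->
  measurable_fun setT (fun t => intd (G t)).
Proof.
elim: d disp T G => [|d IH] disp T G mG G0 /=.
  exact: (measurable_comp2 mG).
pose H (z : T * measurableTypeR R) :=
  intd (fun v => G z.1 (row_mx (const_mx z.2 : 'rV_1) v)).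
have mH : measurable_fun setT H.
  apply: (IH _ _ (fun (z : T * measurableTypeR R) v => G z.1 (row_mx (const_mx z.2 : 'rV_1) v))) => //=.
  apply: (measurable_comp2 mG); first by apply: measurableT_comp.
  by apply: measurable_row_mx => //; apply: measurableT_comp.
by apply: (@measurable_fun_fubini_tonelli_F _ _ _ _ R leb H) => // z; exact: intd_ge0.
Qed.

Lemma measurable_intd_slice d (G : 'rV[R]_d.+1 -> \bar R) :
  measurable_fun setT G -> (forall x, 0 <= G x) ->
  measurable_fun setT (fun t : R => intd (fun v : 'rV_d => G (row_mx (const_mx t : 'rV_1) v))).
Proof.
move=> mG G0.
apply: (@measurable_intd _ (measurableTypeR R) d (fun t v => G (row_mx (const_mx t : 'rV_1) v))) => //.
apply: (measurableT_comp mG).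
exact: (@measurable_row_mx _ (measurableTypeR R * 'rV[R]_d)%type).
Qed.

Lemma measurable_slice d (G : 'rV[R]_d.+1 -> \bar R) (t : R) :
  measurable_fun setT G ->
  measurable_fun setT (fun v : 'rV_d => G (row_mx (const_mx t : 'rV_1) v)).
Proof.
move=> mG; apply: (measurableT_comp mG); exact: measurable_row_mx.
Qed.

Lemma intdD d (F G : 'rV[R]_d -> \bar R) :
  measurable_fun setT F -> measurable_fun setT G ->
  (forall x, 0 <= F x) -> (forall x, 0 <= G x) ->
  intd (fun x => F x + G x) = intd F + intd G.
Proof.
elim: d F G => [//|d IH] F G mF mG F0 G0 /=.
rewrite -ge0_integralD//; first last.
- exact: measurable_intd_slice.
- by move=> *; exact: intd_ge0.
- exact: measurable_intd_slice.
- by move=> *; exact: intd_ge0.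
by apply: eq_integral => t _; rewrite IH//; exact: measurable_slice.
Qed.

Lemma intdZ d (k : \bar R) (F : 'rV[R]_d -> \bar R) :
  measurable_fun setT F -> (forall x, 0 <= F x) -> 0 <= k ->
  intd (fun x => k * F x) = k * intd F.
Proof.
elim: d F => [//|d IH] F mF F0 k0 /=.
rewrite -ge0_integralZl//; first last.
- by move=> *; exact: intd_ge0.
- exact: measurable_intd_slice.
by apply: eq_integral => t _; rewrite IH//; exact: measurable_slice.
Qed.

(** Induction on d: the outermost coordinate of the vector is exchanged with t by Tonelli in the
    plane. *)
Lemma intd_tonelli d (G : R -> 'rV[R]_d -> \bar R) :
  measurable_fun setT (fun z : measurableTypeR R * 'rV[R]_d => G z.1 z.2) ->
  (forall t x, 0 <= G t x) ->
  intd (fun x => \int[leb]_t G t x) = \int[leb]_t intd (G t).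
Proof.
elim: d G => [//|d IH] G mG G0 /=.
have mG3 : measurable_fun setT
    (fun z : (measurableTypeR R * measurableTypeR R) * 'rV[R]_d => G z.1.2 (row_mx (const_mx z.1.1 : 'rV_1) z.2)).
  apply: (measurable_comp2 mG); first by apply: measurableT_comp.
  by apply: measurable_row_mx => //; apply: measurableT_comp.
transitivity (\int[leb]_u \int[leb]_t intd (fun v : 'rV_d => G t (row_mx (const_mx u : 'rV_1) v))).
  apply: eq_integral => u _; apply: IH => //.
  pose f (z : measurableTypeR R * 'rV[R]_d) : measurableTypeR R * measurableTypeR R := (u, z.1).
  apply: (@measurable_comp2 _ _ _ _ _ _ _ _ (fun p v => G p.2 (row_mx (const_mx p.1 : 'rV_1) v)) f snd mG3) => //.
  by apply: measurable_fun_pair.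
pose H (z : measurableTypeR R * measurableTypeR R) := intd (fun v : 'rV_d => G z.2 (row_mx (const_mx z.1 : 'rV_1) v)).
have mH : measurable_fun setT H.
  exact: (@measurable_intd _ _ _ (fun z : measurableTypeR R * measurableTypeR R => fun v => G z.2 (row_mx (const_mx z.1 : 'rV_1) v))).
by rewrite (@fubini_tonelli _ _ _ _ R leb leb H)// => z; exact: intd_ge0.
Qed.

Lemma measurable_scale d (l : R) : measurable_fun setT (fun x : 'rV[R]_d => l *: x).
Proof.
apply: measurable_fun_rV => i; under eq_fun do rewrite mxE.
by apply: measurable_funM => //; exact: measurable_coord.
Qed.

Lemma measurable_rVD disp (T : measurableType disp) d (f g : T -> 'rV[R]_d) :
  measurable_fun setT f -> measurable_fun setT g ->
  measurable_fun setT (fun x => f x + g x)%R.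
Proof.
move=> mf mg; apply: measurable_fun_rV => i; under eq_fun do rewrite mxE.
by apply: measurable_funD => //; apply: measurableT_comp (measurable_coord i) _.
Qed.

Lemma intd_shift d (c : 'rV[R]_d) (G : 'rV[R]_d -> \bar R) :
  measurable_fun setT G -> (forall x, 0 <= G x) ->
  intd (fun x => G (x + c)%R) = intd G.
Proof.
elim: d c G => [|d IH] c G mG G0 /=.
  by congr G; apply/matrixP => i [].
have E t (v : 'rV[R]_d) : ((row_mx (const_mx t : 'rV_1) v : 'rV[R]_d.+1) + c =
    row_mx (const_mx (t + c ord0 ord0) : 'rV_1) (v + \row_j c ord0 (lift ord0 j)))%R.
  apply/rowP => i; rewrite mxE.
  have [j ->|j ->] := fintype.split_ordP (i : 'I_(1 + d)).
    rewrite !(@row_mxEl _ 1 1 d) !mxE; congr (_ + c ord0 _)%R.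
    by apply: val_inj; rewrite /= ord1.
  rewrite !(@row_mxEr _ 1 1 d) !mxE; congr (_ + c ord0 _)%R.
  exact: val_inj.
rewrite -[RHS](integral_shift (c ord0 ord0)).
- apply: eq_integral => t _; under eq_intd do rewrite E.
  by rewrite (IH _ (fun v => G (row_mx (_ : 'rV_1) v)))//; exact: measurable_slice.
- exact: measurable_intd_slice.
- by move=> t; exact: intd_ge0.
Qed.

Lemma intd_scale d (l : R) (G : 'rV[R]_d -> \bar R) : l != 0%R ->
  measurable_fun setT G -> (forall x, 0 <= G x) ->
  (`|l| ^+ d)%:E * intd (fun x => G (l *: x)%R) = intd G.
Proof.
move=> l0; elim: d G => [|d IH] G mG G0 /=.
  by rewrite expr0 mul1e; congr G; apply/matrixP => i [].
have E t (v : 'rV[R]_d) : (l *: (row_mx (const_mx t : 'rV_1) v : 'rV[R]_d.+1) =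
    row_mx (const_mx (l * t) : 'rV_1) (l *: v))%R.
  apply: (etrans (@scale_row_mx _ 1 1 d _ _ _)); congr row_mx.
  by apply/matrixP => i j; rewrite !mxE.
rewrite exprS EFinM -muleA -ge0_integralZl//; first last.
- by move=> t _; exact: intd_ge0.
- apply: (@measurable_intd_slice _ (fun x => G (l *: x)%R)) => //.
  by apply: (measurableT_comp mG); exact: measurable_scale.
rewrite -[RHS](integral_scale l0).
- congr (_ * _); apply: eq_integral => t _; under eq_intd do rewrite E.
  by rewrite (IH (fun v => G (row_mx (_ : 'rV_1) v)))//; exact: measurable_slice.
- exact: measurable_intd_slice.
- by move=> t; exact: intd_ge0.
Qed.

(** The origin lies on the hyperplane where the first coordinate vanishes, and that hyperplane is
    null because a point of the line is. *)
Lemma intd_null0 d (G : 'rV[R]_d -> \bar R) : (0 < d)%N ->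
  measurable_fun setT G -> (forall x, 0 <= G x) ->
  intd G = intd (fun x => G x * (x != 0%R)%:R%:E).
Proof.
case: d G => // d G _ mG G0; apply/eqP; rewrite eq_le; apply/andP; split; last first.
  apply: le_intd => x; first by rewrite mule_ge0.
  by case: (x != 0%R); rewrite ?mule1 ?mule0.
rewrite /= integral_null0//; first last.
- by move=> t; exact: intd_ge0.
- exact: measurable_intd_slice.
apply: le_lower_integral => t.
  by rewrite mule_ge0//; exact: intd_ge0.
have [->|t0] := eqVneq t 0%R; first by rewrite mule0 intd_ge0// => x; rewrite mule_ge0.
rewrite mule1; apply: le_intd => // v.
rewrite (_ : _ != _) ?mule1//; apply: contra t0 => /eqP /rowP /(_ ord0).
have -> : ord0 = lshift d (ord0 : 'I_1) :> 'I_(1 + d) by exact: val_inj.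
by rewrite (@row_mxEl _ 1 1 d) !mxE => ->.
Qed.

End intd_theory.

Lemma measurable_fun_powR disp (T : measurableType disp) (R : realType)
    (f : T -> R) (p : R) :
  measurable_fun setT f -> measurable_fun setT (fun t => f t `^ p).
Proof. exact: (@measurableT_comp _ _ _ _ _ _ (fun x => x `^ p)). Qed.

(** * Euclidean inner product and norm *)

Section euclidean.
Variable R : realType.
Variable d : nat.
Implicit Types x y z : 'rV[R]_d.

Definition dot x y : R := \sum_(i < d) x ord0 i * y ord0 i.

Lemma dotC x y : dot x y = dot y x.
Proof. by apply: eq_bigr => i _; rewrite mulrC. Qed.

Lemma dotDl x y z : dot (x + y) z = dot x z + dot y z.
Proof. by rewrite -big_split/=; apply: eq_bigr => i _; rewrite mxE mulrDl. Qed.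

Lemma dotZl l x y : dot (l *: x) y = l * dot x y.
Proof. by rewrite mulr_sumr; apply: eq_bigr => i _; rewrite mxE mulrA. Qed.

Lemma dot0l x : dot 0 x = 0.
Proof. by rewrite /dot big1// => i _; rewrite mxE mul0r. Qed.

Lemma dotDr x y z : dot z (x + y) = dot z x + dot z y.
Proof. by rewrite dotC dotDl !(dotC z). Qed.

Lemma dotZr l x y : dot y (l *: x) = l * dot y x.
Proof. by rewrite dotC dotZl (dotC y). Qed.

Lemma norm2_ge0 x : 0 <= norm2 x. Proof. exact: sqrtr_ge0. Qed.

Lemma sqr_norm2 x : norm2 x ^+ 2 = dot x x.
Proof.
rewrite sqr_sqrtr; last by apply: sumr_ge0 => i _; exact: sqr_ge0.
by apply: eq_bigr => i _; rewrite expr2.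
Qed.

Lemma norm2_eq0 x : (norm2 x == 0) = (x == 0).
Proof.
apply/eqP/eqP => [x0|->]; last first.
  by rewrite /norm2 big1 ?sqrtr0// => i _; rewrite mxE expr0n.
have /psumr_eq0P H : dot x x = 0 by rewrite -sqr_norm2 x0 expr0n.
apply/rowP => i; rewrite mxE; apply/eqP.
rewrite -[_ == 0]orbb -mulf_eq0; by apply/eqP/H => // j _; rewrite -expr2 sqr_ge0.
Qed.

Lemma norm2_gt0 x : (0 < norm2 x) = (x != 0).
Proof. by rewrite lt0r norm2_eq0 norm2_ge0 andbT. Qed.

Lemma norm2Z l x : norm2 (l *: x) = `|l| * norm2 x.
Proof.
apply/eqP; rewrite -(@eqrXn2 _ 2)// ?mulr_ge0 ?norm2_ge0//.
by rewrite exprMn !sqr_norm2 dotZl dotZr real_normK ?num_real// mulrA -expr2.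
Qed.

Lemma norm2_normalize x : x != 0 -> norm2 ((norm2 x)^-1 *: x) = 1.
Proof.
move=> x0; rewrite norm2Z ger0_norm ?invr_ge0 ?norm2_ge0//.
by rewrite mulVf// norm2_eq0.
Qed.

Lemma sqr_norm2D x y :
  norm2 (x + y) ^+ 2 = norm2 x ^+ 2 + 2 * dot x y + norm2 y ^+ 2.
Proof. by rewrite !sqr_norm2 dotDl !dotDr (dotC y x); ring. Qed.

Lemma sqr_norm2B x y :
  norm2 (x - y) ^+ 2 = norm2 x ^+ 2 - 2 * dot x y + norm2 y ^+ 2.
Proof.
rewrite sqr_norm2D -scaleN1r dotZr norm2Z normrN1 mul1r; ring.
Qed.

Lemma norm2N x : norm2 (- x) = norm2 x.
Proof. by rewrite -scaleN1r norm2Z normrN1 mul1r. Qed.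

(** Cauchy-Schwarz, from expanding the squared norm of |y| x - |x| y and dividing by 2 |x| |y|. *)
Lemma dot_le x y : dot x y <= norm2 x * norm2 y.
Proof.
have [->|y0] := eqVneq y 0.
  by rewrite dotC dot0l mulr_ge0 ?norm2_ge0.
have ny : 0 < norm2 y by rewrite norm2_gt0.
have : 0 <= norm2 (norm2 y *: x - norm2 x *: y) ^+ 2 by exact: sqr_ge0.
rewrite sqr_norm2B dotZl dotZr !norm2Z !ger0_norm ?norm2_ge0//.
have [x0|xn0] := eqVneq (norm2 x) 0.
  have -> : x = 0 by apply/eqP; rewrite -norm2_eq0 x0.
  by rewrite dot0l mulr_ge0 ?norm2_ge0.
have nx : 0 < norm2 x by rewrite lt0r xn0 norm2_ge0.
move=> H; rewrite -subr_ge0 -(@pmulr_rge0 _ (2 * (norm2 x * norm2 y))).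
  by rewrite [leRHS](_ : _ = (norm2 y * norm2 x) ^+ 2 - 2 * (norm2 y * (norm2 x * dot x y)) + (norm2 x * norm2 y) ^+ 2)//; ring.
by rewrite !mulr_gt0.
Qed.

Lemma dot_ge x y : - (norm2 x * norm2 y) <= dot x y.
Proof.
by rewrite lerNl -mulN1r -dotZl scaleN1r (le_trans (dot_le _ _))// norm2N.
Qed.

Lemma ler_norm2D x y : norm2 (x + y) <= norm2 x + norm2 y.
Proof.
rewrite -(@ler_pXn2r _ 2)// ?nnegrE ?addr_ge0 ?norm2_ge0// sqr_norm2D.
have := dot_le x y; lra.
Qed.

Lemma measurable_dot disp (T : measurableType disp) (f g : T -> 'rV[R]_d) :
  measurable_fun setT f -> measurable_fun setT g ->
  measurable_fun setT (fun t => dot (f t) (g t)).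
Proof.
move=> mf mg; apply: measurable_sum => i.
by apply: measurable_funM; apply: measurableT_comp (measurable_coord i) _.
Qed.

Lemma measurable_norm2 : measurable_fun setT (@norm2 R d).
Proof.
have -> : @norm2 R d = fun x => (dot x x) `^ (2^-1).
  apply/funext => x; rewrite powR12_sqrt -?sqr_norm2 ?sqr_ge0//.
  by rewrite sqrtr_sqr ger0_norm// norm2_ge0.
apply: measurable_fun_powR; exact: measurable_dot.
Qed.

Lemma measurable_norm2_comp disp (T : measurableType disp) (f : T -> 'rV[R]_d) :
  measurable_fun setT f -> measurable_fun setT (fun t => norm2 (f t)).
Proof. exact: (measurableT_comp measurable_norm2). Qed.

Lemma measurable_rVZ disp (T : measurableType disp) (l : T -> R) (f : T -> 'rV[R]_d) :
  measurable_fun setT l -> measurable_fun setT f ->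
  measurable_fun setT (fun t => l t *: f t).
Proof.
move=> ml mf; apply: measurable_fun_rV => i; under eq_fun do rewrite mxE.
by apply: measurable_funM => //; apply: measurableT_comp (measurable_coord i) _.
Qed.

End euclidean.

Lemma measurable_natb disp (T : measurableType disp) (R : realType) (b : T -> bool) :
  measurable_fun setT b -> measurable_fun setT (fun t => (b t)%:R : R).
Proof.
move=> mb; rewrite (_ : (fun t => _) = fun t => if b t then 1 else 0 : R).
  exact: measurable_fun_ifT.
by apply/funext => t; case: (b t).
Qed.

Lemma indic_bool (T : Type) (R : realType) (b : T -> bool) x :
  \1_[set y | b y] x = (b x)%:R :> R.
Proof. by rewrite indicE mem_setE. Qed.

Lemma measurable_comp_mull disp (V : measurableType disp) (R : realType) (l : R) (f : R -> V) :
  measurable_fun setT f -> measurable_fun setT (fun t => f (l * t)).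
Proof.
move=> mf; apply: (@measurableT_comp _ _ _ _ _ _ f _ (fun t => l * t)) => //.
exact: mulrl_measurable.
Qed.

(** * Polar coordinates by averaging over a shell *)

Section polar.
Variable R : realType.
Local Open Scope ereal_scope.
Notation leb := (@lebesgue_measure R).

Definition radial_integral (d : nat) (g : R -> \bar R) : \bar R :=
  \int[leb]_t (((0 < t)%R%:R * t ^+ d.-1)%:E * g t).

Definition shell (d : nat) (z : 'rV[R]_d) : bool := (1 < norm2 z <= 2)%R.

(* Integration of [h] against surface measure, up to a constant factor: the
   sphere is thickened to a shell on which the direction is averaged. *)
Definition sphere_integral (d : nat) (h : 'rV[R]_d -> \bar R) : \bar R :=
  intd (fun z => ((shell z)%:R * (norm2 z ^+ d)^-1)%:E * h ((norm2 z)^-1 *: z)%R).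

(** The dt/t-measure of the dilations that carry a given nonzero point into the shell, namely ln 2.
    Only its being positive and finite is used. *)
Definition shell_constant : \bar R :=
  \int[leb]_t ((2^-1 <= t < 1)%R%:R * t^-1)%:E.

Lemma measurable_inv_ge0 disp (T : measurableType disp) (f : T -> R) :
  (forall t, (0 <= f t)%R) -> measurable_fun setT f ->
  measurable_fun setT (fun t => (f t)^-1)%R.
Proof.
move=> f0 mf; under eq_fun do rewrite -powR_inv1//.
exact: measurable_fun_powR.
Qed.

Lemma measurable_pos_inv : measurable_fun setT (fun t : R => ((0 < t)%R%:R * t^-1)%R).
Proof.
rewrite (_ : (fun _ => _) = fun t : R => ((0 < t)%R%:R * `|t|^-1)%R); last first.
  apply/funext => t; case: ltP => [t0|]; last by rewrite !mul0r.
  by rewrite gtr0_norm.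
apply: measurable_funM.
  by apply: measurable_natb; exact: measurable_fun_ltr.
by apply: measurable_inv_ge0 => //; exact: normr_measurable.
Qed.

Lemma measurable_shell d : measurable_fun setT (@shell d).
Proof.
apply: measurable_and.
- by apply: measurable_fun_ltr => //; exact: measurable_norm2.
- by apply: measurable_fun_ler => //; exact: measurable_norm2.
Qed.

Lemma shell_constant_integrand (t : R) :
  ((2^-1 <= t < 1)%R%:R * t^-1 = (2^-1 <= t < 1)%R%:R * ((0 < t)%R%:R * t^-1) :> R)%R.
Proof.
case: andP => [[t0 _]|]; last by rewrite !mul0r.
by rewrite (lt_le_trans _ t0) ?mul1r.
Qed.

Lemma measurable_shell_constant_integrand :
  measurable_fun setT (fun t : R => ((2^-1 <= t < 1)%R%:R * t^-1)%:E).
Proof.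
apply/measurable_EFinP; under eq_fun do rewrite shell_constant_integrand.
apply: measurable_funM; last exact: measurable_pos_inv.
apply: measurable_natb; apply: measurable_and.
- exact: measurable_fun_ler.
- exact: measurable_fun_ltr.
Qed.

Lemma shell_constant_integrand_ge0 (t : R) :
  (0 <= (2^-1 <= t < 1)%R%:R * t^-1)%R.
Proof.
case: andP => [[t0 _]|]; last by rewrite !mul0r.
by rewrite mul1r invr_ge0 (le_trans _ t0).
Qed.

Lemma shell_constant_bounds : 2^-1%:E <= shell_constant <= 1%:E.
Proof.
have E c : (0 <= c)%R -> \int[leb]_t ((2^-1 <= t < 1)%R%:R * c)%:E = (c * 2^-1)%:E.
  move=> c0; under eq_integral do rewrite mulrC EFinM.
  have m1 : measurable (`[(2^-1)%R, 1%R[%classic : set R) by exact: measurable_itv.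
  rewrite ge0_integralZl//; last first.
    apply/measurable_EFinP; apply: measurable_natb; apply: measurable_and.
      exact: measurable_fun_ler.
    exact: measurable_fun_ltr.
  have -> : \int[leb]_t ((2^-1 <= t < 1)%R%:R)%:E = leb (`[(2^-1)%R, 1%R[%classic : set R).
    rewrite -[in RHS](setIT `[(2^-1)%R, 1%R[%classic) -[RHS]integral_indic//.
    by apply: eq_integral => t _ /=; rewrite indicE mem_setE in_itv.
  rewrite lebesgue_measure_itv/= lte_fin ifT; last by lra.
  by rewrite -EFinB -EFinM; congr EFin; field.
apply/andP; split.
- have := E 1%R ler01; rewrite mul1r => <-.
  apply: le_lower_integral => t; rewrite lee_fin ?mulr_ge0//.
  case: andP => [[t0 t1]|]; last by rewrite !mul0r.
  by rewrite !mul1r invf_ge1 ?ltW// (lt_le_trans _ t0).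
- have := E 2%R (ler0n _ 2); rewrite divff ?pnatr_eq0// => <-.
  apply: le_lower_integral => t; rewrite lee_fin.
    exact: shell_constant_integrand_ge0.
  case: andP => [[t0 t1]|]; last by rewrite !mul0r.
  by rewrite !mul1r -[leRHS]invrK lef_pV2 ?posrE// (lt_le_trans _ t0).
Qed.

Lemma shell_dilation d (y : 'rV[R]_d) (t : R) : (0 < t)%R -> y != 0%R ->
  shell (t^-1 *: y) = (2^-1 <= (norm2 y)^-1 * t < 1)%R.
Proof.
move=> t0; rewrite -norm2_gt0 => y0.
rewrite /shell norm2Z gtr0_norm ?invr_gt0// ltr_pdivlMl// mulr1 andbC.
congr (_ && _); last by rewrite ltr_pdivrMl// mulr1.
by rewrite ler_pdivrMl// ler_pdivlMl// ler_pdivrMr.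
Qed.

(** Under t = |y| u the condition that y / t lies in the shell becomes 1/2 <= u < 1, and dt/t is
    invariant under this substitution. *)
Lemma shell_average d (y : 'rV[R]_d) :
  \int[leb]_t ((0 < t)%R%:R * (shell (t^-1 *: y))%:R * t^-1)%:E =
  shell_constant * (y != 0%R)%:R%:E.
Proof.
have [->|y0] := eqVneq y 0%R.
  rewrite mule0; under eq_integral => t _.
    rewrite scaler0 /shell (_ : norm2 0 = 0)%R ?ltr10 ?mulr0 ?mul0r; last by apply/eqP; rewrite norm2_eq0.
  over.
  exact: integral0.
have ny0 : (0 < norm2 y)%R by rewrite norm2_gt0.
rewrite mule1 /shell_constant.
rewrite -[RHS](@integral_scale_pos _ (norm2 y)^-1); last 3 first.
- by rewrite invr_gt0.
- exact: measurable_shell_constant_integrand.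
- by move=> t; rewrite lee_fin shell_constant_integrand_ge0.
rewrite -[RHS]ge0_integralZl//; last 3 first.
- exact: (measurable_comp_mull _ measurable_shell_constant_integrand).
- by move=> t _; rewrite lee_fin shell_constant_integrand_ge0.
- by rewrite lee_fin invr_ge0 norm2_ge0.
apply: eq_integral => t _; rewrite -EFinM; congr EFin.
have [t0|t0] := ltP 0%R t.
  rewrite shell_dilation// mul1r invfM invrK mulrCA; congr (_ * _)%R.
  by rewrite mulrA mulVf ?gt_eqF// mul1r.
rewrite !mul0r; case: andP => [[h _]|]; last by rewrite mul0r mulr0.
have : ((norm2 y)^-1 * t <= 0)%R by rewrite pmulr_rle0 ?invr_gt0.
by move/(le_trans h); rewrite leNgt invr_gt0 ltr0n.
Qed.

Section polar_formula.
Variable d : nat.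
Hypothesis d_gt0 : (0 < d)%N.
Implicit Types (G : 'rV[R]_d -> \bar R) (g : R -> \bar R).

Definition ray G (theta : 'rV[R]_d) : \bar R :=
  radial_integral d (fun t => G (t *: theta)).

Lemma radial_weight_ge0 (t : R) : 0 <= ((0 < t)%R%:R * t ^+ d.-1)%:E.
Proof.
rewrite lee_fin; case: ltP => [t0|]; last by rewrite mul0r.
by rewrite mul1r exprn_ge0// ltW.
Qed.

Lemma measurable_radial_weight :
  measurable_fun setT (fun t : R => ((0 < t)%R%:R * t ^+ d.-1)%:E).
Proof.
apply/measurable_EFinP; apply: measurable_funM.
  by apply: measurable_natb; exact: measurable_fun_ltr.
exact: measurable_funX.
Qed.

Lemma shell_weight_ge0 (z : 'rV[R]_d) :
  0 <= ((shell z)%:R * (norm2 z ^+ d)^-1)%:E.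
Proof. by rewrite lee_fin mulr_ge0// invr_ge0 exprn_ge0// norm2_ge0. Qed.

Lemma measurable_shell_weight :
  measurable_fun setT (fun z : 'rV[R]_d => ((shell z)%:R * (norm2 z ^+ d)^-1)%:E).
Proof.
apply/measurable_EFinP; apply: measurable_funM.
  by apply: measurable_natb; exact: measurable_shell.
apply: measurable_inv_ge0; first by move=> z; rewrite exprn_ge0// norm2_ge0.
by apply: measurable_funX; exact: measurable_norm2.
Qed.

Lemma radial_integral_ge0 g : (forall t, 0 <= g t) -> 0 <= radial_integral d g.
Proof.
by move=> g0; apply: integral_ge0 => t _; rewrite mule_ge0// radial_weight_ge0.
Qed.

Lemma radial_integralZ (c : \bar R) g : measurable_fun setT g -> (forall t, 0 <= g t) ->
  0 <= c -> radial_integral d (fun t => c * g t) = c * radial_integral d g.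
Proof.
move=> mg g0 c0; rewrite /radial_integral -ge0_integralZl//.
- by apply: eq_integral => t _; rewrite muleCA.
- apply: emeasurable_funM => //; exact: measurable_radial_weight.
- by move=> t _; rewrite mule_ge0// radial_weight_ge0.
Qed.

Lemma measurable_ray G : measurable_fun setT G -> (forall x, 0 <= G x) ->
  measurable_fun setT (ray G).
Proof.
move=> mG G0.
pose H (z : 'rV[R]_d * measurableTypeR R) :=
  ((0 < z.2)%R%:R * z.2 ^+ d.-1)%:E * G (z.2 *: z.1).
apply: (@measurable_fun_fubini_tonelli_F _ _ _ _ R leb H).
  apply: emeasurable_funM.
    exact: (measurableT_comp measurable_radial_weight).
  by apply: (measurableT_comp mG); exact: measurable_rVZ.
by move=> z; rewrite mule_ge0// radial_weight_ge0.
Qed.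

(** Replacing t by |z| t costs |z| from dt and |z|^(d-1) from the weight; this is where the factor
    |z|^(-d) of [sphere_integral] comes from. *)
Lemma ray_dilation G z : measurable_fun setT G -> (forall x, 0 <= G x) ->
  z != 0%R ->
  ray G z = ((norm2 z ^+ d)^-1)%:E * ray G ((norm2 z)^-1 *: z).
Proof.
move=> mG G0; rewrite -norm2_gt0 => z0; rewrite /ray /radial_integral.
rewrite -[RHS in _ = _ * RHS](@integral_scale_pos _ (norm2 z)) //; last 2 first.
- apply: emeasurable_funM; first exact: measurable_radial_weight.
  by apply: (measurableT_comp mG); exact: measurable_rVZ.
- by move=> t; rewrite mule_ge0// radial_weight_ge0.
rewrite muleA -EFinM -[RHS]ge0_integralZl//; last 2 first.
- by move=> t _; rewrite mule_ge0// radial_weight_ge0.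
- by rewrite lee_fin mulr_ge0// ?invr_ge0 ?exprn_ge0// norm2_ge0.
apply: eq_integral => t _; rewrite muleA -EFinM scalerA.
congr (_%:E * G _); last first.
  by rewrite mulrAC divff ?mul1r ?gt_eqF.
rewrite pmulr_rgt0//; case: (0 < t)%R; last by rewrite !mul0r mulr0.
rewrite !mul1r exprMn (_ : norm2 z ^+ d = norm2 z ^+ d.-1 * norm2 z)%R.
  by field; rewrite expf_neq0 gt_eqF.
  by rewrite -exprSr prednK.
apply: emeasurable_funM.
  exact: (measurable_comp_mull _ measurable_radial_weight).
by apply: (measurableT_comp mG); exact: measurable_rVZ.
Qed.

(** [shell_constant] is expanded as an average over t, the integrals are exchanged, y = t z is
    substituted, and the integrals are exchanged back. The inner integral is then [ray G z], which
    by homogeneity depends on z only through its direction and a power of |z|. *)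
Lemma polar G : measurable_fun setT G -> (forall x, 0 <= G x) ->
  shell_constant * intd G = sphere_integral (ray G).
Proof.
move=> mG G0.
have k0 : 0 <= shell_constant.
  by case/andP: shell_constant_bounds => + _; apply: le_trans; rewrite lee_fin.
rewrite (intd_null0 d_gt0)// -intdZ//; last 2 first.
- apply: emeasurable_funM => //; apply/measurable_EFinP; apply: measurable_natb.
  rewrite (_ : (fun x => _) = fun x : 'rV[R]_d => 0 < norm2 x)%R; last first.
    by apply/funext => x; rewrite norm2_gt0.
  by apply: measurable_fun_ltr => //; exact: measurable_norm2.
- by move=> x; rewrite mule_ge0.
pose w (t : R) (y : 'rV[R]_d) := ((0 < t)%R%:R * (shell (t^-1 *: y))%:R * t^-1)%R.
have w0 t y : (0 <= w t y)%R.
  rewrite /w; case: ltP => [t0|]; last by rewrite !mul0r.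
  by rewrite !mulr_ge0// invr_ge0 ltW.
have mw : measurable_fun setT (fun z : measurableTypeR R * 'rV[R]_d => w z.1 z.2).
  have -> : (fun z : measurableTypeR R * 'rV[R]_d => w z.1 z.2) =
     fun z => ((shell (((0 < z.1)%R%:R * z.1^-1) *: z.2))%:R * ((0 < z.1)%R%:R * z.1^-1))%R.
    apply/funext => z; rewrite /w; case: (0 < z.1)%R; last by rewrite !mul0r mulr0.
    by rewrite !mul1r.
  have mp : measurable_fun setT (fun z : measurableTypeR R * 'rV[R]_d => ((0 < z.1)%R%:R * z.1^-1)%R).
    exact: (measurableT_comp measurable_pos_inv).
  apply: measurable_funM => //; apply: measurable_natb.
  by apply: (measurableT_comp (@measurable_shell d)); exact: measurable_rVZ.
transitivity (intd (fun y => \int[leb]_t ((w t y)%:E * G y))).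
  apply: eq_intd => y; rewrite muleCA -shell_average -ge0_integralZl//.
  - by apply: eq_integral => t _; rewrite muleC.
  - apply/measurable_EFinP.
    exact: (@measurableT_comp _ _ _ _ _ _ (fun z : measurableTypeR R * 'rV[R]_d => w z.1 z.2) _ (fun t => (t, y))).
  - by move=> t _; rewrite lee_fin w0.
have mwG : measurable_fun setT (fun z : measurableTypeR R * 'rV[R]_d => (w z.1 z.2)%:E * G z.2).
  by apply: emeasurable_funM; [exact/measurable_EFinP|exact: (measurableT_comp mG)].
rewrite (@intd_tonelli _ _ (fun t y => (w t y)%:E * G y))//; last first.
  by move=> t y; rewrite mule_ge0// lee_fin.
(* Substitution y = t z for each t > 0: the Jacobian t^d and the factor 1/t of dt/t combine into the
   weight t^(d-1). *)
transitivity (\int[leb]_t intd (fun z : 'rV[R]_d =>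
    (shell z)%:R%:E * (((0 < t)%R%:R * t ^+ d.-1)%:E * G (t *: z)))).
  apply: eq_integral => t _; have [t0|t0] := ltP 0%R t; last first.
    rewrite /w (_ : 0 < t = false)%R; last by rewrite ltNge t0.
    by apply: eq_intd => z; rewrite !mul0r !mul0e mule0.
  rewrite -[LHS](@intd_scale _ _ t); last 3 first.
  - by rewrite gt_eqF.
  - apply: emeasurable_funM => //; apply/measurable_EFinP.
    exact: (@measurableT_comp _ _ _ _ _ _ (fun z : measurableTypeR R * 'rV[R]_d => w z.1 z.2) _ (pair t)).
  - by move=> x; rewrite mule_ge0// lee_fin.
  rewrite -intdZ//; last 2 first.
  - apply: emeasurable_funM.
      apply/measurable_EFinP.
      have mt : measurable_fun setT (fun _ : 'rV[R]_d => t : measurableTypeR R) by [].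
      exact: (@measurable_comp2 _ _ _ _ _ _ _ _ w _ _ mw mt (measurable_scale t)).
    by apply: (measurableT_comp mG); exact: measurable_scale.
  - by move=> x; rewrite mule_ge0// lee_fin.
  apply: eq_intd => z; rewrite /w t0 scalerA mulVf ?gt_eqF// scale1r !mul1r.
  rewrite !muleA -!EFinM gtr0_norm//; congr (_%:E * _).
  rewrite mulrCA; congr (_ * _)%R.
  by rewrite -[in LHS](prednK d_gt0) exprSr mulfK ?gt_eqF.
rewrite -(@intd_tonelli _ _ (fun t z => (shell z)%:R%:E * (((0 < t)%R%:R * t ^+ d.-1)%:E * G (t *: z)))); last 2 first.
- apply: emeasurable_funM.
    apply/measurable_EFinP; apply: measurable_natb.
    exact: (measurableT_comp (@measurable_shell d)).
  apply: emeasurable_funM.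
    exact: (measurableT_comp measurable_radial_weight).
  by apply: (measurableT_comp mG); exact: measurable_rVZ.
- by move=> t z; rewrite !mule_ge0// ?lee_fin// -lee_fin radial_weight_ge0.
apply: eq_intd => z; rewrite ge0_integralZl//; last 2 first.
- apply: emeasurable_funM; first exact: measurable_radial_weight.
  by apply: (measurableT_comp mG); exact: measurable_rVZ.
- by move=> t _; rewrite mule_ge0// radial_weight_ge0.
rewrite -[X in _ * X]/(ray G z).
have [->|z0] := eqVneq z 0%R.
  rewrite /shell (_ : norm2 0 = 0)%R ?ltr10 ?mulr0 ?mul0r ?mul0e//.
  by apply/eqP; rewrite norm2_eq0.
by rewrite [in LHS]ray_dilation// muleA -EFinM.
Qed.

End polar_formula.

End polar.

(** * Integrals of powers on an interval starting at 0 *)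

Section power_integral.
Variable R : realType.
Notation leb := (@lebesgue_measure R).

Lemma integral_powR_cc (q e s : R) : 0 < q -> 0 < e -> e < s ->
  (\int[leb]_(t in `[e, s]) (t `^ (q - 1))%:E = (s `^ q / q - e `^ q / q)%:E)%E.
Proof.
move=> q0 e0 es.
have cpow x r : 0 < x -> {for x, continuous (fun t : R => t `^ r)}.
  move=> x0; apply: differentiable_continuous; apply/derivable1_diffP.
  by apply: derivable_powR; rewrite in_itv/= x0.
have dpow x : 0 < x -> derivable (fun t : R => t `^ q / q) x 1.
  move=> x0; apply: derivableM => //.
  by apply: derivable_powR; rewrite in_itv/= x0.
have cF x : 0 < x -> {for x, continuous (fun t : R => t `^ q / q)}.
  by move=> x0; apply: differentiable_continuous; apply/derivable1_diffP/dpow.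
rewrite (@continuous_FTC2 _ _ (fun t => t `^ q / q)) ?EFinB//.
- apply: continuous_in_subspaceT => x; rewrite inE/= in_itv/= => /andP[ex _].
  by apply: cpow; exact: lt_le_trans ex.
- split.
  + by move=> x; rewrite in_itv/= => /andP[ex _]; apply: dpow; exact: lt_trans ex.
  + by apply: cvg_at_right_filter; apply: cF.
  + by apply: cvg_at_left_filter; apply: cF; exact: lt_trans es.
- move=> x; rewrite in_itv/= => /andP[ex _].
  have x0 : 0 < x by exact: lt_trans ex.
  rewrite derive1E deriveM//; last by apply: derivable_powR; rewrite in_itv/= x0.
  rewrite derive_cst scaler0 add0r -derive1E powR_derive1 ?in_itv/= ?x0//.
  by rewrite /GRing.scale/= mulrA mulVf ?mul1r// gt_eqF.
Qed.

(** For q < 1 the integrand is singular at 0, so the fundamental theorem of calculus is applied on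
    intervals that increase to ]0, s] and the limit is taken by monotone convergence. *)
Lemma integral_powR_oo (q s : R) : 0 < q -> 0 < s ->
  (\int[leb]_(t in `]0%R, s[) (t `^ (q - 1))%:E = (s `^ q / q)%:E)%E.
Proof.
move=> q0 s0.
have mp D : measurable D -> measurable_fun D (fun t : R => (t `^ (q - 1))%:E).
  by move=> mD; apply/measurable_EFinP; apply: measurable_funTS; exact: measurable_powR.
rewrite integral_itv_bndo_bndc; last by apply: mp; exact: measurable_itv.
(* With n + 2 in the denominator the left end is strictly below [s] from n = 0 on. *)
pose e n : R := s * (n.+2%:R)^-1.
have e0 n : 0 < e n by rewrite mulr_gt0// invr_gt0.
have es n : e n < s by rewrite /e gtr_pMr// invf_lt1// ltr1n.
have U : `]0, s]%classic = \bigcup_n `[e n, s]%classic.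
  apply/seteqP; split => x /=; rewrite ?in_itv/=.
    move=> /andP[x0 xs].
    have [n Hn] : exists n : nat, s / x < n%:R.
      by exists (Num.truncn (s / x)).+1; rewrite truncnS_gt.
    exists n => //=; rewrite in_itv/= xs andbT /e ler_pdivrMr//.
    rewrite mulrC -ler_pdivrMr// (le_trans (ltW Hn))// ler_nat.
    by rewrite -addn2 leq_addr.
  case=> n _ /=; rewrite in_itv/= => /andP[ex ->].
  by rewrite (lt_le_trans (e0 n)).
have ndF : nondecreasing_seq (fun n => `[e n, s]%classic).
  move=> n m nm; apply/subsetPset => x /=; rewrite !in_itv/= => /andP[ex ->].
  rewrite andbT (le_trans _ ex)// ler_pM2l// lef_pV2 ?posrE//.
  by rewrite ler_nat !ltnS.
have := @ge0_nondecreasing_set_cvg_integral _ (measurableTypeR R) R _ (fun t => (t `^ (q - 1))%:E) leb ndF.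
rewrite -U => H.
have {}H := H (fun=> measurable_itv _) (fun=> mp _ (measurable_itv _)) (fun _ _ _ => powR_ge0 _ _).
apply: (cvg_unique _ H) => //.
rewrite (_ : (fun i => _) = EFin \o (fun n => s `^ q / q - e n `^ q / q)); last first.
  by apply/funext => n /=; exact: integral_powR_cc.
apply: cvg_EFin; first exact: nearW.
rewrite (_ : fine \o _ = fun n => s `^ q / q - e n `^ q / q)//.
rewrite -[X in _ --> X]subr0; apply: cvgB; first exact: cvg_cst.
rewrite -[X in _ --> X](mul0r q^-1); apply: cvgMl.
have e_cvg : e n @[n --> \oo] --> 0.
  rewrite -[X in _ --> X](mulr0 s); apply: cvgMr.
  rewrite (cvg_shiftS (fun n => n.+1%:R^-1 : R)); exact: cvg_harmonic.
have e_cvg_right : e n @[n --> \oo] --> 0^'+.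
  move=> A A0.
  have K : \forall n \near \oo, 0 < e n -> A (e n) := e_cvg _ A0.
  suff : \forall n \near \oo, A (e n) by [].
  by apply: filterS K => n; apply; exact: e0.
exact: (@cvg_comp _ _ _ e (fun a => a `^ q) _ _ _ e_cvg_right (powR_cvg0 q0)).
Qed.
End power_integral.

(** * Consequences of polar coordinates: comparison on rays, factorization *)

Section polar_corollaries.
Variable R : realType.
Local Open Scope ereal_scope.
Notation leb := (@lebesgue_measure R).
Variable d : nat.
Hypothesis d_gt0 : (0 < d)%N.
Implicit Types (G : 'rV[R]_d -> \bar R) (h : 'rV[R]_d -> R) (g : R -> \bar R).

Lemma shell_constant_gt0 : 0 < shell_constant R.
Proof.
by case/andP: (shell_constant_bounds R) => + _; apply: lt_le_trans; rewrite lte_fin.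
Qed.

Lemma shell_constant_fin_num : shell_constant R \is a fin_num.
Proof.
rewrite ge0_fin_numE ?ltW ?shell_constant_gt0//.
by case/andP: (shell_constant_bounds R) => _ /le_lt_trans; apply; rewrite ltry.
Qed.

Lemma le_sphere_integral (F G : 'rV[R]_d -> \bar R) :
  (forall x, 0 <= F x) -> (forall x, norm2 x = 1%R -> F x <= G x) ->
  sphere_integral F <= sphere_integral G.
Proof.
move=> F0 FG; apply: le_intd => z; first by rewrite mule_ge0// shell_weight_ge0.
have [sz|] := boolP (shell z); last by rewrite !mul0r !mul0e.
have z0 : (0 < norm2 z)%R by case/andP: sz => + _; exact: lt_trans.
apply: lee_wpmul2l; first by rewrite lee_fin mul1r invr_ge0 exprn_ge0// ltW.
by apply: FG; rewrite norm2_normalize// -norm2_gt0.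
Qed.

Lemma eq_sphere_integral (F G : 'rV[R]_d -> \bar R) :
  (forall x, 0 <= F x) -> (forall x, 0 <= G x) ->
  (forall x, norm2 x = 1%R -> F x = G x) ->
  sphere_integral F = sphere_integral G.
Proof.
move=> F0 G0 FG; apply/eqP; rewrite eq_le.
by rewrite !le_sphere_integral// => x /FG ->.
Qed.

Lemma measurable_direction G : measurable_fun setT G ->
  measurable_fun setT (fun z : 'rV[R]_d => G ((norm2 z)^-1 *: z)%R).
Proof.
move=> mG; apply: (measurableT_comp mG); apply: measurable_rVZ => //.
apply: measurable_inv_ge0; [exact: norm2_ge0|exact: measurable_norm2].
Qed.

Lemma sphere_integral_ge0 G : (forall x, 0 <= G x) -> 0 <= sphere_integral G.
Proof. by move=> G0; apply: intd_ge0 => z; rewrite mule_ge0// shell_weight_ge0. Qed.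

Lemma sphere_integralZ (c : \bar R) G : measurable_fun setT G ->
  (forall x, 0 <= G x) -> 0 <= c ->
  sphere_integral (fun x => c * G x) = c * sphere_integral G.
Proof.
move=> mG G0 c0; rewrite /sphere_integral -intdZ//.
- by apply: eq_intd => z; rewrite muleCA.
- by apply: emeasurable_funM; [exact: measurable_shell_weight|exact: measurable_direction].
- by move=> z; rewrite mule_ge0// shell_weight_ge0.
Qed.

Lemma ray_ge0 G (theta : 'rV[R]_d) : (forall x, 0 <= G x) -> 0 <= ray G theta.
Proof. by move=> G0; exact: radial_integral_ge0. Qed.

(** Integrating the inequality over all directions gives [shell_constant] times the claim, and that
    constant is positive and finite. Every comparison with the maximal function on rays passes
    through here. *)
Lemma le_intd_ray (F G : 'rV[R]_d -> \bar R) (c : \bar R) :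
  measurable_fun setT F -> measurable_fun setT G ->
  (forall x, 0 <= F x) -> (forall x, 0 <= G x) -> 0 <= c ->
  (forall theta, norm2 theta = 1%R -> ray F theta <= c * ray G theta) ->
  intd F <= c * intd G.
Proof.
move=> mF mG F0 G0 c0 FG.
rewrite -(@lee_pmul2l _ (shell_constant R))//; last 2 first.
- exact: shell_constant_fin_num.
- exact: shell_constant_gt0.
rewrite muleCA !polar// -sphere_integralZ//.
- by apply: le_sphere_integral => // x; exact: ray_ge0.
- exact: measurable_ray.
- by move=> x; exact: ray_ge0.
Qed.

(** On a ray the factor [h] is constant, so it comes out of the radial integral. Two cones truncated
    at the same radii thus differ only in their angular factors, even when the radial one is
    infinite. *)
Lemma polar_product h g : measurable_fun setT h -> (forall x, (0 <= h x)%R) ->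
  (forall t x, (0 < t)%R -> h (t *: x)%R = h x) ->
  measurable_fun setT g -> (forall t, 0 <= g t) ->
  shell_constant R * intd (fun y => (h y)%:E * g (norm2 y)) =
  sphere_integral (EFin \o h) * radial_integral d g.
Proof.
move=> mh h0 hh mg g0.
have mG : measurable_fun setT (fun y => (h y)%:E * g (norm2 y)).
  apply: emeasurable_funM; first exact/measurable_EFinP.
  by apply: (measurableT_comp mg); exact: measurable_norm2.
rewrite polar//; last by move=> x; rewrite mule_ge0// lee_fin.
rewrite muleC -sphere_integralZ//; last 2 first.
- exact/measurable_EFinP.
- exact: radial_integral_ge0.
apply: eq_sphere_integral.
- by move=> x; apply: ray_ge0 => y; rewrite mule_ge0// lee_fin.
- by move=> x; rewrite mule_ge0 ?radial_integral_ge0//= lee_fin.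
move=> x x1; rewrite [RHS]muleC -radial_integralZ//= ?lee_fin//.
apply: eq_integral => t _; have [t0|t0] := ltP 0%R t; last by rewrite !mul0r !mul0e.
by rewrite hh// norm2Z x1 mulr1 gtr0_norm.
Qed.

Lemma radial_integral_bool (b : R -> bool) (a : R) :
  radial_integral d (fun t => ((b t)%:R * t `^ (- a))%R%:E) =
  \int[leb]_t (((0 < t) && b t)%R%:R * (t `^ (d%:R - a - 1))%R)%:E.
Proof.
apply: eq_integral => t _; rewrite -EFinM; congr EFin.
have [t0|t0] := ltP 0%R t; last by rewrite !mul0r.
rewrite mul1r mulrCA; congr (_ * _)%R.
rewrite -powR_mulrn ?ltW// -powRD; last by apply/implyP => _; rewrite gt_eqF.
congr (_ `^ _)%R; rewrite -[in RHS](prednK d_gt0) -natr1; ring.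
Qed.

Lemma radial_integral_powR (a s : R) : (a < d%:R)%R -> (0 < s)%R ->
  radial_integral d (fun t => ((t <= s)%R%:R * t `^ (- a))%R%:E) =
  (s `^ (d%:R - a) / (d%:R - a))%R%:E.
Proof.
move=> ad s0; rewrite radial_integral_bool -integral_powR_oo ?subr_gt0//.
rewrite integral_itv_bndo_bndc; last first.
  apply/measurable_EFinP; apply: measurable_funTS; exact: measurable_powR.
rewrite [RHS]integral_mkcond; apply: eq_integral => t _.
rewrite patchE mem_setE in_itv/=; case: ifP => _; first by rewrite mul1r.
by rewrite mul0r.
Qed.

Lemma radial_integral_powR_lt (a s : R) : (a < d%:R)%R -> (0 < s)%R ->
  radial_integral d (fun t => ((t < s)%R%:R * t `^ (- a))%R%:E) =
  (s `^ (d%:R - a) / (d%:R - a))%R%:E.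
Proof.
move=> ad s0; rewrite radial_integral_bool -integral_powR_oo ?subr_gt0//.
rewrite [RHS]integral_mkcond; apply: eq_integral => t _.
rewrite patchE mem_setE in_itv/=; case: ifP => _; first by rewrite mul1r.
by rewrite mul0r.
Qed.

Lemma intd0 : intd (fun _ : 'rV[R]_d => 0) = 0.
Proof.
transitivity (intd (fun _ : 'rV[R]_d => (0 : \bar R) * 0)).
  by apply: eq_intd => x; rewrite mul0e.
by rewrite intdZ// mul0e.
Qed.

End polar_corollaries.

(** * Volumes of boxes and balls *)

Section balls.
Variable R : realType.
Local Open Scope ereal_scope.
Notation leb := (@lebesgue_measure R).

Lemma integral_normr_le (c : R) (K : \bar R) : (0 <= c)%R -> 0 <= K ->
  \int[leb]_t (if (`|t| <= c)%R then K else 0) = (2 * c)%:E * K.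
Proof.
move=> c0 K0.
transitivity (\int[leb]_(t in `[(- c)%R, c]) (cst K t)).
  rewrite [RHS]integral_mkcond; apply: eq_integral => t _.
  by rewrite patchE mem_setE in_itv/= ler_norml.
rewrite integral_cst//= muleC; congr (_ * _).
rewrite lebesgue_measure_itv/= lte_fin; case: ltP => [_|cc].
  by rewrite -EFinB; congr EFin; ring.
have -> : c = 0%R by lra.
by rewrite mulr0.
Qed.

Lemma intd_box d (c : R) : (0 <= c)%R ->
  intd (fun x : 'rV[R]_d => ([forall i, `|x ord0 i| <= c]%R)%:R%:E) = ((2 * c) ^+ d)%:E.
Proof.
move=> c0; elim: d => [|d IH] /=.
  by rewrite (_ : [forall i, _] = true)//; apply/forallP => -[].
rewrite exprS EFinM -[in RHS]IH -integral_normr_le//; last exact: intd_ge0.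
apply: eq_integral => t _.
have E (v : 'rV[R]_d) :
    [forall i, `|(row_mx (const_mx t : 'rV_1) v : 'rV[R]_d.+1) ord0 i| <= c]%R =
    (`|t| <= c)%R && [forall i, `|v ord0 i| <= c]%R.
  apply/forallP/andP => [H|[tc /forallP H] i].
    split; last apply/forallP => i.
      by have := H (lshift d (ord0 : 'I_1) : 'I_(1 + d)); rewrite (@row_mxEl _ 1 1 d) mxE.
    by have := H (rshift 1 i : 'I_(1 + d)); rewrite (@row_mxEr _ 1 1 d).
  have [j ->|j ->] := fintype.split_ordP (i : 'I_(1 + d)).
    by rewrite (@row_mxEl _ 1 1 d) mxE.
  by rewrite (@row_mxEr _ 1 1 d).
under eq_intd do rewrite E.
case: ifP => [_|_]//; exact: intd0.
Qed.

Variable d : nat.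

Lemma coord_le_norm2 (x : 'rV[R]_d) i : (`|x ord0 i| <= norm2 x)%R.
Proof.
rewrite -(@ler_pXn2r _ 2)// ?nnegrE ?norm2_ge0// real_normK ?num_real//.
rewrite sqr_norm2 /dot (bigD1 i)//= -expr2 lerDl sumr_ge0// => j _.
by rewrite -expr2 sqr_ge0.
Qed.

(** Its value is never computed: it is a common factor of the masses that are compared.
    [unit_ball_volumeE] makes the use of [fine] harmless. *)
Definition unit_ball_volume : R :=
  fine (intd (fun y : 'rV[R]_d => ((norm2 y <= 1)%R)%:R%:E)).

Hypothesis d_gt0 : (0 < d)%N.

Lemma unit_ball_volumeE :
  intd (fun y : 'rV[R]_d => ((norm2 y <= 1)%R)%:R%:E) = unit_ball_volume%:E.
Proof.
rewrite /unit_ball_volume fineK// ge0_fin_numE; last exact: intd_ge0.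
apply: (@le_lt_trans _ _ ((2 * 1) ^+ d)%:E); last by rewrite ltry.
rewrite -intd_box//; apply: le_intd => // y; rewrite lee_fin ler_nat.
have [y1|//] := boolP (norm2 y <= 1)%R; rewrite lt0b.
by apply/forallP => i; rewrite (le_trans (coord_le_norm2 _ _)).
Qed.

(** The cube of half-side 1/d fits into the unit ball, since d (1/d)^2 <= 1. *)
Lemma unit_ball_volume_gt0 : (0 < unit_ball_volume)%R.
Proof.
rewrite -lte_fin -unit_ball_volumeE.
have d0 : (0 < d%:R^-1 :> R)%R by rewrite invr_gt0 ltr0n.
apply: (@lt_le_trans _ _ ((2 * d%:R^-1) ^+ d)%:E).
  by rewrite lte_fin exprn_gt0// mulr_gt0.
rewrite -intd_box; last exact: ltW.
apply: le_intd => // y; rewrite lee_fin ler_nat.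
case: forallP => // H; rewrite lt0b.
rewrite -(@ler_pXn2r _ 2)// ?nnegrE ?norm2_ge0// expr1n sqr_norm2.
apply: (@le_trans _ _ (\sum_(i < d) (d%:R^-1))%R).
  apply: ler_sum => i _; rewrite -expr2 -real_normK ?num_real//.
  apply: (@le_trans _ _ (d%:R^-1 ^+ 2)%R); first by rewrite ler_pXn2r// nnegrE ltW.
  rewrite expr2 ger_pMl// invf_le1 ?ltr0n//.
  by rewrite ler1n.
by rewrite sumr_const card_ord -[X in (X <= _)%R]mulr_natr mulVf// pnatr_eq0 -lt0n.
Qed.

Lemma measurable_ball2 (x : 'rV[R]_d) r : measurable_fun setT (fun y : 'rV[R]_d => norm2 (y - x) <= r)%R.
Proof.
apply: measurable_fun_ler => //; apply: measurable_norm2_comp.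
exact: measurable_rVD.
Qed.

Lemma measurable_ball2_indic (x : 'rV[R]_d) r :
  measurable_fun setT (fun y : 'rV[R]_d => ((norm2 (y - x) <= r)%R)%:R%:E : \bar R).
Proof. by apply/measurable_EFinP; apply: measurable_natb; exact: measurable_ball2. Qed.

Lemma ball_volume (x : 'rV[R]_d) r : (0 < r)%R ->
  intd (fun y => ((norm2 (y - x) <= r)%R)%:R%:E) = (r ^+ d * unit_ball_volume)%:E.
Proof.
move=> r0.
rewrite -[LHS](intd_shift x); last 2 first.
- exact: measurable_ball2_indic.
- by [].
rewrite -[LHS](@intd_scale _ _ r) ?gt_eqF//; last first.
  under eq_fun do rewrite addrK -[X in norm2 X]subr0.
  exact: measurable_ball2_indic.
rewrite gtr0_norm// EFinM -unit_ball_volumeE; congr (_ * _); apply: eq_intd => y.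
by rewrite addrK norm2Z gtr0_norm// ger_pMr.
Qed.

End balls.

(** * Covering by intervals with overlap at most two *)

Section interval_covering.
Variable R : realType.
Notation leb := (@lebesgue_measure R).

Definition convex_pred (b : R -> bool) :=
  forall x y z, b x -> b y -> x <= z <= y -> b z.

Lemma private_point_overlap N (I : 'I_N -> R -> bool) (J : {set 'I_N}) :
  (forall i, convex_pred (I i)) ->
  (forall i, i \in J -> exists t, I i t /\ forall j, j \in J -> I j t -> j = i) ->
  forall t, (#|[set i in J | I i t]| <= 2)%N.
Proof.
move=> Iconv Hpriv t; rewrite leqNgt; apply/negP => /card_gt2P.
case=> i [j [k [[]]]]; rewrite !inE => /andP[iJ it] /andP[jJ jt] /andP[kJ kt] [ij jk ki].
(* In a minimal subfamily every interval has a private point; two intervals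
   through t with private points on the same side of t coincide, so that at
   most two intervals pass through t. *)
have side a b xa xb : a \in J -> b \in J -> I a t -> I b t -> I a xa -> I b xb ->
    (forall c, c \in J -> I c xa -> c = a) ->
    (forall c, c \in J -> I c xb -> c = b) ->
    (xa <= t) = (xb <= t) -> a = b.
  move=> aJ bJ at_ bt Ia Ib Ha Hb.
  have [xt|xt] := leP xa t => /esym yt.
    have [xy|/ltW yx] := leP xa xb.
      by apply: Hb => //; apply: (Iconv a xa t) => //; rewrite xy.
    by apply/esym/Ha => //; apply: (Iconv b xb t) => //; rewrite yx.
  have {}yt : t < xb by rewrite ltNge yt.
  have [xy|/ltW yx] := leP xa xb.
    by apply/esym/Ha => //; apply: (Iconv b t xb) => //; rewrite ltW.
  by apply: Hb => //; apply: (Iconv a t xa) => //; rewrite ltW.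
have [xi [Ii Hi]] := Hpriv i iJ.
have [xj [Ij Hj]] := Hpriv j jJ.
have [xk [Ik Hk]] := Hpriv k kJ.
have [E|E] := eqVneq (xi <= t) (xj <= t).
  by move/eqP: ij; apply; exact: (side i j xi xj).
have [E'|E'] := eqVneq (xj <= t) (xk <= t).
  by move/eqP: jk; apply; exact: (side j k xj xk).
move/eqP: ki; apply; apply: (side k i xk xi) => //.
by case: (xi <= t) (xj <= t) (xk <= t) E E' => -[] [].
Qed.

(** In a subfamily minimal for inclusion among those with the same union, an interval without a
    point of its own could be discarded. *)
Lemma exists_minimal_cover N (I : 'I_N -> R -> bool) :
  exists J : {set 'I_N},
    (forall t, [exists i, I i t] -> [exists i in J, I i t]) /\
    forall i, i \in J -> exists t, I i t /\ forall j, j \in J -> I j t -> j = i.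
Proof.
pose cover (J : {set 'I_N}) := `[< forall t, [exists i, I i t] -> [exists i in J, I i t] >].
have [J] : {J | minset cover J}.
  apply: ex_minset; exists [set: 'I_N]%SET; apply/asboolP => t /existsP[i Ii].
  by apply/existsP; exists i; rewrite inE.
move=> /minsetP[/asboolP Jcov Jmin]; exists J; split => // i iJ.
apply: contrapT => H.
have : cover (J :\ i).
  apply/asboolP => t /Jcov/existsP[j /andP[jJ jt]].
  have [ji|ji] := eqVneq j i; last first.
    by apply/existsP; exists j; rewrite !inE ji jJ.
  apply: contrapT => /negP /existsPn noj; apply: H; exists t; rewrite -{1}ji.
  split=> // k kJ kt; apply/eqP/negPn/negP => ki.
  by have := noj k; rewrite !inE ki kJ kt.
by move=> /(Jmin _)/(_ (subD1set _ _))/setP/(_ i); rewrite !inE eqxx iJ.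
Qed.

Local Open Scope ereal_scope.

(** The minimal subfamily covers each point of the union at least once, which bounds the left side
    by a sum over the subfamily, and at most twice, which bounds the sum of the g-integrals by twice
    the integral of g. *)
Lemma covering_finite N (I : 'I_N -> R -> bool) (w g : R -> \bar R) (l : R) :
  (forall i, convex_pred (I i)) -> (forall i, measurable_fun setT (I i)) ->
  measurable_fun setT w -> measurable_fun setT g ->
  (forall t, 0 <= w t) -> (forall t, 0 <= g t) -> (0 <= l)%R ->
  (forall i, l%:E * \int[leb]_t ((I i t)%:R%:E * w t) <= \int[leb]_t ((I i t)%:R%:E * g t)) ->
  l%:E * \int[leb]_t ([exists i, I i t]%:R%:E * w t) <= 2%:E * \int[leb]_t g t.
Proof.
move=> Iconv mI mw mg w0 g0 l0 H.
have [J [Jcov Jpriv]] := exists_minimal_cover I.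
have mIh i h : measurable_fun setT h -> measurable_fun setT (fun t => (I i t)%:R%:E * h t : \bar R).
  by move=> mh; apply: emeasurable_funM => //; apply/measurable_EFinP/measurable_natb.
have Ih0 i h t : (forall t, 0 <= h t) -> 0 <= (I i t)%:R%:E * h t :> \bar R.
  by move=> h0; rewrite mule_ge0.
have sumE h t : \sum_(i <- enum J) (I i t)%:R%:E * h t = (#|[set i in J | I i t]|%:R)%:E * h t :> \bar R.
  rewrite big_enum/= -ge0_sume_distrl//; congr (_ * _); rewrite sumEFin; congr EFin.
  rewrite -natr_sum; congr (_%:R)%R.
  rewrite -sum1_card [RHS]big_mkcond [LHS]big_mkcond/=; apply: eq_bigr => i _.
  by rewrite inE; case: (i \in J); case: (I i t).
apply: (@le_trans _ _ (l%:E * \int[leb]_t (\sum_(i <- enum J) ((I i t)%:R%:E * w t)))).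
  apply: lee_wpmul2l => //; apply: le_lower_integral => t; first by rewrite mule_ge0.
  rewrite sumE; apply: lee_wpmul2r => //; rewrite lee_fin ler_nat.
  have [/Jcov/existsP[i /andP[iJ it]]|//] := boolP [exists i, I i t].
  by apply/card_gt0P; exists i; rewrite inE iJ.
rewrite ge0_integral_sum//; last 2 first.
- by move=> i; exact: mIh.
- by move=> i t _; exact: Ih0.
rewrite ge0_sume_distrr; last by move=> i _; apply: integral_ge0 => t _; exact: Ih0.
apply: (@le_trans _ _ (\sum_(i <- enum J) \int[leb]_t ((I i t)%:R%:E * g t))).
  by apply: lee_sum => i _; exact: H.
rewrite -ge0_integral_sum//; last 2 first.
- by move=> i; exact: mIh.
- by move=> i t _; exact: Ih0.
rewrite -ge0_integralZl//; apply: le_lower_integral => t.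
  by apply: sume_ge0 => i _; exact: Ih0.
rewrite sumE; apply: lee_wpmul2r => //.
by rewrite lee_fin ler_nat private_point_overlap.
Qed.

(** The bound for the union of the first N intervals does not depend on N, and these unions
    increase. *)
Lemma covering_countable (I : nat -> R -> bool) (w g : R -> \bar R) (l : R) :
  (forall i, convex_pred (I i)) -> (forall i, measurable_fun setT (I i)) ->
  measurable_fun setT w -> measurable_fun setT g ->
  (forall t, 0 <= w t) -> (forall t, 0 <= g t) -> (0 <= l)%R ->
  (forall i, l%:E * \int[leb]_t ((I i t)%:R%:E * w t) <= \int[leb]_t ((I i t)%:R%:E * g t)) ->
  forall b : R -> bool, (forall t, b t -> exists i, I i t) ->
  l%:E * \int[leb]_t ((b t)%:R%:E * w t) <= 2%:E * \int[leb]_t g t.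
Proof.
move=> Iconv mI mw mg w0 g0 l0 H b Hb.
pose E N t := [exists i : 'I_N, I i t].
have mE N : measurable_fun setT (fun t => (E N t)%:R%:E * w t).
  apply: emeasurable_funM => //; apply/measurable_EFinP/measurable_natb.
  rewrite (_ : E N = fun t => \big[orb/false]_(i < N) I i t); last first.
    apply/funext => t; rewrite big_orE /E.
    by apply/existsP/existsP => -[i Hi]; exists i.
  elim: N => [|N IH].
    by rewrite (_ : (fun _ => _) = cst false)//; apply/funext => t; rewrite big_ord0.
  rewrite (_ : (fun _ => _) = fun t => (\big[orb/false]_(i < N) I i t) || I N t).
    exact: measurable_or.
  by apply/funext => t; rewrite big_ord_recr.
have ndE t : nondecreasing_seq (fun N => (E N t)%:R%:E * w t).
  move=> n m nm; apply: lee_wpmul2r => //; rewrite lee_fin ler_nat.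
  have [/existsP[i it]|//] := boolP (E n t); rewrite lt0b.
  by apply/existsP; exists (widen_ord nm i).
have E0 n t : setT t -> 0 <= (E n t)%:R%:E * w t by move=> _; rewrite mule_ge0.
have cvgE := @cvg_monotone_convergence _ (measurableTypeR R) R leb setT measurableT _ mE
  E0 (fun t _ => ndE t).
have lim_le : \int[leb]_t ((b t)%:R%:E * w t) <= \int[leb]_t limn (fun N => (E N t)%:R%:E * w t).
  apply: le_lower_integral => t; first by rewrite mule_ge0.
  have [/Hb[i it]|_] := boolP (b t); last first.
    rewrite mul0e; apply: lime_ge; first exact: ereal_nondecreasing_is_cvgn.
    by apply: nearW => n; rewrite mule_ge0.
  rewrite mul1e; apply: lime_ge; first exact: ereal_nondecreasing_is_cvgn.
  exists i.+1 => // n /= ni.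
  rewrite (_ : E n t) ?mul1e//; apply/existsP; exists (Ordinal ni); exact: it.
apply: (le_trans (lee_wpmul2l _ lim_le)); first by rewrite lee_fin.
have mono : {homo (fun N => l%:E * \int[leb]_t ((E N t)%:R%:E * w t)) : n m / (n <= m)%N >-> n <= m}.
  move=> n m nm; apply: lee_wpmul2l; first by rewrite lee_fin.
  apply: le_lower_integral => t; first by rewrite mule_ge0.
  exact: ndE.
have {}cvgE := cvgeZl (y := l%:E) isT cvgE.
rewrite -(cvg_lim _ cvgE)//; apply: lime_le; first exact: ereal_nondecreasing_is_cvgn.
by apply: nearW => n; exact: covering_finite.
Qed.

End interval_covering.

(** * Division by a positive finite extended real *)

Section ereal_division.
Variable R : realType.
Local Open Scope ereal_scope.

Lemma lte_pdivl_fin (l x y : \bar R) : 0 < y -> y \is a fin_num ->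
  (l < x * y^-1) = (l * y < x).
Proof.
move=> y0 yf; rewrite -(fineK yf) inver ifF ?lte_pdivlMr//; last first.
  by apply/negbTE; rewrite gt_eqF// fine_gt0// y0 ltey_eq yf.
by rewrite fine_gt0// y0 ltey_eq yf.
Qed.

Lemma lee_pdivr_fin (l x y : \bar R) : 0 < y -> y \is a fin_num ->
  (x * y^-1 <= l) = (x <= l * y).
Proof. by move=> y0 yf; rewrite !leNgt lte_pdivl_fin. Qed.

End ereal_division.

(** * The uncentered maximal function for a power weight on the half-line *)

Section radial_maximal_function.
Variable R : realType.
Notation leb := (@lebesgue_measure R).
Variable e : R.

Definition pos_powR (t : R) : R := (0 < t)%R%:R * t `^ e.
Local Notation w := pos_powR.

Lemma pos_powR_ge0 t : 0 <= w t.
Proof. by rewrite /w mulr_ge0// powR_ge0. Qed.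

Lemma measurable_pos_powR : measurable_fun setT w.
Proof.
apply: measurable_funM; last exact: measurable_powR.
by apply: measurable_natb; exact: measurable_fun_ltr.
Qed.

(** The power is monotone, increasing or decreasing with the sign of [e]; the sum of the two
    endpoint values covers both cases. *)
Lemma pos_powR_bound (a b : R) : 0 < a ->
  forall t, a <= t <= b -> w t <= a `^ e + b `^ e.
Proof.
move=> a0 t /andP[at_ tb]; have t0 : 0 < t by exact: lt_le_trans at_.
rewrite /w t0 mul1r; have [e0|e0] := leP 0 e.
  by rewrite ler_wpDl ?powR_ge0// ge0_ler_powR// nnegrE ltW// (lt_le_trans t0).
rewrite ler_wpDr ?powR_ge0//.
have -> : e = - (- e) by rewrite opprK.
rewrite !(powRN _ (- e)) lef_pV2 ?posrE ?powR_gt0//.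
by rewrite ge0_ler_powR// ?nnegrE ?ltW// oppr_gt0.
Qed.

Lemma pos_powR_lbound (a b : R) : 0 < a -> a < b ->
  exists c, 0 < c /\ forall t, a <= t <= b -> c <= w t.
Proof.
move=> a0 ab; have b0 : 0 < b by exact: lt_trans ab.
exists (Num.min (a `^ e) (b `^ e)); split.
  by rewrite lt_min !powR_gt0.
move=> t /andP[at_ tb]; have t0 : 0 < t by exact: lt_le_trans at_.
rewrite /w t0 mul1r ge_min; have [e0|e0] := leP 0 e.
  by rewrite ge0_ler_powR// nnegrE ltW.
apply/orP; right.
have -> : e = - (- e) by rewrite opprK.
rewrite !(powRN _ (- e)) lef_pV2 ?posrE ?powR_gt0//.
by rewrite ge0_ler_powR// ?nnegrE ?ltW// oppr_gt0.
Qed.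

Local Open Scope ereal_scope.

Definition wmass (b : R -> bool) : \bar R :=
  \int[leb]_t ((b t)%:R%:E * (w t)%:E).

Definition wint (f : R -> R) (b : R -> bool) : \bar R :=
  \int[leb]_t ((b t)%:R%:E * (f t * w t)%:E).

Lemma integral_itv_bool (a b c : R) : (a <= b)%R -> (0 <= c)%R ->
  \int[leb]_t ((a < t < b)%R%:R%:E * c%:E) = (c * (b - a))%:E.
Proof.
move=> ab c0.
transitivity (\int[leb]_(t in `]a, b[) (cst c%:E t)).
  rewrite [RHS]integral_mkcond; apply: eq_integral => t _.
  rewrite patchE mem_setE in_itv/=; case: ifP => _; first by rewrite mul1e.
  by rewrite mul0e.
rewrite integral_cst//= EFinM; congr (_ * _).
rewrite lebesgue_measure_itv/= lte_fin; case: ltP => [_|cc].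
  by rewrite -EFinB.
have -> : a = b by apply/eqP; rewrite eq_le ab cc.
by rewrite subrr.
Qed.

Lemma le_wmass (b b' : R -> bool) : (forall t, b t -> b' t) -> wmass b <= wmass b'.
Proof.
move=> bb; apply: le_lower_integral => t; first by rewrite mule_ge0// lee_fin pos_powR_ge0.
apply: lee_wpmul2r; first by rewrite lee_fin pos_powR_ge0.
by have := bb t; case: (b t) => [->|] //; rewrite lee_fin.
Qed.

Lemma le_wint f (b b' : R -> bool) : (forall t, (0 <= f t)%R) ->
  (forall t, b t -> b' t) -> wint f b <= wint f b'.
Proof.
move=> f0 bb; apply: le_lower_integral => t.
  by rewrite mule_ge0// lee_fin mulr_ge0// pos_powR_ge0.
apply: lee_wpmul2r; first by rewrite lee_fin mulr_ge0// pos_powR_ge0.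
by have := bb t; case: (b t) => [->|] //; rewrite lee_fin.
Qed.

Lemma wmass_ge0 b : 0 <= wmass b.
Proof. by apply: integral_ge0 => t _; rewrite mule_ge0// lee_fin pos_powR_ge0. Qed.

Lemma wint_ge0 f b : (forall t, (0 <= f t)%R) -> 0 <= wint f b.
Proof.
by move=> f0; apply: integral_ge0 => t _; rewrite mule_ge0// lee_fin mulr_ge0// pos_powR_ge0.
Qed.

Lemma wmass_itv_le (a b p q : R) : (0 < a)%R -> (a <= p)%R -> (p <= q)%R -> (q <= b)%R ->
  wmass (fun t => p < t < q)%R <= ((a `^ e + b `^ e) * (q - p))%R%:E.
Proof.
move=> a0 ap pq qb; rewrite -integral_itv_bool; [|exact: pq|exact: addr_ge0 (powR_ge0 _ _) (powR_ge0 _ _)].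
apply: le_lower_integral => t; first by rewrite mule_ge0// lee_fin pos_powR_ge0.
case: andP => [[pt tq]|_]; last by rewrite !mul0e.
by rewrite !mul1e lee_fin pos_powR_bound// (le_trans ap (ltW pt)) (le_trans (ltW tq)).
Qed.

Lemma wmass_itv_gt0 (p q : R) : (0 < p)%R -> (p < q)%R ->
  0 < wmass (fun t => p < t < q)%R.
Proof.
move=> p0 pq; have [c [c0 Hc]] := pos_powR_lbound p0 pq.
apply: (@lt_le_trans _ _ (c * (q - p))%:E).
  by rewrite lte_fin mulr_gt0// subr_gt0.
rewrite -integral_itv_bool; [|exact: ltW|exact: ltW].
apply: le_lower_integral => t; first by rewrite mule_ge0// lee_fin ltW.
case: andP => [[pt tq]|_]; last by rewrite !mul0e.
by rewrite !mul1e lee_fin Hc// !ltW.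
Qed.

Lemma wmass_itv_fin_num (p q : R) : (0 < p)%R -> (p < q)%R ->
  wmass (fun t => p < t < q)%R \is a fin_num.
Proof.
move=> p0 pq; rewrite ge0_fin_numE ?wmass_ge0//.
by apply: (le_lt_trans (@wmass_itv_le p q p q p0 (lexx _) (ltW pq) (lexx _))); rewrite ltry.
Qed.

(** An enumeration of the intervals with rational ends, so that the maximal function is a countable
    supremum. The left end is positive, which keeps the weighted mass finite whatever the exponent;
    codes of no such interval give the empty set. *)
Definition rat_itv (n : nat) (t : R) : bool :=
  if unpickle n is Some pq then
    [&& 0 < ratr pq.1 :> R, ratr pq.1 < t & t < ratr (pq.2 : rat)]%R
  else false.

Lemma rat_itv_spec n (s : R) : rat_itv n s -> exists p q : R,
  [/\ 0 < p, p < q & rat_itv n = (fun t => p < t < q)]%R.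
Proof.
rewrite /rat_itv; case: (unpickle n) => [[p q]|]//= /and3P[p0 ps sq].
exists (ratr p), (ratr q); split => //; first exact: lt_trans sq.
by apply/funext => t; rewrite p0.
Qed.

Lemma measurable_itv_bool (p q : R) : measurable_fun setT (fun t => p < t < q)%R.
Proof. by apply: measurable_and; exact: measurable_fun_ltr. Qed.

Lemma measurable_rat_itv n : measurable_fun setT (rat_itv n).
Proof.
rewrite /rat_itv; case: (unpickle n) => [[p q]|]//=.
by case: (0 < ratr p)%R => //=; exact: measurable_itv_bool.
Qed.

Lemma convex_rat_itv n : convex_pred (rat_itv n).
Proof.
move=> x y z; rewrite /rat_itv; case: (unpickle n) => [[p q]|]//=.
move=> /and3P[-> px _] /and3P[_ _ yq] /andP[xz zy].
by rewrite (lt_le_trans px)// (le_lt_trans zy).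
Qed.

Definition maximal_avg (f : R -> R) (n : nat) (s : R) : \bar R :=
  (rat_itv n s)%:R%:E * (wint f (rat_itv n) * (wmass (rat_itv n))^-1).

(** [esups] from index 0 is the supremum over all n, in a form whose measurability is known. *)
Definition rad_max (f : R -> R) (s : R) : \bar R :=
  esups (fun n => maximal_avg f n s) 0%N.

Variable f : R -> R.
Hypothesis mf : measurable_fun setT f.
Hypothesis f0 : forall t, (0 <= f t)%R.

Lemma maximal_avg_ge0 n s : 0 <= maximal_avg f n s.
Proof. by rewrite mule_ge0// mule_ge0 ?wint_ge0// inve_ge0 wmass_ge0. Qed.

Lemma maximal_avg_le n s : maximal_avg f n s <= rad_max f s.
Proof. by apply: ereal_sup_ubound; exists n. Qed.

Lemma rad_max_ge0 s : 0 <= rad_max f s.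
Proof. exact: le_trans (maximal_avg_ge0 0%N s) (maximal_avg_le 0%N s). Qed.

Lemma measurable_rad_max : measurable_fun setT (rad_max f).
Proof.
apply: measurable_fun_esups => n.
apply: emeasurable_funM => //; apply/measurable_EFinP/measurable_natb.
exact: measurable_rat_itv.
Qed.

Lemma lt_rad_max (l : R) s : (0 <= l)%R -> l%:E < rad_max f s ->
  exists n, rat_itv n s /\ l%:E * wmass (rat_itv n) <= wint f (rat_itv n).
Proof.
move=> l0 /ereal_sup_gt[_ [n _ <-]]; rewrite /maximal_avg.
have [ns|_] := boolP (rat_itv n s); last by rewrite mul0e lte_fin ltNge l0.
rewrite mul1e => H; exists n; split => //.
have [p [q [p0 pq E]]] := rat_itv_spec ns.
rewrite E in H *.
have W0 := wmass_itv_gt0 p0 pq; have Wf := wmass_itv_fin_num p0 pq.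
by apply: ltW; rewrite -lte_pdivl_fin.
Qed.

Lemma rat_itv_le_rad_max (p q : rat) s : (0 < ratr p :> R)%R ->
  (ratr p < s < ratr q)%R ->
  wint f (fun t => ratr p < t < ratr q)%R <=
  rad_max f s * wmass (fun t => ratr p < t < ratr q)%R.
Proof.
move=> p0 psq; have := maximal_avg_le (pickle (p, q)) s.
rewrite /maximal_avg.
have E : rat_itv (pickle (p, q)) = (fun t => ratr p < t < ratr q)%R.
  by apply/funext => t; rewrite /rat_itv pickleK/= p0.
have pq : (ratr p < ratr q :> R)%R by case/andP: psq; exact: lt_trans.
rewrite E psq mul1e lee_pdivr_fin//; first exact: wmass_itv_gt0.
exact: wmass_itv_fin_num.
Qed.

(** A form common to two uses: g = f, and g = f cut off below l / 2. The hypothesis says that an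
    interval with f-average at least l keeps g-average at least l / 2; with the overlap 2 this makes
    the constant 4. *)
Lemma maximal_weak_type (l : R) (b : R -> bool) (g : R -> R) : (0 <= l)%R ->
  measurable_fun setT g -> (forall t, 0 <= g t)%R ->
  (forall n, l%:E * wmass (rat_itv n) <= wint f (rat_itv n) ->
    (l%:E * wmass (rat_itv n) <= 2%:E * wint g (rat_itv n))) ->
  (forall t, b t -> l%:E < rad_max f t) ->
  l%:E * wmass b <= 4%:E * wint g (fun=> true).
Proof.
move=> l0 mg g0 Hg Hb.
(* Intervals with average below l are replaced by the empty set, so that the hypothesis of the
   covering lemma holds for every index. *)
pose I n t := (l%:E * wmass (rat_itv n) <= wint f (rat_itv n)) && rat_itv n t.
have mgw : measurable_fun setT (fun t => (2 * (g t * w t))%:E).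
  by apply/measurable_EFinP; apply: measurable_funM => //; apply: measurable_funM => //; exact: measurable_pos_powR.
have gw0 t : (0 <= g t * w t)%R by rewrite mulr_ge0// pos_powR_ge0.
have := @covering_countable R I (fun t => (w t)%:E) (fun t => (2 * (g t * w t))%:E) l.
move=> /(_ _ _ _ mgw _ _ l0 _ b).
have -> : 4%:E * wint g (fun=> true) = 2%:E * \int[leb]_t ((2 * (g t * w t))%:E) :> \bar R.
  rewrite /wint; under eq_integral do rewrite mul1e.
  under [in RHS]eq_integral do rewrite EFinM.
  rewrite ge0_integralZl//; last 2 first.
  - by apply/measurable_EFinP; apply: measurable_funM => //; exact: measurable_pos_powR.
  - by move=> t _; rewrite lee_fin.
  by rewrite muleA -EFinM; congr (_%:E * _); ring.
apply.
- move=> n x y z; rewrite /I; case: (_ <= _) => //=; exact: convex_rat_itv.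
- move=> n; rewrite /I; case: (_ <= _) => //=; exact: measurable_rat_itv.
- by apply/measurable_EFinP; exact: measurable_pos_powR.
- by move=> t; rewrite lee_fin pos_powR_ge0.
- by move=> t; rewrite lee_fin mulr_ge0.
- move=> n; rewrite /I.
  have [H|_] /= := boolP (l%:E * wmass (rat_itv n) <= wint f (rat_itv n)); last first.
    under eq_integral do rewrite mul0e; rewrite integral0 mule0.
    by apply: integral_ge0 => t _; rewrite mul0e.
  apply: (le_trans (Hg n H)); rewrite /wint -ge0_integralZl//; last 2 first.
  - apply: emeasurable_funM.
      by apply/measurable_EFinP/measurable_natb; exact: measurable_rat_itv.
    by apply/measurable_EFinP; apply: measurable_funM => //; exact: measurable_pos_powR.
  - by move=> t _; rewrite mule_ge0// lee_fin.
  apply: le_lower_integral => t; first by rewrite !mule_ge0// lee_fin.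
  by rewrite muleCA -EFinM.
- move=> t /Hb /(lt_rad_max l0)[n [nt Hn]]; exists n; by rewrite /I Hn nt.
Qed.

Lemma measurable_convex_pred (J : R -> bool) :
  convex_pred J -> measurable_fun setT J.
Proof.
move=> Jconv; apply: (measurable_fun_bool true); rewrite setTI.
apply: is_interval_measurable => x y /= Jx Jy z /= xzy.
exact: (Jconv x y).
Qed.

(** J is enlarged by less than [del] at both ends to an interval with rational ends, for which the
    bound holds by definition. J stays away from 0, so the added mass tends to 0 with [del]. *)
Lemma ray_le_rad_max_bounded (J : R -> bool) (s t1 t2 : R) :
  (0 < t1)%R -> (forall t, J t -> t1 <= t <= t2)%R ->
  convex_pred J -> J s -> rad_max f s \is a fin_num ->
  wint f J <= rad_max f s * wmass J.
Proof.
move=> t10 Jb Jconv Js Mf.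
pose S := [set t | J t].
have S0 : S !=set0 by exists s.
have ubS : has_sup S by split => //; exists t2 => t /Jb/andP[].
have lbS : has_inf S by split => //; exists t1 => t /Jb/andP[].
have iS t : J t -> (inf S <= t)%R by move=> Jt; exact: (@ge_inf _ S lbS.2).
have sS t : J t -> (t <= sup S)%R by move=> Jt; exact: (@ub_le_sup _ S ubS.2).
have t1i : (t1 <= inf S)%R by apply: lb_le_inf => // t /Jb/andP[].
have st2 : (sup S <= t2)%R by apply: ge_sup => // t /Jb/andP[].
have inJ t : (inf S < t < sup S)%R -> J t.
  move=> /andP[/(inf_lt S0)[x Sx xt] /(sup_gt S0)[y Sy ty]].
  by apply: (Jconv x y) => //; rewrite !ltW.
(* Bound for the weight on [t1 / 2, t2 + 1], which contains the enlarged interval because [del] <=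
   t1 / 2 and [del] <= 1. *)
pose C := ((t1 / 2) `^ e + (t2 + 1) `^ e)%R.
have C0 : (0 <= C)%R by rewrite addr_ge0// powR_ge0.
pose m := fine (rad_max f s).
have mE : rad_max f s = m%:E by rewrite fineK.
have m0 : (0 <= m)%R by rewrite fine_ge0// rad_max_ge0.
rewrite mE; apply/lee_addgt0Pr => eps eps0.
(* The added mass is at most 4 C del, and its product with [m] must stay below [eps]; the 1 in the
   denominator covers m C = 0. *)
pose del := Num.min (Num.min (t1 / 2) 1)%R (eps / (m * (4 * C) + 1))%R.
have mC0 : (0 < m * (4 * C) + 1)%R by rewrite ltr_wpDl// !mulr_ge0.
have del0 : (0 < del)%R by rewrite !lt_min ltr01 !divr_gt0.
have [del1 del2 del3] : [/\ del <= t1 / 2, del <= 1 & m * (4 * C * del) <= eps]%R.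
  split.
  - by rewrite /del !ge_min lexx.
  - by rewrite /del !ge_min lexx orbT.
  - have : (del <= eps / (m * (4 * C) + 1))%R by rewrite /del ge_min lexx orbT.
    rewrite ler_pdivlMr// => H; rewrite mulrA (le_trans _ H)// mulrC ler_wpM2l ?ltW//.
    by rewrite ltrDl.
have [p] : exists p : rat, ratr p \in `](inf S - del)%R, (inf S)[.
  by apply: rat_in_itvoo; rewrite ltrBlDr ltrDl.
rewrite in_itv/= => /andP[ip pi].
have [q] : exists q : rat, ratr q \in `](sup S), (sup S + del)%R[.
  by apply: rat_in_itvoo; rewrite ltrDl.
rewrite in_itv/= => /andP[uq qu].
have is_ : (inf S <= s)%R by exact: iS.
have su : (s <= sup S)%R by exact: sS.
have p0 : (0 < ratr p :> R)%R by lra.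
apply: (@le_trans _ _ (wint f (fun t => ratr p < t < ratr q)%R)).
  apply: le_wint => // t Jt; rewrite (lt_le_trans pi) ?iS//=.
  by rewrite (le_lt_trans _ uq)// sS.
apply: (le_trans (@rat_itv_le_rad_max p q s p0 _)); first by apply/andP; split; lra.
rewrite mE.
(* What the rational interval adds to J, the ends of J included, lies within [del] of one of the two
   ends of J. *)
pose L t := (inf S - del < t < inf S + del)%R.
pose U t := (sup S - del < t < sup S + del)%R.
have mLU (b : R -> bool) : measurable_fun setT b ->
    measurable_fun setT (fun t => (b t)%:R%:E * (w t)%:E : \bar R).
  move=> mb; apply: emeasurable_funM; first exact/measurable_EFinP/measurable_natb.
  by apply/measurable_EFinP; exact: measurable_pos_powR.
have w0 t : 0 <= (w t)%:E by rewrite lee_fin pos_powR_ge0.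
have mJ := measurable_convex_pred Jconv.
have mL : measurable_fun setT L by exact: measurable_itv_bool.
have mU : measurable_fun setT U by exact: measurable_itv_bool.
have W v : (t1 <= v)%R -> (v <= t2)%R -> wmass (fun t => v - del < t < v + del)%R <= (C * (2 * del))%:E.
  move=> t1v vt2; have h1 : (0 < t1 / 2)%R by lra.
  have h2 : (t1 / 2 <= v - del)%R by lra.
  have h3 : (v - del <= v + del)%R by lra.
  have h4 : (v + del <= t2 + 1)%R by lra.
  apply: (le_trans (wmass_itv_le h1 h2 h3 h4)).
  by rewrite lee_fin ler_wpM2l//; lra.
have WL : wmass L <= (C * (2 * del))%:E by apply: W; lra.
have WU : wmass U <= (C * (2 * del))%:E by apply: W; lra.
have : wmass (fun t => ratr p < t < ratr q)%R <= wmass J + (wmass L + wmass U).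
  rewrite /wmass -ge0_integralD//; last 4 first.
  - by move=> t _; rewrite mule_ge0.
  - exact: mLU.
  - by move=> t _; rewrite mule_ge0.
  - exact: mLU.
  rewrite -ge0_integralD//; last 4 first.
  - by move=> t _; rewrite mule_ge0.
  - exact: mLU.
  - by move=> t _; rewrite adde_ge0// mule_ge0.
  - by apply: emeasurable_funD; exact: mLU.
  apply: le_lower_integral => t; first by rewrite mule_ge0.
  rewrite -!ge0_muleDl ?lee_fin ?adde_ge0//.
  apply: ler_wpM2r; first exact: pos_powR_ge0.
  rewrite -!natrD ler_nat.
  have [/andP[pt tq]|//] := boolP (ratr p < t < ratr q)%R.
  case: (J t) (@inJ t) => // Jt; case Lt: (L t) => //.
  suff -> : U t by [].
  rewrite /U; move: Lt; rewrite /L => /negP Lt.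
  have [ut|tu] := leP (sup S) t; first by apply/andP; split; lra.
  exfalso; have [ti|it] := leP t (inf S).
    by apply: Lt; apply/andP; split; lra.
  by move: Jt; rewrite it tu => /(_ isT).
move=> HW; apply: (@le_trans _ _ (m%:E * (wmass J + (C * (4 * del))%:E))).
  apply: lee_wpmul2l; first by rewrite lee_fin.
  apply: (le_trans HW); apply: leeD2l.
  rewrite (_ : (C * (4 * del) = C * (2 * del) + C * (2 * del))%R); last by ring.
  by rewrite EFinD; exact: leeD.
rewrite ge0_muleDr ?wmass_ge0//; last by rewrite lee_fin !mulr_ge0// ltW.
apply: leeD2l; rewrite -EFinM lee_fin (le_trans _ del3)//.
by rewrite le_eqVlt; apply/orP; left; apply/eqP; ring.
Qed.

(** J may come arbitrarily close to 0, where the weight may fail to be integrable; it is exhausted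
    by its parts away from 0, all containing [s]. *)
Lemma ray_le_rad_max (J : R -> bool) (s u t2 : R) :
  (forall t, J t -> 0 < t <= t2)%R -> convex_pred J -> J s -> J u -> u != s ->
  wint f J <= rad_max f s * wmass J.
Proof.
move=> Jb Jconv Js Ju us.
have /andP[s0 st2] := Jb _ Js; have /andP[u0 ut2] := Jb _ Ju.
have [Mf|Mf] := boolP (rad_max f s \is a fin_num); last first.
  have -> : rad_max f s = +oo.
    by apply/eqP; move: Mf; rewrite ge0_fin_numE ?rad_max_ge0// -leNgt leye_eq.
  rewrite gt0_mulye ?leey//.
  (* Because [+oo * 0 = 0], an infinite maximal function helps only if J has positive mass. The
     second point [u] of J guarantees this. *)
  have pos a b : (0 < a)%R -> (a < b)%R -> J a -> J b -> 0 < wmass J.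
    move=> a0 ab Ja Jb'; apply: (lt_le_trans (wmass_itv_gt0 a0 ab)).
    by apply: le_wmass => t /andP[at_ tb]; apply: (Jconv a b) => //; rewrite !ltW.
  by move: us; rewrite neq_lt => /orP[us|us]; [exact: (pos u s)|exact: (pos s u)].
pose E n t := J t && (s / n.+1%:R <= t)%R.
have n0 n : (0 < n.+1%:R :> R)%R by rewrite ltr0n.
have En0 n : (0 < s / n.+1%:R)%R by rewrite divr_gt0.
have Econv n : convex_pred (E n).
  move=> x y z /andP[Jx sx] /andP[Jy sy] /andP[xz zy].
  by rewrite /E (Jconv x y)//= ?xz// (le_trans sx xz).
have HE n : wint f (E n) <= rad_max f s * wmass J.
  apply: (@le_trans _ _ (rad_max f s * wmass (E n))).
    apply: (@ray_le_rad_max_bounded _ s (s / n.+1%:R) t2) => //.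
    - by move=> t /andP[/Jb/andP[_ ->] ->].
    - by rewrite /E Js/= ler_pdivrMr// ler_peMr ?ler1n//; exact: ltW.
  apply: lee_wpmul2l; first exact: rad_max_ge0.
  by apply: le_wmass => t /andP[].
have mfw : measurable_fun setT (fun t => (f t * w t)%:E).
  by apply/measurable_EFinP; apply: measurable_funM => //; exact: measurable_pos_powR.
have fw0 t : 0 <= (f t * w t)%:E by rewrite lee_fin mulr_ge0// pos_powR_ge0.
have mE n : measurable_fun setT (fun t => (E n t)%:R%:E * (f t * w t)%:E).
  apply: emeasurable_funM => //; apply/measurable_EFinP/measurable_natb.
  exact: measurable_convex_pred.
have ndE t : setT t -> {homo (fun n => (E n t)%:R%:E * (f t * w t)%:E) : n m / (n <= m)%N >-> n <= m}.
  move=> _ n m nm; apply: lee_wpmul2r => //; rewrite lee_fin ler_nat.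
  rewrite /E; case: (J t) => //=; have [H|//] := boolP (s / n.+1%:R <= t)%R.
  rewrite lt0b (le_trans _ H)// ler_pM2l// lef_pV2 ?posrE//.
  by rewrite ler_nat.
have E0 n t : setT t -> 0 <= (E n t)%:R%:E * (f t * w t)%:E by move=> _; rewrite mule_ge0.
have cvgE := @cvg_monotone_convergence _ (measurableTypeR R) R leb setT measurableT _ mE E0 ndE.
apply: (@le_trans _ _ (\int[leb]_t limn (fun n => (E n t)%:R%:E * (f t * w t)%:E))).
  apply: le_lower_integral => t; first by rewrite mule_ge0.
  have [Jt|_] := boolP (J t); last first.
    rewrite mul0e; apply: lime_ge; first by apply: ereal_nondecreasing_is_cvgn; exact: ndE.
    by apply: nearW => n; exact: E0.
  rewrite mul1e; apply: lime_ge; first by apply: ereal_nondecreasing_is_cvgn; exact: ndE.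
  have /andP[t0 _] := Jb _ Jt.
  exists (Num.truncn (s / t)) => // n /= ni; rewrite /E Jt/=.
  rewrite (_ : _ <= t)%R ?mul1e// ler_pdivrMr// mulrC -ler_pdivrMr//.
  by rewrite (le_trans (ltW (truncnS_gt _)))// ler_nat ltnS.
rewrite -(cvg_lim _ cvgE)//; apply: lime_le; last by apply: nearW => n; exact: HE.
by apply: ereal_nondecreasing_is_cvgn => n m nm; apply: le_lower_integral => t; [exact: E0|exact: ndE].
Qed.

End radial_maximal_function.

(** * Weak and strong type of the maximal function on the half-line *)

Section rad_max_bounds.
Variable R : realType.
Notation leb := (@lebesgue_measure R).
Variables (e : R) (f : R -> R).
Local Notation w := (pos_powR e).
Hypothesis mf : measurable_fun setT f.
Hypothesis f0 : forall t, 0 <= f t.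
Local Open Scope ereal_scope.

Lemma rad_max_weak (l : R) : (0 < l)%R ->
  l%:E * wmass e (fun t => l%:E < rad_max e f t) <= 4%:E * wint e f (fun=> true).
Proof.
move=> l0; apply: (@maximal_weak_type _ e f) => //; first exact: ltW.
move=> n H; apply: (le_trans H); rewrite -[leLHS]mul1e.
by apply: lee_wpmul2r; [exact: wint_ge0|rewrite lee_fin ler1n].
Qed.

Let mpw : measurable_fun setT w. Proof. exact: measurable_pos_powR. Qed.
Let w0 t : (0 <= w t)%R. Proof. exact: pos_powR_ge0. Qed.

(** Since f <= g + l / 2 for f cut off where 2 f <= l, an f-average of at least l forces a g-average
    of at least l / 2. *)
Lemma rad_max_weak_truncated (l : R) : (0 < l)%R ->
  l%:E * wmass e (fun t => l%:E < rad_max e f t) <=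
  4%:E * wint e f (fun t => l < 2 * f t)%R.
Proof.
move=> l0; pose g t := ((l < 2 * f t)%R%:R * f t)%R.
have mg : measurable_fun setT g.
  apply: measurable_funM => //; apply: measurable_natb.
  by apply: measurable_fun_ltr => //; exact: measurable_funM.
have g0 t : (0 <= g t)%R by rewrite mulr_ge0.
have -> : wint e f (fun t => l < 2 * f t)%R = wint e g (fun=> true).
  by apply: eq_integral => t _; rewrite mul1e -EFinM mulrA.
apply: (@maximal_weak_type _ e f l _ g) => //; first exact: ltW.
(* An index may code an empty interval, of mass 0; every other interval has finite mass, and the
   term (l / 2) mass can be subtracted. *)
move=> n H; have [In|In] := pselect (exists s : R, rat_itv n s); last first.
  have -> : wmass e (rat_itv n) = 0.
    apply: integral0_eq => t _; rewrite (_ : rat_itv n t = false) ?mul0e//.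
    by apply/negP => nt; apply: In; exists t.
  by rewrite mule0 mule_ge0// wint_ge0.
case: In => s ns; have [p [q [p00 pq E]]] := rat_itv_spec ns.
have Wf : wmass e (rat_itv n) \is a fin_num by rewrite E wmass_itv_fin_num.
have mI := @measurable_rat_itv R n.
have mIh (h : R -> R) : measurable_fun setT h ->
    measurable_fun setT (fun t => (rat_itv n t)%:R%:E * (h t)%:E : \bar R).
  by move=> mh; apply: emeasurable_funM; apply/measurable_EFinP => //; apply: measurable_natb.
have : wint e f (rat_itv n) <= wint e g (rat_itv n) + (l / 2)%:E * wmass e (rat_itv n).
  rewrite /wint /wmass -ge0_integralZl//; last 3 first.
  - exact: mIh.
  - by move=> t _; rewrite mule_ge0// lee_fin.
  - by rewrite lee_fin divr_ge0// ltW.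
  rewrite -ge0_integralD//; last 4 first.
  - by move=> t _; rewrite mule_ge0// lee_fin mulr_ge0.
  - by apply: mIh; exact: measurable_funM.
  - by move=> t _; rewrite !mule_ge0// lee_fin ?divr_ge0// ltW.
  - by apply: emeasurable_funM => //; exact: mIh.
  apply: le_lower_integral => t; first by rewrite mule_ge0// lee_fin mulr_ge0.
  case: (rat_itv n t); last by rewrite !mul0e mule0 adde0.
  rewrite !mul1e -EFinM -EFinD lee_fin -mulrDl ler_wpM2r// /g.
  have [H1|H1] := ltP l (2 * f t)%R; first by rewrite mul1r lerDl divr_ge0// ltW.
  by rewrite mul0r add0r; lra.
move: H; rewrite -(fineK Wf); set W := fine _; set F := wint e f _.
have : 0 <= wint e g (rat_itv n) by exact: wint_ge0.
case: (wint e g (rat_itv n)) => [G G0|_ _ _|//]; last by rewrite mulry gtr0_sg// mul1e leey.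
rewrite -!EFinM -EFinD => H1 H2.
have := le_trans H1 H2; rewrite !lee_fin; lra.
Qed.

(** The p-th power is the integral of p l^(p-1) over 0 < l < M; an infinite M is reached through
    arbitrarily large finite levels. *)
Lemma layer_cake_power (p : R) (M : \bar R) : (0 < p)%R -> 0 <= M ->
  M `^ p <= \int[leb]_l (((0 < l)%R && ((l : R)%:E < M)%E)%:R%:E * (p * (l : R) `^ (p - 1))%:E).
Proof.
move=> p0.
have I0 (N : \bar R) : 0 <= \int[leb]_l (((0 < l)%R && ((l : R)%:E < N)%E)%:R%:E * (p * (l : R) `^ (p - 1))%:E).
  by apply: integral_ge0 => t _; rewrite mule_ge0// lee_fin mulr_ge0 ?powR_ge0// ltW.
have key (s : R) : (0 < s)%R ->
    (s `^ p)%:E = \int[leb]_l (((0 < l)%R && ((l : R)%:E < s%:E)%E)%:R%:E * (p * (l : R) `^ (p - 1))%:E).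
  move=> s0.
  transitivity (p%:E * \int[leb]_(l in `]0%R, s[) (l `^ (p - 1))%:E).
    by rewrite integral_powR_oo// -EFinM; congr EFin; field; rewrite gt_eqF.
  rewrite -ge0_integralZl//; last 3 first.
  - by apply/measurable_EFinP; apply: measurable_funTS; exact: measurable_powR.
  - by move=> t _; rewrite lee_fin powR_ge0.
  - by rewrite lee_fin ltW.
  rewrite integral_mkcond; apply: eq_integral => t _.
  rewrite patchE mem_setE in_itv/= lte_fin; case: ifP => _; first by rewrite mul1e EFinM.
  by rewrite mul0e.
case: M => [s| |//].
  rewrite lee_fin le_eqVlt => /predU1P[<-|s0]; last by rewrite poweR_EFin -key.
  by rewrite poweR0r ?gt_eqF// I0.
move=> _; rewrite poweRyr ?gt_eqF// leye_eq; apply/eqP/eqyP => A A0.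
have -> : A = ((A `^ p^-1) `^ p)%R by rewrite -powRrM mulVf ?gt_eqF// powRr1// ltW.
rewrite key ?powR_gt0//; apply: le_lower_integral => t.
  by rewrite mule_ge0// lee_fin mulr_ge0 ?powR_ge0// ltW.
apply: lee_wpmul2r; first by rewrite lee_fin mulr_ge0 ?powR_ge0// ltW.
rewrite ltry andbT lee_fin ler_nat; case: (0 < t)%R => //=.
exact: leq_b1.
Qed.

(** Layer cake, Tonelli, the truncated weak type at each level l, and Tonelli again. What remains is
    the integral of 4 p l^(p-2) over 0 < l < 2 f, which converges because p > 1 and yields the
    constant. *)
Lemma rad_max_strong (p : R) : (1 < p)%R ->
  \int[leb]_t ((rad_max e f t) `^ p * (w t)%:E) <=
  (4 * p * 2 `^ (p - 1) / (p - 1))%:E * \int[leb]_t ((f t `^ p) * w t)%:E.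
Proof.
move=> p1; have p0 : (0 < p)%R by exact: lt_trans p1.
have q0 : (0 < p - 1)%R by rewrite subr_gt0.
pose M := rad_max e f.
have mM : measurable_fun setT M by exact: measurable_rad_max.
pose H (z : measurableTypeR R * measurableTypeR R) :=
  ((0 < z.2)%R && ((z.2 : R)%:E < M z.1)%E)%:R%:E * (p * (z.2 : R) `^ (p - 1) * w z.1)%:E.
have mH : measurable_fun setT H.
  apply: emeasurable_funM.
    apply/measurable_EFinP; apply: measurable_natb; apply: measurable_and.
      by apply: measurable_fun_ltr.
    apply: measurable_fun_lte; last exact: (measurableT_comp mM).
    by apply/measurable_EFinP.
  apply/measurable_EFinP; apply: measurable_funM; last exact: (measurableT_comp mpw).
  by apply: measurable_funM => //; exact: measurable_fun_powR.
have H0 z : 0 <= H z.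
  by rewrite mule_ge0// lee_fin !mulr_ge0 ?powR_ge0// ltW.
apply: (@le_trans _ _ (\int[leb]_t \int[leb]_l H (t, l))).
  apply: le_lower_integral => t; first by rewrite mule_ge0 ?poweR_ge0// lee_fin.
  apply: (@le_trans _ _ ((\int[leb]_l (((0 < l)%R && ((l : R)%:E < M t)%E)%:R%:E * (p * (l : R) `^ (p - 1))%:E)) * (w t)%:E)).
    apply: lee_wpmul2r; first by rewrite lee_fin.
    by apply: layer_cake_power => //; exact: rad_max_ge0.
  rewrite muleC -ge0_integralZl//; last 3 first.
  - apply: emeasurable_funM.
      apply/measurable_EFinP; apply: measurable_natb; apply: measurable_and.
        by apply: measurable_fun_ltr.
      by apply: measurable_fun_lte => //; exact/measurable_EFinP.
    by apply/measurable_EFinP; apply: measurable_funM => //; exact: measurable_powR.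
  - by move=> l _; rewrite mule_ge0// lee_fin mulr_ge0 ?powR_ge0// ltW.
  - by rewrite lee_fin.
  apply: le_lower_integral => l; first by rewrite !mule_ge0 ?lee_fin// mulr_ge0 ?powR_ge0// ltW.
  by rewrite /H/= muleCA -EFinM [(w t * _)%R]mulrC.
have split_pow (x : R) : (0 < x -> p * x `^ (p - 1) = p * x `^ (p - 1 - 1) * x)%R.
  by move=> x0; rewrite -(@mulr_powRB1 _ x (p - 1)%R) ?(ltW x0) ?subr_gt0// mulrCA mulrC.
rewrite (@fubini_tonelli _ _ _ _ R leb leb H)//.
pose K (z : measurableTypeR R * measurableTypeR R) :=
  ((0 < z.2)%R && (z.2 < 2 * f z.1)%R)%:R%:E *
  (4 * p * (z.2 : R) `^ (p - 1 - 1) * (f z.1 * w z.1))%:E.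
have K0 z : 0 <= K z.
  by rewrite mule_ge0// lee_fin !mulr_ge0 ?powR_ge0// ltW.
have mK : measurable_fun setT K.
  apply: emeasurable_funM.
    apply/measurable_EFinP; apply: measurable_natb; apply: measurable_and.
      by apply: measurable_fun_ltr.
    apply: measurable_fun_ltr => //; apply: measurable_funM => //.
    exact: (measurableT_comp mf).
  apply/measurable_EFinP; apply: measurable_funM.
    by apply: measurable_funM => //; exact: measurable_fun_powR.
  by apply: measurable_funM; [exact: (measurableT_comp mf)|exact: (measurableT_comp mpw)].
have mlM l : measurable_fun setT (fun t => l%:E < M t) by exact: measurable_fun_lte.
have mlf l : measurable_fun setT (fun t => l < 2 * f t)%R.
  by apply: measurable_fun_ltr => //; exact: measurable_funM.
apply: (@le_trans _ _ (\int[leb]_l \int[leb]_t K (t, l))).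
  apply: le_lower_integral => l; first by apply: integral_ge0 => t _; exact: H0.
  have [l0|l0] := ltP 0%R (l : R); last first.
    rewrite [leLHS](_ : _ = 0); first by apply: integral_ge0 => t _; exact: K0.
    apply: integral0_eq => t _; rewrite /H/= (_ : (0 < l)%R = false) ?mul0e//.
    by rewrite ltNge l0.
  have -> : \int[leb]_t H (t, l) = (p * (l : R) `^ (p - 1))%:E * wmass e (fun t => (l : R)%:E < M t).
    rewrite -ge0_integralZl//; last 3 first.
    - apply: emeasurable_funM; apply/measurable_EFinP => //.
      exact: measurable_natb (mlM l).
    - by move=> t _; rewrite mule_ge0// lee_fin.
    - by rewrite lee_fin mulr_ge0 ?powR_ge0// ltW.
    by apply: eq_integral => t _; rewrite /H/= l0 muleCA -EFinM.
  have -> : \int[leb]_t K (t, l) = (4 * p * (l : R) `^ (p - 1 - 1))%:E * wint e f (fun t => (l : R) < 2 * f t)%R.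
    rewrite -ge0_integralZl//; last 3 first.
    - apply: emeasurable_funM; apply/measurable_EFinP; first exact: measurable_natb (mlf l).
      exact: measurable_funM.
    - by move=> t _; rewrite mule_ge0// lee_fin mulr_ge0.
    - by rewrite lee_fin !mulr_ge0 ?powR_ge0// ltW.
    by apply: eq_integral => t _; rewrite /K/= l0 muleCA -EFinM.
  rewrite (split_pow _ l0).
  rewrite EFinM -muleA.
  have -> : (4 * p * (l : R) `^ (p - 1 - 1) = p * (l : R) `^ (p - 1 - 1) * 4)%R by ring.
  rewrite [in leRHS]EFinM -[leRHS]muleA; apply: lee_wpmul2l.
    by rewrite lee_fin mulr_ge0 ?powR_ge0// ltW.
  exact: rad_max_weak_truncated.
rewrite -(@fubini_tonelli _ _ _ _ R leb leb K)//.
have mfp : measurable_fun setT (fun t => (f t `^ p * w t)%:E).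
  apply/measurable_EFinP; apply: measurable_funM => //.
  exact: measurable_fun_powR.
have fp0 t : 0 <= (f t `^ p * w t)%:E by rewrite lee_fin mulr_ge0// powR_ge0.
have C0 : (0 <= 4 * p * 2 `^ (p - 1) / (p - 1))%R.
  by rewrite !mulr_ge0 ?invr_ge0 ?powR_ge0// ltW.
rewrite -ge0_integralZl//.
apply: le_lower_integral => t; first by apply: integral_ge0 => l _; exact: K0.
have [ft|ft] := ltP 0%R (f t); last first.
  rewrite [leLHS](_ : _ = 0); first by rewrite mule_ge0// lee_fin.
  apply: integral0_eq => l _; rewrite /K/=.
  have -> : f t = 0%R by apply/eqP; rewrite eq_le f0 ft.
  by rewrite mul0r mulr0 mule0.
rewrite le_eqVlt; apply/orP; left; apply/eqP.
transitivity ((4 * p * (f t * w t))%:E * \int[leb]_(l in `]0%R, (2 * f t)%R[) ((l : R) `^ (p - 1 - 1))%:E).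
  rewrite -ge0_integralZl//; last 3 first.
  - by apply/measurable_EFinP; apply: measurable_funTS; exact: measurable_powR.
  - by move=> l _; rewrite lee_fin powR_ge0.
  - by rewrite lee_fin; apply: mulr_ge0; [rewrite mulr_ge0 ?(ltW p0)|apply: mulr_ge0].
  rewrite [RHS]integral_mkcond; apply: eq_integral => l _.
  rewrite patchE mem_setE in_itv/= /K/=; case: ifP => _; last by rewrite mul0e.
  by rewrite mul1e -EFinM; congr EFin; ring.
rewrite integral_powR_oo//; last by rewrite mulr_gt0.
rewrite -!EFinM; congr EFin; rewrite powRM//.
rewrite -(@mulr_powRB1 _ (f t) p)//.
by field; rewrite gt_eqF.
Qed.

End rad_max_bounds.

(** * Reduction of the maximal operator to rays *)

Section mass.
Variable R : realType.
Variable d : nat.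
Implicit Types (x y theta : 'rV[R]_d) (b : 'rV[R]_d -> bool) (a : R).

Definition mass a b : \bar R := intd (fun y => ((b y)%:R * wt a y)%:E).

Definition ballb x r : 'rV[R]_d -> bool := fun y => norm2 (y - x) <= r.

Lemma wt_ge0 a y : 0 <= wt a y. Proof. exact: powR_ge0. Qed.

Lemma measurable_wt a : measurable_fun setT (@wt R d a).
Proof. by apply: measurable_fun_powR; exact: measurable_norm2. Qed.

Lemma mass_integrand_ge0 a b y : (0 <= ((b y)%:R * wt a y)%:E)%E.
Proof. by rewrite lee_fin mulr_ge0// wt_ge0. Qed.

Lemma measurable_mass_integrand a b : measurable_fun setT b ->
  measurable_fun setT (fun y => ((b y)%:R * wt a y)%:E).
Proof.
move=> mb; apply/measurable_EFinP; apply: measurable_funM; last exact: measurable_wt.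
exact: measurable_natb.
Qed.

Lemma mass_ge0 a b : (0 <= mass a b)%E.
Proof. by apply: intd_ge0 => y; exact: mass_integrand_ge0. Qed.

Lemma le_mass a b b' : (forall y, b y -> b' y) -> (mass a b <= mass a b')%E.
Proof.
move=> bb; apply: le_intd => y; first exact: mass_integrand_ge0.
by rewrite lee_fin ler_wpM2r ?wt_ge0// ler_nat; case: (b y) (bb y) => // ->.
Qed.

Lemma muE a b : mu a [set y | b y] = mass a b.
Proof.
by apply: eq_intd => y; rewrite mule1 indic_bool EFinM.
Qed.

Lemma mu_ball2E a x r : mu a (ball2 x r) = mass a (ballb x r).
Proof. exact: muE. Qed.

Lemma intmu_ball2E a x r (f0 : R -> R) :
  intmu a (ball2 x r) (fun y => (`|radial f0 y|)%:E) =
  intd (fun y => ((ballb x r y)%:R * wt a y)%:E * (`|f0 (norm2 y)|)%:E)%E.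
Proof.
by apply: eq_intd => y; rewrite (indic_bool _ (ballb x r)) EFinM.
Qed.

Lemma measurable_ballb x r : measurable_fun setT (ballb x r).
Proof. exact: measurable_ball2. Qed.

Hypothesis d_gt0 : (0 < d)%N.

Definition radial_exponent a : R := d%:R - a - 1.

Lemma radial_weightE a (theta : 'rV[R]_d) t : norm2 theta = 1 ->
  (0 < t)%R%:R * t ^+ d.-1 * wt a (t *: theta) = pos_powR (radial_exponent a) t.
Proof.
move=> th1; rewrite /pos_powR; have [t0|t0] := ltP 0 t; last by rewrite !mul0r.
rewrite !mul1r /wt norm2Z th1 mulr1 gtr0_norm//.
rewrite -powR_mulrn ?ltW// -powRD; last by apply/implyP => _; rewrite gt_eqF.
by congr (_ `^ _); rewrite /radial_exponent -[in RHS](prednK d_gt0) -natr1; ring.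
Qed.

Lemma ray_mass a b theta : norm2 theta = 1 ->
  ray (fun y => ((b y)%:R * wt a y)%:E) theta =
  wmass (radial_exponent a) (fun t => (0 < t) && b (t *: theta)).
Proof.
move=> th1; apply: eq_integral => t _; rewrite -!EFinM -(radial_weightE a t th1).
by congr EFin; case: (0 < t); rewrite /= ?mul0r ?mulr0// !mul1r mulrCA.
Qed.

Lemma ray_mass_int a b (f : R -> R) theta : norm2 theta = 1 ->
  ray (fun y => ((b y)%:R * wt a y)%:E * (f (norm2 y))%:E)%E theta =
  wint (radial_exponent a) f (fun t => (0 < t) && b (t *: theta)).
Proof.
move=> th1; apply: eq_integral => t _; rewrite -!EFinM -(radial_weightE a t th1).
congr EFin; have [t0|] := ltP 0 t; last by rewrite /= !mul0r.
rewrite /= !mul1r norm2Z th1 mulr1 gtr0_norm//; ring.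
Qed.

(** The same [s] serves on every ray, so [rad_max] at [s] is a constant that comes out when the rays
    are put together. The second point [u] is the one [ray_le_rad_max] asks for. *)
Lemma integral_le_rad_max a b (f : R -> R) (s : R) : measurable_fun setT b ->
  measurable_fun setT f -> (forall t, 0 <= f t) ->
  (forall theta, norm2 theta = 1 -> (forall t, 0 < t -> ~~ b (t *: theta)) \/
    exists u t2, [/\ convex_pred (fun t => (0 < t) && b (t *: theta)),
      forall t, 0 < t -> b (t *: theta) -> t <= t2,
      0 < s /\ b (s *: theta) & [/\ 0 < u, b (u *: theta) & u != s]]) ->
  (intd (fun y => ((b y)%:R * wt a y)%:E * (f (norm2 y))%:E) <=
   rad_max (radial_exponent a) f s * mass a b)%E.
Proof.
move=> mb mf f0 H; apply: le_intd_ray => //.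
- apply: emeasurable_funM; first exact: measurable_mass_integrand.
  apply/measurable_EFinP; apply: (measurableT_comp mf); exact: measurable_norm2.
- exact: measurable_mass_integrand.
- by move=> y; rewrite mule_ge0// ?mass_integrand_ge0// lee_fin.
- by move=> y; rewrite mass_integrand_ge0.
- exact: rad_max_ge0.
move=> theta th1; rewrite ray_mass// ray_mass_int//.
have [none|[u [t2 [Jconv Jb [s0 bs] [u0 bu us]]]]] := H theta th1.
  have -> : wint (radial_exponent a) f (fun t => (0 < t) && b (t *: theta)) = 0%E.
    apply: integral0_eq => t _; rewrite (_ : _ && _ = false) ?mul0e//.
    by apply/negP => /andP[/none/negP].
  by rewrite mule_ge0 ?rad_max_ge0// wmass_ge0.
apply: (@ray_le_rad_max _ _ f mf f0 _ s u t2) => //.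
- by move=> t /andP[t0 bt]; rewrite t0 Jb.
- by rewrite s0.
- by rewrite u0.
Qed.

(** Sublevel sets of a monic quadratic are intervals; on a ray, a ball is such a sublevel set by
    [ballb_ray]. *)
Lemma quadratic_convex (c k x y z : R) : x <= z <= y ->
  x ^+ 2 - 2 * x * c <= k -> y ^+ 2 - 2 * y * c <= k -> z ^+ 2 - 2 * z * c <= k.
Proof.
move=> /andP[xz zy] hx hy.
have H : (z - x) * (y - z) >= 0 by rewrite mulr_ge0// subr_ge0.
have [h|h] := leP 0 (x + y - 2 * c).
  have : (x + y - 2 * c) * (y - z) >= 0 by rewrite mulr_ge0// subr_ge0.
  nra.
have : (2 * c - x - y) * (z - x) >= 0 by rewrite mulr_ge0// ?subr_ge0//; lra.
nra.
Qed.

Lemma ballb_ray x r t theta : norm2 theta = 1 -> 0 <= r ->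
  ballb x r (t *: theta) = (t ^+ 2 - 2 * t * dot theta x <= r ^+ 2 - norm2 x ^+ 2).
Proof.
move=> th1 r0; rewrite /ballb -(@ler_pXn2r _ 2)// ?nnegrE ?norm2_ge0//.
rewrite sqr_norm2B norm2Z th1 mulr1 real_normK ?num_real// dotZl.
by rewrite lerBrDr mulrA.
Qed.

Lemma measurable_dotr x : measurable_fun setT (fun y => dot y x).
Proof. exact: (@measurable_dot R d _ _ (fun y => y) (fun=> x)). Qed.

(* Each ray from the origin meets the union of [ballb x r] and its inner shadow
   in the empty set or in an interval containing [norm2 x]. *)
Definition inner_shadow x r : 'rV[R]_d -> bool := fun y =>
  if r < norm2 x then
    [&& Num.sqrt (norm2 x ^+ 2 - r ^+ 2) <= norm2 y, norm2 y <= norm2 x &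
      norm2 y * Num.sqrt (norm2 x ^+ 2 - r ^+ 2) <= dot y x]
  else norm2 y <= norm2 x.

Lemma measurable_inner_shadow x r : measurable_fun setT (inner_shadow x r).
Proof.
have mn := @measurable_norm2 R d.
have mle (c : R) : measurable_fun setT (fun y : 'rV[R]_d => norm2 y <= c).
  by apply: measurable_fun_ler.
rewrite /inner_shadow; case: (ltP r (norm2 x)) => _; last exact: mle.
apply: measurable_and; first by apply: measurable_fun_ler.
apply: measurable_and; first exact: mle.
apply: measurable_fun_ler; last exact: measurable_dotr.
by apply: measurable_funM.
Qed.

(** Let s = |x| and c = [dot theta x]. If r >= s the ball contains the origin, its chord starts at
    0, and the shadow adds ]0, s]. If r < s put rho^2 = s^2 - r^2: the ray meets the ball exactly
    when c >= rho, the chord then contains rho, and the shadow adds [rho, s] on precisely these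
    rays. *)
Lemma shadow_ray x r theta : 0 < r -> x != 0 -> norm2 theta = 1 ->
  let b y := ballb x r y || inner_shadow x r y in
  (forall t, 0 < t -> ~~ b (t *: theta)) \/
  exists u t2, [/\ convex_pred (fun t => (0 < t) && b (t *: theta)),
    forall t, 0 < t -> b (t *: theta) -> t <= t2,
    0 < norm2 x /\ b (norm2 x *: theta) & [/\ 0 < u, b (u *: theta) & u != norm2 x]].
Proof.
move=> r0; rewrite -norm2_gt0 => s0 th1 b.
set s := norm2 x in s0 *; set c := dot theta x.
have cs : c <= s by rewrite (le_trans (dot_le _ _))// th1 mul1r.
have bE t : 0 < t -> b (t *: theta) = (t ^+ 2 - 2 * t * c <= r ^+ 2 - s ^+ 2) ||
    (if r < s then [&& Num.sqrt (s ^+ 2 - r ^+ 2) <= t, t <= s &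
      Num.sqrt (s ^+ 2 - r ^+ 2) <= c] else t <= s).
  move=> t0; rewrite /b /inner_shadow ballb_ray ?(ltW r0)// norm2Z th1 mulr1 gtr0_norm// dotZl.
  by rewrite ler_pM2l.
have ball_bound t : 0 < t -> t ^+ 2 - 2 * t * c <= r ^+ 2 - s ^+ 2 -> t <= s + r.
  move=> t0 h; have h2 : (t - s) ^+ 2 <= r ^+ 2.
    have : t * c <= t * s by rewrite ler_wpM2l// ltW.
    nra.
  have h3 : `|t - s| <= r.
    by rewrite -(@ler_pXn2r _ 2)// ?nnegrE ?(ltW r0)// real_normK ?num_real.
  have := le_trans (ler_norm (t - s)) h3; lra.
have [rs|sr] := ltP r s; last first.
  right; exists (s / 2), (s + r).
  have k0 : 0 <= r ^+ 2 - s ^+ 2 by rewrite subr_ge0 lerXn2r// nnegrE ltW.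
  have {}bE t : 0 < t -> b (t *: theta) = (t ^+ 2 - 2 * t * c <= r ^+ 2 - s ^+ 2) || (t <= s).
    by move=> /bE ->; rewrite ltNge sr.
  split => //.
  - move=> t1 t2 t3 /andP[t10 h1] /andP[t20 h2] /andP[t13 t32].
    have t30 : 0 < t3 by exact: lt_le_trans t13.
    rewrite t30/= bE//; move: h2; rewrite bE// => /orP[h2|h2]; last first.
      by rewrite (le_trans t32 h2) orbT.
    apply/orP; left; apply: (@quadratic_convex _ _ 0 t2) => //.
      by rewrite ltW.
    by rewrite expr0n/= mulr0 mul0r subr0.
  - by move=> t t0; rewrite bE// => /orP[/(ball_bound _ t0)//|h]; lra.
  - by rewrite bE// lexx orbT.
  - split; [by rewrite divr_gt0| |by rewrite lt_eqF//; lra].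
    by rewrite bE ?divr_gt0//; apply/orP; right; lra.
pose rho := Num.sqrt (s ^+ 2 - r ^+ 2).
have sr2 : 0 < s ^+ 2 - r ^+ 2 by rewrite subr_gt0 ltrXn2r// ?nnegrE ltW.
have rho0 : 0 < rho by rewrite sqrtr_gt0.
have rho2 : rho ^+ 2 = s ^+ 2 - r ^+ 2 by rewrite sqr_sqrtr// ltW.
have rhos : rho < s.
  rewrite -(@ltr_pXn2r _ 2)// ?nnegrE ?(ltW s0) ?(ltW rho0)// rho2.
  by rewrite ltrBlDr ltrDl exprn_gt0.
have {}bE t : 0 < t -> b (t *: theta) = (t ^+ 2 - 2 * t * c <= - rho ^+ 2) ||
    [&& rho <= t, t <= s & rho <= c].
  by move=> /bE ->; rewrite rs rho2 opprB.
have [rc|cr] := leP rho c; last first.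
  (* For c < rho the quadratic t^2 - 2 t c + rho^2 exceeds (t - rho)^2, so the ray misses the
     ball. *)
  left=> t t0; rewrite bE// [rho <= c]leNgt cr !andbF orbF -ltNge.
  have : 0 <= (t - rho) ^+ 2 by exact: sqr_ge0.
  have : t * c < t * rho by rewrite ltr_pM2l.
  nra.
right; exists rho, (s + r).
have {}bE t : 0 < t -> b (t *: theta) = (t ^+ 2 - 2 * t * c <= - rho ^+ 2) ||
    (rho <= t <= s) by move=> /bE ->; rewrite rc andbT.
have rhoB : rho ^+ 2 - 2 * rho * c <= - rho ^+ 2.
  have : rho * rho <= rho * c by rewrite ler_pM2l.
  nra.
split => //.
- move=> t1 t2 t3 /andP[t10 +] /andP[t20 +] /andP[t13 t32].
  have t30 : 0 < t3 by exact: lt_le_trans t13.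
  rewrite t30/= !bE//; move=> /orP[h1|/andP[h1 h1']] /orP[h2|/andP[h2 h2']].
  + by apply/orP; left; apply: (@quadratic_convex _ _ t1 t2) => //; rewrite t13.
  + have [h3|h3] := leP rho t3; first by rewrite (le_trans t32 h2') orbT.
    apply/orP; left; apply: (@quadratic_convex _ _ t1 rho) => //.
    by rewrite t13 ltW.
  + apply/orP; left; apply: (@quadratic_convex _ _ rho t2) => //.
    by rewrite t32 (le_trans h1).
  + by rewrite (le_trans h1 t13) (le_trans t32 h2') orbT.
- move=> t t0; rewrite bE// => /orP[h|/andP[_ h]]; last by lra.
  by apply: ball_bound => //; rewrite -[leRHS]opprB -rho2.
- by rewrite bE// lexx andbT (ltW rhos) orbT.
- split => //; last by rewrite lt_eqF.
  by rewrite bE// lexx (ltW rhos) orbT.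
Qed.

(** Enlarging B to B u D makes the integral comparable on every ray, and costs the factor mu(B u D)
    / mu(B) <= C + 1. *)
Lemma maxop_le_rad_max a (f0 : R -> R) x (C : R) : x != 0 -> 0 <= C ->
  measurable_fun setT f0 ->
  (forall r, 0 < r -> (mass a (inner_shadow x r) <= C%:E * mass a (ballb x r))%E) ->
  (maxop a (radial f0) x <=
   (C + 1)%:E * rad_max (radial_exponent a) (fun t => `|f0 t|%R) (norm2 x))%E.
Proof.
move=> x0 C0 mf0 HC; apply: ge_ereal_sup => _ [r /= [r0 mr] <-].
have M0 : (0 <= rad_max (radial_exponent a) (fun t => `|f0 t|%R) (norm2 x))%E.
  exact: rad_max_ge0.
rewrite mu_ball2E intmu_ball2E; rewrite mu_ball2E in mr.
(* A ball of infinite mass contributes 0, by the convention on the inverse of [+oo]. *)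
have [mfin|] := boolP (mass a (ballb x r) \is a fin_num); last first.
  rewrite ge0_fin_numE ?mass_ge0// -leNgt leye_eq => /eqP ->.
  by rewrite invey mule0 mule_ge0// lee_fin addr_ge0.
rewrite lee_pdivr_fin//.
pose b y := ballb x r y || inner_shadow x r y.
have mb : measurable_fun setT b.
  by apply: measurable_or; [exact: measurable_ballb|exact: measurable_inner_shadow].
apply: (@le_trans _ _ (intd (fun y => ((b y)%:R * wt a y)%:E * (`|f0 (norm2 y)|%R)%:E)%E)).
  apply: le_intd => y; first by rewrite mule_ge0 ?mass_integrand_ge0.
  apply: lee_wpmul2r => //; rewrite lee_fin ler_wpM2r ?wt_ge0// ler_nat /b.
  by case: (ballb x r y).
have mabs : measurable_fun setT (fun t => `|f0 t|).
  exact: (measurableT_comp (@normr_measurable R setT)).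
apply: (le_trans (@integral_le_rad_max a b _ (norm2 x) mb mabs _ _)) => //.
  by move=> theta th1; exact: shadow_ray.
rewrite muleAC; rewrite [leRHS]muleC; apply: lee_wpmul2l => //.
apply: (@le_trans _ _ (mass a (ballb x r) + mass a (inner_shadow x r))%E).
  rewrite /mass -intdD; last 4 first.
  - exact: measurable_mass_integrand (measurable_ballb _ _).
  - exact: measurable_mass_integrand (measurable_inner_shadow _ _).
  - by move=> y; exact: mass_integrand_ge0.
  - by move=> y; exact: mass_integrand_ge0.
  apply: le_intd => y; first exact: mass_integrand_ge0.
  rewrite -EFinD lee_fin -mulrDl ler_wpM2r ?wt_ge0// -natrD ler_nat /b.
  by case: (ballb x r y).
rewrite EFinD ge0_muleDl ?lee_fin// mul1e addeC; apply: leeD2r.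
exact: HC.
Qed.

End mass.

(** * The mass of the inner shadow against that of the ball *)

Section shadow_mass.
Variable R : realType.
Variable d : nat.
Hypothesis d_gt0 : (0 < d)%N.
Implicit Types (x y theta : 'rV[R]_d) (b : 'rV[R]_d -> bool) (a : R).
Local Notation V := (unit_ball_volume R d).

Definition vol b : \bar R := intd (fun y => (b y)%:R%:E).

Lemma vol_ballb x r : 0 < r -> vol (ballb x r) = (r ^+ d * V)%:E.
Proof. by move=> r0; exact: ball_volume. Qed.

Lemma vol_mass b : vol b = mass 0 b.
Proof. by apply: eq_intd => y; rewrite /wt oppr0 powRr0 mulr1. Qed.

Lemma le_vol b b' : (forall y, b y -> b' y) -> (vol b <= vol b')%E.
Proof. by move=> bb; rewrite !vol_mass; exact: le_mass. Qed.

Lemma V_gt0 : 0 < V. Proof. exact: unit_ball_volume_gt0. Qed.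

Lemma mass_null0 a b : measurable_fun setT b ->
  mass a b = mass a (fun y => b y && (y != 0)).
Proof.
move=> mb; rewrite /mass intd_null0//; last 2 first.
- exact: measurable_mass_integrand.
- by move=> y; exact: mass_integrand_ge0.
apply: eq_intd => y; rewrite -EFinM; congr EFin.
by case: (b y); case: (y != 0); rewrite /= ?mulr1 ?mulr0 ?mul0r.
Qed.

Lemma vol_null0 b : measurable_fun setT b -> vol b = vol (fun y => b y && (y != 0)).
Proof. by rewrite !vol_mass; exact: mass_null0. Qed.

Lemma measurable_nonzero : measurable_fun setT (fun y : 'rV[R]_d => y != 0).
Proof.
rewrite (_ : (fun y => _) = fun y : 'rV[R]_d => 0 < norm2 y); last first.
  by apply/funext => y; rewrite norm2_gt0.
by apply: measurable_fun_ltr => //; exact: (@measurable_norm2 R d).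
Qed.

Lemma measurable_zero : measurable_fun setT (fun y : 'rV[R]_d => y == 0).
Proof.
rewrite (_ : (fun y => _) = fun y : 'rV[R]_d => ~~ (y != 0)).
  by apply: measurable_neg; exact: measurable_nonzero.
by apply/funext => y; rewrite negbK.
Qed.

Lemma volZ (c : R) b : measurable_fun setT b -> 0 <= c ->
  intd (fun y => (c * (b y)%:R)%:E) = (c%:E * vol b)%E.
Proof.
move=> mb c0; rewrite -intdZ//.
by apply/measurable_EFinP; exact: measurable_natb.
Qed.

Lemma massZ (c : R) a b : measurable_fun setT b -> 0 <= c ->
  intd (fun y => (c * ((b y)%:R * wt a y))%:E) = (c%:E * mass a b)%E.
Proof.
move=> mb c0; rewrite -intdZ//; first exact: (measurable_mass_integrand a mb).
by move=> y; exact: mass_integrand_ge0.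
Qed.

Lemma mass_le_vol a b b' (c : R) : measurable_fun setT b -> measurable_fun setT b' -> 0 <= c ->
  (forall y, y != 0 -> b y -> wt a y <= c /\ b' y) -> (mass a b <= c%:E * vol b')%E.
Proof.
move=> mb mb' c0 H; rewrite -volZ// mass_null0//.
apply: le_intd => y; first by rewrite lee_fin mulr_ge0// wt_ge0.
rewrite lee_fin; have [y0|] := boolP (y != 0); last by rewrite andbF mul0r mulr_ge0.
rewrite andbT; have := H y y0; case: (b y) => [/(_ isT)[h ->]|_].
  by rewrite mul1r mulr1.
by rewrite mul0r mulr_ge0.
Qed.

Lemma vol_le_mass a b b' (c : R) : measurable_fun setT b -> measurable_fun setT b' -> 0 <= c ->
  (forall y, y != 0 -> b y -> 1 <= c * wt a y /\ b' y) -> (vol b <= c%:E * mass a b')%E.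
Proof.
move=> mb mb' c0 H; rewrite -massZ// vol_null0//.
apply: le_intd => // y.
rewrite lee_fin; have [y0|] := boolP (y != 0); last by rewrite andbF !mulr_ge0// wt_ge0.
rewrite andbT; have := H y y0; case: (b y) => [/(_ isT)[h ->]|_].
  by rewrite mul1r.
by rewrite !mulr_ge0// wt_ge0.
Qed.

(** As r <= |x|, the ball stays within norm 2 |x|, where the weight is at least (2 |x|)^(-a). *)
Lemma vol_ball_le_mass a x r : 0 <= a -> x != 0 -> 0 < r <= norm2 x ->
  ((r ^+ d * V)%:E <= ((2 * norm2 x) `^ a)%:E * mass a (ballb x r))%E.
Proof.
move=> a0; rewrite -norm2_gt0 => x0 /andP[r0 rx].
rewrite -(vol_ballb x)//; apply: vol_le_mass; rewrite ?powR_ge0//.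
- exact: measurable_ballb.
- exact: measurable_ballb.
move=> y; rewrite -norm2_gt0 => y0 yB; split => //.
rewrite /wt powRN ler_pdivlMr ?powR_gt0// mul1r ge0_ler_powR// ?nnegrE ?norm2_ge0//.
  by rewrite mulr_ge0// norm2_ge0.
have := ler_norm2D (y - x) x; rewrite subrK; move: yB; rewrite /ballb; lra.
Qed.

Lemma mass_shift a b (v : 'rV[R]_d) : measurable_fun setT b ->
  mass a b = intd (fun y => ((b (y + v))%:R * wt a (y + v))%:E).
Proof.
move=> mb; rewrite /mass -[LHS](intd_shift v)//; first exact: (measurable_mass_integrand a mb).
by move=> y; exact: mass_integrand_ge0.
Qed.

Lemma wt_monotone a (x y : 'rV[R]_d) : a <= 0 -> norm2 x <= norm2 y -> wt a x <= wt a y.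
Proof.
by move=> a0 xy; rewrite /wt ge0_ler_powR// ?nnegrE ?norm2_ge0// oppr_ge0.
Qed.

Lemma mass_le_shift a b b' (v : 'rV[R]_d) : a <= 0 ->
  measurable_fun setT b' ->
  (forall y, b y -> b' (y + v) /\ norm2 y <= norm2 (y + v)) ->
  (mass a b <= mass a b')%E.
Proof.
move=> a0 mb' H; rewrite (@mass_shift a b' v mb'); apply: le_intd => y.
  exact: mass_integrand_ge0.
rewrite lee_fin; case: (b y) (H y) => [/(_ isT)[-> h]|_].
  by rewrite !mul1r wt_monotone.
by rewrite mul0r mulr_ge0// wt_ge0.
Qed.

(** Both sides have the same angular factor; the radial integrals are s^(d-a) / (d-a) and s^d /
    d. *)
Lemma conic_mass_ratio a (s : R) b : 0 < s -> a < d%:R ->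
  measurable_fun setT b -> (forall t y, 0 < t -> b (t *: y) = b y) ->
  (mass a (fun y => b y && (norm2 y <= s)%R) =
   (s `^ (- a) * (d%:R / (d%:R - a)))%R%:E * vol (fun y => b y && (norm2 y <= s)%R))%E.
Proof.
move=> s0 ad mb bcone.
have mg (c : R) : measurable_fun setT (fun t : R => ((t <= s)%R%:R * t `^ (- c))%:E).
  apply/measurable_EFinP; apply: measurable_funM; last exact: measurable_powR.
  by apply: measurable_natb; exact: measurable_fun_ler.
have g0 (c t : R) : (0 <= ((t <= s)%R%:R * t `^ (- c))%:E)%E.
  by rewrite lee_fin mulr_ge0// powR_ge0.
have key (c : R) : c < d%:R ->
    (shell_constant R * mass c (fun y => b y && (norm2 y <= s)%R))%E =
    (sphere_integral (fun y => (b y)%:R%:E) * (s `^ (d%:R - c) / (d%:R - c))%R%:E)%E.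
  move=> cd; rewrite -radial_integral_powR//.
  rewrite -[sphere_integral _]/(sphere_integral (EFin \o (fun y => (b y)%:R))).
  rewrite -polar_product//; last 2 first.
  - exact: measurable_natb.
  - by move=> t y t0; rewrite bcone.
  congr (_ * _)%E; apply: eq_intd => y; rewrite -EFinM mulrA; congr (_ * _)%:E.
  by rewrite -natrM mulnb.
have k0 := shell_constant_gt0 R; have kf := shell_constant_fin_num R.
have d0 : 0 < d%:R :> R by rewrite ltr0n.
have inj (u v : \bar R) : (shell_constant R * u = shell_constant R * v)%E -> u = v.
  move=> uv; apply/eqP; rewrite eq_le.
  by apply/andP; split; rewrite -(lee_pmul2l kf k0) uv lexx.
apply: inj; rewrite key// vol_mass muleCA key ?subr0// muleCA -EFinM; congr (_ * _%:E)%E.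
rewrite powRD; last by apply/implyP => _; rewrite gt_eqF.
by field; rewrite (gt_eqF d0)/= subr_eq0 gt_eqF.
Qed.

(** For r < |x|, the length of the tangents from the origin to the sphere of centre x and radius
    r. *)
Definition tangent_radius x (r : R) : R := Num.sqrt (norm2 x ^+ 2 - r ^+ 2).

Lemma tangent_radiusP x r : 0 < r -> r < norm2 x ->
  [/\ 0 < tangent_radius x r, tangent_radius x r < norm2 x &
      tangent_radius x r ^+ 2 = norm2 x ^+ 2 - r ^+ 2].
Proof.
move=> r0 rs; have s0 : 0 < norm2 x by exact: lt_trans rs.
have sr2 : 0 < norm2 x ^+ 2 - r ^+ 2 by rewrite subr_gt0 ltrXn2r// ?nnegrE ltW.
have rho0 : 0 < tangent_radius x r by rewrite sqrtr_gt0.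
have rho2 : tangent_radius x r ^+ 2 = norm2 x ^+ 2 - r ^+ 2 by rewrite sqr_sqrtr// ltW.
split => //.
rewrite -(@ltr_pXn2r _ 2)// ?nnegrE ?(ltW s0) ?(ltW rho0)// rho2.
by rewrite ltrBlDr ltrDl exprn_gt0.
Qed.

(** The ball of radius r is pulled back to the centre of norm rho on the segment from 0 to x. With n
    = |y| and s = |x|, the inequality to prove factors, after multiplication by s, into (n - s)(s n
    + s^2 - 2 rho^2) <= 0. The last factor is nonnegative under either alternative: for n >= rho it
    is at least (s - rho)(s + 2 rho), and s^2 <= 2 r^2 means 2 rho^2 <= s^2. *)
Lemma cone_in_ball x r y : 0 < r -> r < norm2 x ->
  tangent_radius x r <= norm2 y \/ norm2 x ^+ 2 <= 2 * r ^+ 2 ->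
  norm2 y <= norm2 x -> norm2 y * tangent_radius x r <= dot y x ->
  ballb ((tangent_radius x r / norm2 x) *: x) r y.
Proof.
move=> r0 rs; have [] := tangent_radiusP r0 rs.
set rho := tangent_radius x r; set s := norm2 x; set n := norm2 y.
move=> rho0 rhos rho2 H ns nd.
have s0 : 0 < s by exact: lt_trans rhos.
rewrite /ballb -(@ler_pXn2r _ 2)// ?nnegrE ?norm2_ge0 ?(ltW r0)// sqr_norm2B dotZr.
rewrite norm2Z gtr0_norm ?divr_gt0// -/s -/n divfK ?gt_eqF//.
have h1 : rho / s * (n * rho) <= rho / s * dot y x by rewrite ler_pM2l ?divr_gt0.
suff : n ^+ 2 - 2 * (rho / s * (n * rho)) + rho ^+ 2 <= r ^+ 2 by lra.
rewrite -subr_le0 -(@pmulr_rle0 _ s)//.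
have -> : s * (n ^+ 2 - 2 * (rho / s * (n * rho)) + rho ^+ 2 - r ^+ 2) =
    (n - s) * (s * n + s ^+ 2 - 2 * rho ^+ 2).
  have -> : r ^+ 2 = s ^+ 2 - rho ^+ 2 by rewrite rho2; ring.
  by field; rewrite gt_eqF.
rewrite mulr_le0_ge0 ?subr_le0//.
have n0 : 0 <= n by exact: norm2_ge0.
case: H => [rn|sr].
  have : s * rho <= s * n by rewrite ler_pM2l.
  have : 0 <= (s - rho) * (s + 2 * rho) by rewrite mulr_ge0; lra.
  nra.
have : 0 <= s * n by rewrite mulr_ge0// ltW.
lra.
Qed.

(** For a <= 0 the weight grows with the norm, so a translation outwards can only increase mass. If
    r < |x|, moving the ball of [cone_in_ball] along x onto B takes the shadow into B. If r >= |x|,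
    the shadow is a centred ball: the half facing x is translated by x, the other half is reflected
    before, and each lands in B. Hence the factor 2. *)
Lemma inner_shadow_mass_nonpos a x r : a <= 0 -> x != 0 -> 0 < r ->
  (mass a (inner_shadow x r) <= 2%:E * mass a (ballb x r))%E.
Proof.
move=> a0 x0 r0; have s0 : 0 < norm2 x by rewrite norm2_gt0.
have mB := measurable_ballb x r.
have [rs|sr] := ltP r (norm2 x).
  apply: (@le_trans _ _ (mass a (ballb x r))); last first.
    by rewrite -[leLHS]mul1e; apply: lee_wpmul2r; rewrite ?mass_ge0// lee_fin ler1n.
  have [rho0 rhos rho2] := tangent_radiusP r0 rs.
  apply: (@mass_le_shift a _ _ (x - (tangent_radius x r / norm2 x) *: x)) => // y.
  rewrite /inner_shadow rs => /and3P[h1 h2 h3]; split.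
    have := cone_in_ball r0 rs (or_introl h1) h2 h3.
    rewrite /ballb (_ : y + _ - x = y - (tangent_radius x r / norm2 x) *: x)//.
    by rewrite -addrA [x - _ - x]addrAC subrr add0r.
  rewrite -{1}[x]scale1r -scalerBl -(@ler_pXn2r _ 2)// ?nnegrE ?norm2_ge0//.
  rewrite sqr_norm2D dotZr -addrA lerDl addr_ge0// ?sqr_ge0//.
  rewrite !mulr_ge0//; first by rewrite subr_ge0 ler_pdivrMr// mul1r ltW.
  by apply: le_trans h3; rewrite mulr_ge0 ?norm2_ge0// ltW.
pose G y := ((ballb x r y)%:R * wt a y)%:E.
have mG : measurable_fun setT G := measurable_mass_integrand a mB.
have G0 y : (0 <= G y)%E by exact: mass_integrand_ge0.
have mGx : measurable_fun setT (fun y => G (y + x)).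
  by apply: (measurableT_comp mG); exact: measurable_rVD.
have mGNx : measurable_fun setT (fun y => G (-1 *: y + x)).
  apply: (measurableT_comp mG); apply: measurable_rVD => //.
  exact: measurable_scale.
have E1 : intd (fun y => G (y + x)) = mass a (ballb x r) by exact: intd_shift.
have E2 : intd (fun y => G (-1 *: y + x)) = mass a (ballb x r).
  have n1 : (-1 : R) != 0 by rewrite oppr_eq0 oner_eq0.
  rewrite -E1 -[RHS](@intd_scale _ _ (-1) (fun y => G (y + x)) n1 mGx (fun y => G0 _)).
  by rewrite normrN1 expr1n mul1e.
have -> : (2%:E * mass a (ballb x r) = mass a (ballb x r) + mass a (ballb x r))%E.
  by rewrite -{2 3}[mass _ _]mul1e -ge0_muleDl// lee_fin.
rewrite -{1}E1 -E2 -(intdD mGx mGNx (fun y => G0 _) (fun y => G0 _)).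
apply: le_intd => y; first exact: mass_integrand_ge0.
have key z : norm2 z <= norm2 x -> 0 <= dot z x -> ((1%:R * wt a z)%:E <= G (z + x)%R)%E.
  move=> zx dz; rewrite /G (_ : ballb x r (z + x)); last first.
    by rewrite /ballb addrK (le_trans zx).
  rewrite lee_fin; apply: ler_wpM2l => //; apply: wt_monotone => //.
  rewrite -(@ler_pXn2r _ 2) ?nnegrE ?norm2_ge0//.
  by rewrite sqr_norm2D -addrA lerDl addr_ge0 ?sqr_ge0// mulr_ge0.
rewrite /inner_shadow ltNge sr /=.
have [yx|_] := leP (norm2 y) (norm2 x); last by rewrite mul0r adde_ge0.
have [dy|dy] := leP 0 (dot y x).
  by rewrite -[leLHS]adde0; apply: leeD; [exact: key|exact: G0].
rewrite -[leLHS]add0e; apply: leeD; first exact: G0.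
have -> : wt a y = wt a (-1 *: y) by rewrite /wt norm2Z normrN1 mul1r.
by apply: key; [rewrite norm2Z normrN1 mul1r|rewrite dotZl mulN1r oppr_ge0 ltW].
Qed.

(** Here rho >= |x| / 2, so the shadow has norms at least |x| / 2 while B has norms at most 2 |x|:
    the weights differ by at most 4^a, and the shadow fits into a ball of radius r. *)
Lemma inner_shadow_mass_small a x r : 0 <= a -> x != 0 -> 0 < r ->
  2 * r ^+ 2 <= norm2 x ^+ 2 ->
  (mass a (inner_shadow x r) <= (4 `^ a)%:E * mass a (ballb x r))%E.
Proof.
move=> a0 x0 r0 rs2; have s0 : 0 < norm2 x by rewrite norm2_gt0.
have rs : r < norm2 x.
  rewrite -(@ltr_pXn2r _ 2)// ?nnegrE ?(ltW s0) ?(ltW r0)//.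
  have : 0 < r ^+ 2 by rewrite exprn_gt0.
  lra.
have [rho0 rhos rho2] := tangent_radiusP r0 rs.
have srho : norm2 x / 2 <= tangent_radius x r.
  rewrite -(@ler_pXn2r _ 2)// ?nnegrE ?(ltW rho0) ?divr_ge0 ?(ltW s0)//.
  rewrite rho2; have := sqr_ge0 (norm2 x); lra.
have s2 : 0 < norm2 x / 2 by rewrite divr_gt0.
pose c := (norm2 x / 2) `^ (- a).
apply: (@le_trans _ _ (c%:E * vol (ballb ((tangent_radius x r / norm2 x) *: x) r))%E).
  apply: mass_le_vol; rewrite ?powR_ge0//.
  - exact: measurable_inner_shadow.
  - exact: measurable_ballb.
  move=> y; rewrite -norm2_gt0 => y0; rewrite /inner_shadow rs => /and3P[h1 h2 h3]; split.
    rewrite /wt /c !powRN lef_pV2 ?posrE ?powR_gt0//.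
    by rewrite ge0_ler_powR// ?nnegrE ?norm2_ge0 ?(ltW s2)// (le_trans srho).
  by apply: cone_in_ball => //; left.
rewrite vol_ballb//; have := @vol_ball_le_mass a x r a0 x0.
rewrite r0 (ltW rs) => /(_ isT) H.
apply: (@le_trans _ _ (c%:E * (((2 * norm2 x) `^ a)%:E * mass a (ballb x r)))%E).
  by apply: lee_wpmul2l => //; rewrite lee_fin powR_ge0.
rewrite muleA -EFinM; apply: lee_wpmul2r; first exact: mass_ge0.
rewrite lee_fin /c powRN mulrC ler_pdivrMr ?powR_gt0// -powRM// ?(ltW s2)//.
by rewrite ge0_ler_powR// ?nnegrE ?mulr_ge0// ?(ltW s0) ?(ltW s2)//; lra.
Qed.

(** The shadow may approach the singularity, but the average weight on a cone truncated at radius s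
    = |x| is s^(-a) d / (d - a) <= 2 s^(-a), while on B it is at least (2 s)^(-a) within radius s of
    x. *)
Lemma inner_shadow_mass_large_dim a x r : 0 <= a -> 2 * a <= d%:R -> x != 0 ->
  0 < r -> norm2 x ^+ 2 <= 2 * r ^+ 2 ->
  (mass a (inner_shadow x r) <= (2 * 2 `^ a)%:E * mass a (ballb x r))%E.
Proof.
move=> a0 ad x0 r0 rs2; have s0 : 0 < norm2 x by rewrite norm2_gt0.
set s := norm2 x in s0 rs2 *.
have d0 : 0 < d%:R :> R by rewrite ltr0n.
have ad' : a < d%:R by lra.
have ratio : s `^ (- a) * (d%:R / (d%:R - a)) <= 2 * s `^ (- a).
  rewrite mulrC ler_wpM2r ?powR_ge0// ler_pdivrMr ?subr_gt0//; lra.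
have cst : 2 * s `^ (- a) * (2 * s) `^ a = 2 * 2 `^ a.
  by rewrite powRM ?(ltW s0)// powRN; field; rewrite gt_eqF ?powR_gt0.
(* Used for the tangent cone with r' = r when r < |x|, and for the whole space with r' = |x|
   otherwise. *)
have reduce b r' : 0 < r' <= s -> (forall y, ballb x r' y -> ballb x r y) ->
    measurable_fun setT b -> (forall t y, 0 < t -> b (t *: y) = b y) ->
    (vol (fun y => b y && (norm2 y <= s)%R) <= (r' ^+ d * V)%:E)%E ->
    (mass a (fun y => b y && (norm2 y <= s)%R) <= (2 * 2 `^ a)%:E * mass a (ballb x r))%E.
  move=> r's BB mb bcone volb.
  rewrite conic_mass_ratio//.
  apply: (@le_trans _ _ ((2 * s `^ (- a))%:E * (r' ^+ d * V)%:E)%E).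
    apply: lee_pmul => //.
    - by rewrite lee_fin mulr_ge0 ?powR_ge0// divr_ge0// subr_ge0 ltW.
    - by apply: intd_ge0 => y; rewrite lee_fin.
  have := @vol_ball_le_mass a x r' a0 x0 r's => H.
  apply: (@le_trans _ _ ((2 * s `^ (- a))%:E * (((2 * s) `^ a)%:E * mass a (ballb x r')))%E).
    by apply: lee_wpmul2l => //; rewrite lee_fin mulr_ge0// powR_ge0.
  rewrite muleA -EFinM cst; apply: lee_wpmul2l; first by rewrite lee_fin mulr_ge0// powR_ge0.
  exact: le_mass.
have [rs|sr] := ltP r s.
  have [rho0 rhos rho2] := tangent_radiusP r0 rs.
  pose b y := norm2 y * tangent_radius x r <= dot y x.
  apply: (@le_trans _ _ (mass a (fun y => b y && (norm2 y <= s)%R))).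
    apply: le_mass => y; rewrite /inner_shadow rs => /and3P[h1 h2 h3].
    by rewrite h2 andbT.
  have rs' : 0 < r <= s by rewrite r0 ltW.
  apply: (reduce b r) => //.
  - apply: measurable_fun_ler; last exact: measurable_dotr.
    by apply: measurable_funM => //; exact: (@measurable_norm2 R d).
  - by move=> t y t0; rewrite /b norm2Z dotZl gtr0_norm// -mulrA ler_pM2l.
  rewrite -(vol_ballb ((tangent_radius x r / norm2 x) *: x))//; apply: le_vol => y /andP[h1 h2].
  by apply: cone_in_ball => //; right.
apply: (@le_trans _ _ (mass a (fun y => true && (norm2 y <= s)%R))).
  by apply: le_mass => y; rewrite /inner_shadow ltNge sr.
have ss : 0 < s <= s by rewrite s0 lexx.
apply: (reduce (fun=> true) s) => //.
  by move=> y; rewrite /ballb => /le_trans; apply.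
rewrite -(vol_ballb (0 : 'rV[R]_d))//; apply: le_vol => y /andP[_].
by rewrite /ballb subr0.
Qed.

(** The cosine 3/4 suits two needs: it exceeds rho / |x| <= 2^(-1/2) when |x|^2 <= 2 r^2, and the
    cone is still wide enough to hold a ball of radius 1/4 inside the unit ball. *)
Definition cone34 x : 'rV[R]_d -> bool := fun y => 3 / 4 * norm2 x * norm2 y <= dot y x.

Lemma measurable_cone34 x : measurable_fun setT (cone34 x).
Proof.
apply: measurable_fun_ler; last exact: measurable_dotr.
by apply: measurable_funM => //; exact: (@measurable_norm2 R d).
Qed.

Lemma cone34Z x t y : 0 < t -> cone34 x (t *: y) = cone34 x y.
Proof.
by move=> t0; rewrite /cone34 norm2Z dotZl gtr0_norm// mulrCA ler_pM2l.
Qed.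

(** The ball of radius 1/4 around (3/4) x / |x| lies in the cone and in the unit ball, and has
    4^(-d) of its volume. *)
Lemma sphere_le_cone34 x : x != 0 ->
  (sphere_integral (fun _ : 'rV[R]_d => 1%R%:E) <= (4 ^+ d)%:E * sphere_integral (fun y => (cone34 x y)%:R%:E))%E.
Proof.
rewrite -norm2_gt0 => s0.
have d0 : 0 < d%:R :> R by rewrite ltr0n.
have key (b : 'rV[R]_d -> bool) : measurable_fun setT b ->
    (forall t y, 0 < t -> b (t *: y) = b y) ->
    (shell_constant R * vol (fun y => b y && (norm2 y <= 1)%R))%E =
    (sphere_integral (fun y => (b y)%:R%:E) * (d%:R^-1)%:E)%E.
  move=> mb bcone.
  have -> : (d%:R^-1)%:E = radial_integral d (fun t => ((t <= 1)%R%:R * t `^ (- 0))%:E) :> \bar R.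
    by rewrite radial_integral_powR// powR1 subr0 mul1r.
  rewrite -[sphere_integral _]/(sphere_integral (EFin \o (fun y => (b y)%:R))).
  rewrite -polar_product//.
  - congr (_ * _)%E; apply: eq_intd => y; rewrite oppr0 powRr0 mulr1 -EFinM.
    by rewrite -natrM mulnb.
  - exact: measurable_natb.
  - by move=> t y t0; rewrite bcone.
  - apply/measurable_EFinP; apply: measurable_funM; last exact: measurable_powR.
    by apply: measurable_natb; exact: measurable_fun_ler.
  - by move=> t; rewrite lee_fin mulr_ge0// powR_ge0.
have di : 0 < d%:R^-1 :> R by rewrite invr_gt0.
rewrite -(@lee_pmul2r _ (d%:R^-1)%:E)//.
rewrite -muleA -(key (cone34 x)); last 2 first.
- exact: measurable_cone34.
- by move=> t y t0; exact: cone34Z.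
have := key (fun=> true) (measurable_cst _) (fun _ _ _ => erefl).
move=> <-; rewrite muleCA; apply: lee_wpmul2l; first exact: ltW (shell_constant_gt0 R).
have -> : vol (fun y : 'rV[R]_d => true && (norm2 y <= 1)%R) = V%:E by exact: unit_ball_volumeE.
have -> : V%:E = ((4 ^+ d)%:E * ((4^-1 ^+ d) * V)%:E)%E :> \bar R.
  by rewrite -EFinM mulrA -exprMn divff ?expr1n ?mul1r.
apply: lee_wpmul2l; first by rewrite lee_fin exprn_ge0.
pose c := (3 / 4 / norm2 x) *: x.
have nc : norm2 c = 3 / 4.
  by rewrite norm2Z gtr0_norm ?divr_gt0// divfK// gt_eqF.
rewrite -(vol_ballb c) ?invr_gt0//; apply: le_vol => y; rewrite /ballb => yc.
have yE : y = c + (y - c) by rewrite addrC subrK.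
apply/andP; split; last first.
  by rewrite yE (le_trans (ler_norm2D _ _))// nc; lra.
set z := y - c in yc yE.
set tau := dot z ((norm2 x)^-1 *: x).
have z0 := norm2_ge0 z.
have nx1 : norm2 ((norm2 x)^-1 *: x) = 1 by rewrite norm2_normalize// -norm2_gt0.
have xE : x = norm2 x *: ((norm2 x)^-1 *: x) by rewrite scalerA divff ?scale1r// gt_eqF.
have cE : c = (3 / 4) *: ((norm2 x)^-1 *: x) by rewrite scalerA.
have t1 : - (1 / 4) <= tau.
  by have := dot_ge z ((norm2 x)^-1 *: x); rewrite nx1 mulr1 -/tau; lra.
have dy : dot y x = norm2 x * (3 / 4 + tau).
  rewrite [in LHS]xE dotZr yE dotDl cE dotZl -sqr_norm2 nx1 expr1n mulr1.
  by [].
have ny : norm2 y ^+ 2 = 9 / 16 + 3 / 2 * tau + norm2 z ^+ 2.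
  by rewrite yE sqr_norm2D nc cE dotZl dotC -/tau; field.
rewrite /cone34 dy [3 / 4 * _]mulrC -mulrA ler_pM2l//.
rewrite -(@ler_pXn2r _ 2)// ?nnegrE ?mulr_ge0 ?norm2_ge0//; last by lra.
rewrite exprMn ny.
have z2 : norm2 z ^+ 2 <= 1 / 16.
  have : norm2 z ^+ 2 <= (4^-1) ^+ 2 by rewrite ler_pXn2r// nnegrE.
  lra.
(* Completing the square in [tau]: the claim reduces to tau^2 + (21/32) tau + 27/128 >= 0. *)
have : 0 <= (tau + 21 / 64) ^+ 2 by exact: sqr_ge0.
nra.
Qed.

(** The radii of the shadow form an annulus, and the part of that annulus in the cone of cosine 3/4
    lies in B. Both have the same radial integral, possibly infinite, so only the angular factors
    are compared, at the price 4^d. *)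
Lemma inner_shadow_mass_small_dim a x r : x != 0 ->
  0 < r -> norm2 x ^+ 2 <= 2 * r ^+ 2 ->
  (mass a (inner_shadow x r) <= (4 ^+ d)%:E * mass a (ballb x r))%E.
Proof.
move=> x0 r0 rs2; have s0 : 0 < norm2 x by rewrite norm2_gt0.
pose rho := if r < norm2 x then tangent_radius x r else 0.
pose ann (t : R) := (rho <= t <= norm2 x).
have mann : measurable_fun setT ann by apply: measurable_and; exact: measurable_fun_ler.
have key (b : 'rV[R]_d -> bool) : measurable_fun setT b ->
    (forall t y, 0 < t -> b (t *: y) = b y) ->
    (shell_constant R * mass a (fun y => b y && ann (norm2 y)))%E =
    (sphere_integral (fun y => (b y)%:R%:E) *
     radial_integral d (fun t => ((ann t)%:R * t `^ (- a))%:E))%E.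
  move=> mb bcone.
  rewrite -[sphere_integral _]/(sphere_integral (EFin \o (fun y => (b y)%:R))).
  rewrite -polar_product//.
  - congr (_ * _)%E; apply: eq_intd => y; rewrite -EFinM mulrA; congr (_ * _)%:E.
    by rewrite -natrM mulnb.
  - exact: measurable_natb.
  - by move=> t y t0; rewrite bcone.
  - apply/measurable_EFinP; apply: measurable_funM; last exact: measurable_powR.
    exact: measurable_natb.
  - by move=> t; rewrite lee_fin mulr_ge0// powR_ge0.
apply: (@le_trans _ _ (mass a (fun y => true && ann (norm2 y)))).
  apply: le_mass => y; rewrite /inner_shadow /ann /rho.
  by case: ifP => [_ /and3P[-> ->]//|_ ->]; rewrite norm2_ge0.
apply: (@le_trans _ _ ((4 ^+ d)%:E * mass a (fun y => cone34 x y && ann (norm2 y)))%E); last first.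
  apply: lee_wpmul2l; first by rewrite lee_fin exprn_ge0.
  apply: le_mass => y /andP[h1 /andP[h2 h3]].
  rewrite /ballb -(@ler_pXn2r _ 2)// ?nnegrE ?norm2_ge0 ?(ltW r0)// sqr_norm2B.
  move: h1; rewrite /cone34 => h1.
  have : norm2 y ^+ 2 - 2 * norm2 y * (3 / 4 * norm2 x) <= r ^+ 2 - norm2 x ^+ 2.
    move: h2; rewrite /rho; case: ifPn => [rs|]; last first.
      rewrite -leNgt => sr y0.
      have : norm2 x ^+ 2 <= r ^+ 2 by rewrite lerXn2r// nnegrE ltW.
      have : norm2 y * norm2 y <= norm2 y * norm2 x by rewrite ler_wpM2l.
      have : 0 <= norm2 y * norm2 x by rewrite mulr_ge0// norm2_ge0.
      nra.
    move=> rhoy; have [rho0 rhos rho2] := tangent_radiusP r0 rs.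
    (* By convexity along the ray it suffices to test the two ends of the annulus, the norms rho and
       |x|. *)
    apply: (@quadratic_convex R (3 / 4 * norm2 x) _ (tangent_radius x r) (norm2 x)).
    - by rewrite rhoy.
    - have rho34 : tangent_radius x r <= 3 / 4 * norm2 x.
        rewrite -(@ler_pXn2r _ 2)// ?nnegrE ?mulr_ge0 ?(ltW rho0) ?(ltW s0)//.
        by rewrite exprMn rho2; have := sqr_ge0 (norm2 x); lra.
      have : tangent_radius x r * tangent_radius x r <= tangent_radius x r * (3 / 4 * norm2 x).
        by rewrite ler_pM2l.
      nra.
    - nra.
  lra.
have inj (u v : \bar R) : (shell_constant R * u <= shell_constant R * v)%E -> (u <= v)%E.
  by rewrite (lee_pmul2l (shell_constant_fin_num R) (shell_constant_gt0 R)).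
apply: inj; rewrite muleCA (key (fun=> true))// (key (cone34 x)); last 2 first.
- exact: measurable_cone34.
- by move=> t y t0; exact: cone34Z.
rewrite muleA; apply: lee_wpmul2r; last exact: sphere_le_cone34.
by apply: radial_integral_ge0 => t; rewrite lee_fin mulr_ge0// powR_ge0.
Qed.

(** Four regimes: a <= 0, a small ball, 2 a <= d, and d <= 2 a. In the last one 4^d <= 4^(2a) =
    16^a, which is the largest of the four constants up to the factor 2. *)
Lemma inner_shadow_mass alpha a x r : 0 <= alpha -> a <= alpha -> x != 0 -> 0 < r ->
  (mass a (inner_shadow x r) <= (2 * 16 `^ alpha)%:E * mass a (ballb x r))%E.
Proof.
move=> al0 aal x0 r0.
have one16 : 1 <= 16 `^ alpha :> R.
  by rewrite -[leLHS](powRr0 16); apply: ler_powR; rewrite ?ler1n.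
have lift (c : R) : c <= 2 * 16 `^ alpha ->
    (mass a (inner_shadow x r) <= c%:E * mass a (ballb x r))%E ->
    (mass a (inner_shadow x r) <= (2 * 16 `^ alpha)%:E * mass a (ballb x r))%E.
  by move=> h /le_trans; apply; apply: lee_wpmul2r; rewrite ?mass_ge0// lee_fin.
have pow_le (b : R) : 1 <= b -> b <= 16 -> 0 <= a -> b `^ a <= 16 `^ alpha.
  move=> b1 b16 a0; apply: (@le_trans _ _ (b `^ alpha)); first exact: ler_powR.
  by rewrite ge0_ler_powR// nnegrE// (le_trans ler01).
have [a0|/ltW a0] := leP a 0.
  by apply: (lift 2); [lra|exact: inner_shadow_mass_nonpos].
have [h|/ltW h] := leP (2 * r ^+ 2) (norm2 x ^+ 2).
  apply: (lift (4 `^ a)); last exact: inner_shadow_mass_small.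
  have : 4 `^ a <= 16 `^ alpha by apply: pow_le => //; rewrite ?ler1n ?ler_nat.
  lra.
have [ad|/ltW da] := leP (2 * a) d%:R.
  apply: (lift (2 * 2 `^ a)); last exact: inner_shadow_mass_large_dim.
  by rewrite ler_pM2l//; apply: pow_le => //; rewrite ?ler1n ?ler_nat.
apply: (lift (4 ^+ d)); last exact: inner_shadow_mass_small_dim.
rewrite -powR_mulrn//; apply: (@le_trans _ _ (4 `^ (2 * a))).
  by apply: ler_powR; rewrite ?ler1n.
rewrite powRrM powR_mulrn// (_ : 4 ^+ 2 = 16 :> R); last by ring.
have : 16 `^ a <= 16 `^ alpha by apply: pow_le => //; rewrite ler1n.
lra.
Qed.

End shadow_mass.

(** * Balls that avoid the origin *)

Section annulus_balls.
Variable R : realType.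
Variable d : nat.
Hypothesis d_gt0 : (0 < d)%N.
Implicit Types (x y : 'rV[R]_d) (a r : R).
Local Notation V := (unit_ball_volume R d).

Lemma ballb_norm2 x r y : r < norm2 x -> ballb x r y ->
  norm2 x - r <= norm2 y <= norm2 x + r.
Proof.
move=> rx yB; have := ler_norm2D (y - x) x; rewrite subrK.
have := ler_norm2D (x - y) y; rewrite subrK -[norm2 (x - y)]norm2N opprB.
by move: yB; rewrite /ballb => h1 h2 h3; apply/andP; split; lra.
Qed.

Lemma mass_ballb_gt0 a x r : 0 < r -> r < norm2 x -> (0 < mass a (ballb x r))%E.
Proof.
move=> r0 rx; have s0 : 0 < norm2 x by exact: lt_trans rx.
have h1 : 0 < norm2 x - r by rewrite subr_gt0.
have h2 : norm2 x - r < norm2 x + r by lra.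
have [c [c0 Hc]] := pos_powR_lbound (- a) h1 h2.
have : ((c * (r ^+ d * V))%:E <= mass a (ballb x r))%E.
  rewrite EFinM -(vol_ballb x)// -volZ//; [|exact: measurable_ballb|exact: ltW].
  apply: le_intd => y; first by rewrite lee_fin mulr_ge0// ltW.
  rewrite lee_fin mulrC; case yB : (ballb x r y); last by rewrite !mul0r.
  rewrite !mul1r; have h := ballb_norm2 rx yB.
  have := Hc _ h; rewrite /pos_powR (_ : 0 < norm2 y) ?mul1r//.
  by case/andP: h => h _; exact: lt_le_trans h.
by apply: lt_le_trans; rewrite lte_fin !mulr_gt0// ?exprn_gt0// V_gt0.
Qed.

Lemma mass_ballb_fin a x r : 0 < r -> r < norm2 x -> mass a (ballb x r) \is a fin_num.
Proof.
move=> r0 rx; have h1 : 0 < norm2 x - r by rewrite subr_gt0.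
rewrite ge0_fin_numE ?mass_ge0//.
pose c := (norm2 x - r) `^ (- a) + (norm2 x + r) `^ (- a).
have c0 : 0 <= c by rewrite addr_ge0// powR_ge0.
apply: (@le_lt_trans _ _ (c%:E * vol (ballb x r))%E); last first.
  by rewrite vol_ballb// -EFinM ltry.
apply: mass_le_vol => //; try exact: measurable_ballb.
move=> y y0 yB; split => //; have h := ballb_norm2 rx yB.
have := pos_powR_bound (- a) h1 h; rewrite /pos_powR (_ : 0 < norm2 y) ?mul1r//.
by case/andP: h => h _; exact: lt_le_trans h.
Qed.

Lemma maxop_ge0 a (f0 : R -> R) x : x != 0 -> (0 <= maxop a (radial f0) x)%E.
Proof.
rewrite -norm2_gt0 => s0.
have r0 : 0 < norm2 x / 2 by rewrite divr_gt0.
have rx : norm2 x / 2 < norm2 x by lra.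
apply: (@le_trans _ _ (intmu a (ball2 x (norm2 x / 2)) (fun y => (`|radial f0 y|)%:E)
                   * (mu a (ball2 x (norm2 x / 2)))^-1)%E).
  rewrite mule_ge0//; last by rewrite inve_ge0 mu_ball2E mass_ge0.
  by rewrite intmu_ball2E intd_ge0// => y; rewrite mule_ge0// mass_integrand_ge0.
by apply: ereal_sup_ubound; exists (norm2 x / 2) => //=; rewrite mu_ball2E mass_ballb_gt0.
Qed.

End annulus_balls.

(** * Weak and strong type bounds for bounded exponents *)

Section upper_bounds.
Variable R : realType.
Notation leb := (@lebesgue_measure R).
Variable d : nat.
Hypothesis d_gt0 : (0 < d)%N.
Variables (alpha a : R).
Hypothesis (alpha0 : 0 <= alpha) (a_alpha : a <= alpha).
Local Notation e := (radial_exponent d a).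
Local Notation S1 := (sphere_integral (fun _ : 'rV[R]_d => 1%R%:E)).
Local Notation C0 := (2 * 16 `^ alpha + 1).

Lemma radial_polar (g : R -> \bar R) : measurable_fun setT g -> (forall t, 0 <= g t)%E ->
  (shell_constant R * intd (fun y : 'rV[R]_d => g (norm2 y) * (wt a y)%:E) =
   S1 * \int[leb]_t (g t * (pos_powR e t)%:E))%E.
Proof.
move=> mg g0.
have -> : (\int[leb]_t (g t * (pos_powR e t)%:E) =
   radial_integral d (fun t => g t * (t `^ (- a))%:E))%E.
  apply: eq_integral => t _; rewrite muleCA; congr (_ * _)%E.
  rewrite -EFinM; congr EFin; rewrite /pos_powR /radial_exponent.
  have [t0|_] := ltP 0 t; last by rewrite !mul0r.
  rewrite !mul1r -powR_mulrn ?ltW// -powRD; last by apply/implyP => _; rewrite gt_eqF.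
  by congr (_ `^ _); rewrite -[in LHS](prednK d_gt0) -natr1; ring.
rewrite -[sphere_integral _]/(sphere_integral (EFin \o (fun=> 1))).
rewrite -polar_product//.
- by congr (_ * _)%E; apply: eq_intd => y; rewrite mul1e.
- apply: emeasurable_funM => //; apply/measurable_EFinP; exact: measurable_powR.
- by move=> t; rewrite mule_ge0// lee_fin powR_ge0.
Qed.

Lemma maxop_bound (f0 : R -> R) (x : 'rV[R]_d) : measurable_fun setT f0 -> x != 0 ->
  (maxop a (radial f0) x <= C0%:E * rad_max e (fun t => `|f0 t|%R) (norm2 x))%E.
Proof.
move=> mf0 x0; have c0 : 0 <= 2 * 16 `^ alpha by rewrite mulr_ge0// powR_ge0.
by apply: maxop_le_rad_max => // r r0; exact: inner_shadow_mass.
Qed.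

Lemma C0_gt0 : 0 < C0 :> R.
Proof. by rewrite ltr_wpDl// mulr_ge0// powR_ge0. Qed.

Lemma measurable_abs (f0 : R -> R) : measurable_fun setT f0 ->
  measurable_fun setT (fun t => `|f0 t|).
Proof. by move=> mf0; exact: (measurableT_comp (@normr_measurable R setT)). Qed.

Lemma Lpnorm_radial (p : R) (f0 : R -> R) :
  Lpnorm a p (fun x : 'rV[R]_d => (radial f0 x)%:E) =
  (intd (fun y : 'rV[R]_d => (`|f0 (norm2 y)| `^ p)%:E * (wt a y)%:E) `^ p^-1)%E.
Proof. by []. Qed.

Lemma weak_type_bound : (weak_const d a 1 <= (4 * C0)%:E)%E.
Proof.
apply: ereal_inf_lbound; exists (4 * C0) => //; split.
  by rewrite mulr_ge0// ltW// C0_gt0.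
move=> f0 mf0 _ l l0; rewrite Lpnorm_radial invr1 !poweRe1; last 2 first.
- by apply: intd_ge0 => y; rewrite mule_ge0// lee_fin ?wt_ge0// powR_ge0.
- by rewrite muE mass_ge0.
rewrite muE; have C00 := C0_gt0.
(* The factor between [maxop] and [rad_max] is absorbed into the level; it reappears linearly in the
   constant. *)
have [l' lE l'0] : exists2 l', l = C0 * l' & 0 < l'.
  by exists (l / C0); rewrite ?divr_gt0// mulrC divfK// gt_eqF.
pose f t := `|f0 t|; have mf : measurable_fun setT f by exact: measurable_abs.
have f00 t : 0 <= f t by rewrite normr_ge0.
have mM : measurable_fun setT (rad_max e f) by exact: measurable_rad_max.
have mb : measurable_fun setT (fun t => l'%:E < rad_max e f t)%E.
  by apply: measurable_fun_lte.
have mb' : measurable_fun setT (fun y : 'rV[R]_d => l'%:E < rad_max e f (norm2 y))%E.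
  by apply: (measurableT_comp mb); exact: (@measurable_norm2 R d).
have step : (mass a (fun x : 'rV[R]_d => l%:E < maxop a (radial f0) x)%E <=
    mass a (fun x : 'rV[R]_d => l'%:E < rad_max e f (norm2 x))%E)%E.
  (* The bound by [rad_max] is available for x != 0 only; the origin is added to the set and then
     discarded as a null point. *)
  apply: (@le_trans _ _ (mass a (fun x : 'rV[R]_d => (x == 0) || (l'%:E < rad_max e f (norm2 x))%E))).
    apply: le_mass => x; have [//|x0] := eqVneq x 0 => /= H.
    have := lt_le_trans H (maxop_bound mf0 x0).
    by rewrite lE EFinM lte_pmul2l// lte_fin.
  rewrite mass_null0//; last first.
    by apply: measurable_or => //; exact: measurable_zero.
  by apply: le_mass => x; case: eqVneq => //= _ /andP[].
apply: (@le_trans _ _ (l%:E * mass a (fun x : 'rV[R]_d => l'%:E < rad_max e f (norm2 x))%E)%E).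
  by apply: lee_wpmul2l => //; rewrite lee_fin ltW.
have k0 := shell_constant_gt0 R; have kf := shell_constant_fin_num R.
rewrite -(lee_pmul2l kf k0) muleCA.
have -> : mass a (fun x : 'rV[R]_d => l'%:E < rad_max e f (norm2 x))%E =
    intd (fun y : 'rV[R]_d => (l'%:E < rad_max e f (norm2 y))%E%:R%:E * (wt a y)%:E)%E by [].
rewrite (@radial_polar (fun t => (l'%:E < rad_max e f t)%E%:R%:E)); last 2 first.
- by apply/measurable_EFinP; exact: measurable_natb.
- by move=> t; rewrite lee_fin.
rewrite [leRHS]muleCA (@radial_polar (fun t => (f t `^ 1)%:E)); last 2 first.
- by apply/measurable_EFinP; exact: measurable_fun_powR.
- by move=> t; rewrite lee_fin powR_ge0.
rewrite muleCA [leRHS]muleCA; apply: lee_wpmul2l.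
  by apply: sphere_integral_ge0 => y; rewrite lee_fin.
rewrite lE [4 * _]mulrC [(C0 * l')%:E]EFinM [(C0 * 4)%:E]EFinM -!muleA; apply: lee_wpmul2l; first by rewrite lee_fin ltW.
have -> : (\int[leb]_t ((f t `^ 1)%:E * (pos_powR e t)%:E) = wint e f (fun=> true))%E.
  by apply: eq_integral => t _; rewrite mul1e EFinM powRr1.
exact: rad_max_weak.
Qed.

Lemma strong_type_bound (p : R) : 1 < p ->
  (strong_const d a p <= ((C0 `^ p * (4 * p * 2 `^ (p - 1) / (p - 1))) `^ p^-1)%:E)%E.
Proof.
move=> p1; have p0 : 0 < p by exact: lt_trans p1.
set Cp := 4 * p * _ / _.
have Cp0 : 0 <= Cp.
  by rewrite /Cp !mulr_ge0 ?invr_ge0 ?powR_ge0// ?subr_ge0 ltW.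
have C00 := C0_gt0.
have K0 : 0 <= C0 `^ p * Cp by rewrite mulr_ge0// powR_ge0.
apply: ereal_inf_lbound; exists ((C0 `^ p * Cp) `^ p^-1) => //; split.
  exact: powR_ge0.
move=> f0 mf0 _.
pose f t := `|f0 t|; have mf : measurable_fun setT f by exact: measurable_abs.
have f00 t : 0 <= f t by rewrite normr_ge0.
have mM : measurable_fun setT (rad_max e f) by exact: measurable_rad_max.
have M0 t : (0 <= rad_max e f t)%E by exact: rad_max_ge0.
have mpow (g : R -> \bar R) : measurable_fun setT g -> measurable_fun setT (fun t => g t `^ p)%E.
  move=> mg; apply: (@measurableT_comp _ _ _ _ _ _ (fun x : \bar R => x `^ p)%E) => //.
  exact: measurable_poweR.
rewrite Lpnorm_radial -poweR_EFin -poweRM; last 2 first.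
- by rewrite lee_fin.
- by apply: intd_ge0 => y; rewrite mule_ge0// lee_fin ?wt_ge0// powR_ge0.
rewrite /Lpnorm.
have int0 (g : 'rV[R]_d -> \bar R) : (0 <= intd (fun x => g x `^ p * (wt a x)%:E))%E.
  by apply: intd_ge0 => y; rewrite mule_ge0// ?poweR_ge0// lee_fin wt_ge0.
apply: gt0_ler_poweR; first by rewrite invr_ge0 ltW.
- by rewrite in_itv/= leey andbT; exact: int0.
- rewrite in_itv/= leey andbT mule_ge0// ?lee_fin//.
  by apply: intd_ge0 => y; rewrite mule_ge0// lee_fin ?wt_ge0// powR_ge0.
pose G (y : 'rV[R]_d) := ((C0%:E * rad_max e f (norm2 y)) `^ p * (wt a y)%:E)%E.
have mG : measurable_fun setT G.
  apply: emeasurable_funM; last by apply/measurable_EFinP; exact: measurable_wt.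
  apply: (measurableT_comp (mpow (fun t => C0%:E * rad_max e f t)%E _)); last exact: (@measurable_norm2 R d).
  exact: emeasurable_funM.
have G0 y : (0 <= G y)%E by rewrite mule_ge0// ?poweR_ge0// lee_fin wt_ge0.
have zero_null := @measurable_zero R d.
(* Nothing is claimed about [maxop] at the origin, so the majorant is made infinite there; being a
   null point, it does not change the integral. *)
apply: (@le_trans _ _ (intd (fun y => G y + (y == 0)%:R%:E * +oo)%E)).
  apply: le_intd => y; first by rewrite mule_ge0// ?poweR_ge0// lee_fin wt_ge0.
  have [_|y0] := eqVneq y 0.
    by rewrite mul1e addey ?leey// gt_eqF// (lt_le_trans _ (G0 y))// ltNyr.
  rewrite mul0e adde0; apply: lee_wpmul2r; first by rewrite lee_fin wt_ge0.
  have h0 := maxop_ge0 d_gt0 a f0 y0.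
  apply: gt0_ler_poweR; first exact: ltW.
  - by rewrite in_itv/= leey andbT abse_ge0.
  - by rewrite in_itv/= leey andbT mule_ge0// lee_fin ltW.
  by rewrite gee0_abs//; exact: maxop_bound.
rewrite intd_null0//; last 2 first.
- apply: emeasurable_funD => //; apply: emeasurable_funM => //.
  by apply/measurable_EFinP; exact: measurable_natb.
- by move=> y; rewrite adde_ge0// mule_ge0.
apply: (@le_trans _ _ (intd G)).
  apply: le_intd => y; first by rewrite mule_ge0// adde_ge0// mule_ge0.
  by have [_|_] := eqVneq y 0; rewrite ?mule0// mule1 mul0e adde0.
have k0 := shell_constant_gt0 R; have kf := shell_constant_fin_num R.
rewrite -(lee_pmul2l kf k0).
rewrite (@radial_polar (fun t => (C0%:E * rad_max e f t) `^ p)%E); last 2 first.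
- by apply: mpow; exact: emeasurable_funM.
- by move=> t; exact: poweR_ge0.
rewrite [leRHS]muleCA (@radial_polar (fun t => (f t `^ p)%:E)); last 2 first.
- by apply/measurable_EFinP; exact: measurable_fun_powR.
- by move=> t; rewrite lee_fin powR_ge0.
rewrite [leRHS]muleCA; apply: lee_wpmul2l.
  by apply: sphere_integral_ge0 => y; rewrite lee_fin.
under eq_integral do rewrite poweRM ?M0 ?lee_fin ?(ltW C00)// -muleA.
rewrite ge0_integralZl//; last 3 first.
- apply: emeasurable_funM; first exact: mpow.
  by apply/measurable_EFinP; exact: measurable_pos_powR.
- by move=> t _; rewrite mule_ge0// ?poweR_ge0// lee_fin pos_powR_ge0.
- exact: poweR_ge0.
rewrite poweR_EFin EFinM -muleA; apply: lee_wpmul2l; first by rewrite lee_fin powR_ge0.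
exact: rad_max_strong.
Qed.

End upper_bounds.

(** * Testing the weak type inequality on indicators *)

Section lower_bound_tools.
Variable R : realType.
Variable d : nat.
Hypothesis d_gt0 : (0 < d)%N.
Implicit Types (x y : 'rV[R]_d) (a r p l : R) (A : R -> bool).
Local Notation V := (unit_ball_volume R d).

Lemma mass_le_add a (b b1 b2 : 'rV[R]_d -> bool) :
  measurable_fun setT b1 -> measurable_fun setT b2 ->
  (forall y, b y -> b1 y || b2 y) -> (mass a b <= mass a b1 + mass a b2)%E.
Proof.
move=> m1 m2 H; rewrite /mass -intdD; last 4 first.
- exact: measurable_mass_integrand.
- exact: measurable_mass_integrand.
- by move=> y; exact: mass_integrand_ge0.
- by move=> y; exact: mass_integrand_ge0.
apply: le_intd => y; first exact: mass_integrand_ge0.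
rewrite -EFinD lee_fin -mulrDl ler_wpM2r ?wt_ge0// -natrD ler_nat.
by case: (b y) (H y) => // /(_ isT); case: (b1 y); case: (b2 y).
Qed.

Lemma mass_centered a s : a < d%:R -> 0 < s ->
  mass a (fun y : 'rV[R]_d => norm2 y <= s) =
  (s `^ (d%:R - a) * (d%:R / (d%:R - a)) * V)%:E.
Proof.
move=> ad s0.
have := @conic_mass_ratio R d d_gt0 a s (fun=> true) s0 ad (measurable_cst _) (fun _ _ _ => erefl).
rewrite /= => ->.
have -> : vol (fun y : 'rV[R]_d => norm2 y <= s) = (s ^+ d * V)%:E.
  by rewrite -(vol_ballb (0 : 'rV[R]_d))//; apply: eq_intd => y; rewrite /ballb subr0.
rewrite -EFinM; congr EFin.
have -> : s `^ (d%:R - a) = s `^ (- a) * s ^+ d.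
  rewrite -powR_mulrn ?ltW// -powRD; last by apply/implyP => _; rewrite gt_eqF.
  by rewrite addrC.
ring.
Qed.

Lemma mass_centered_lt a s : a < d%:R -> 0 < s ->
  mass a (fun y : 'rV[R]_d => norm2 y < s) =
  (s `^ (d%:R - a) * (d%:R / (d%:R - a)) * V)%:E.
Proof.
move=> ad s0; rewrite -mass_centered//.
have key (A : R -> bool) : measurable_fun setT A ->
    (shell_constant R * mass a (fun y : 'rV[R]_d => A (norm2 y)))%E =
    (sphere_integral (fun _ : 'rV[R]_d => 1%R%:E) *
     radial_integral d (fun t => ((A t)%:R * t `^ (- a))%:E))%E.
  move=> mA.
  rewrite -[sphere_integral _]/(sphere_integral (EFin \o (fun=> 1))).
  rewrite -polar_product//.
  - by congr (_ * _)%E; apply: eq_intd => y; rewrite mul1e.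
  - apply/measurable_EFinP; apply: measurable_funM; last exact: measurable_powR.
    exact: measurable_natb.
  - by move=> t; rewrite lee_fin mulr_ge0// powR_ge0.
have inj (u v : \bar R) : (shell_constant R * u = shell_constant R * v)%E -> u = v.
  move=> uv; apply/eqP; rewrite eq_le.
  by apply/andP; split;
    rewrite -(lee_pmul2l (shell_constant_fin_num R) (shell_constant_gt0 R)) uv lexx.
apply: inj; rewrite (key (fun t => t < s)) ?(key (fun t => t <= s)); last 2 first.
- exact: measurable_fun_ler.
- exact: measurable_fun_ltr.
by rewrite radial_integral_powR// radial_integral_powR_lt.
Qed.

Lemma lt_maxop a A x r l : 0 < r -> (0 < mass a (ballb x r))%E ->
  mass a (ballb x r) \is a fin_num ->
  (l%:E * mass a (ballb x r) < mass a (fun y => ballb x r y && A (norm2 y)))%E ->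
  (l%:E < maxop a (radial (fun t => (A t)%:R)) x)%E.
Proof.
move=> r0 m0 mf H.
apply: (@lt_le_trans _ _ (intmu a (ball2 x r) (fun y => (`|radial (fun t => (A t)%:R) y|)%:E)
                   * (mu a (ball2 x r))^-1)%E); last first.
  by apply: ereal_sup_ubound; exists r => //=; rewrite mu_ball2E.
rewrite intmu_ball2E mu_ball2E lte_pdivl_fin//.
apply: (lt_le_trans H); apply: le_intd => y; first by rewrite lee_fin mulr_ge0// wt_ge0.
rewrite -EFinM lee_fin mulrAC ler_wpM2r ?wt_ge0//.
by case: (ballb x r y); case: (A (norm2 y)); rewrite /= ?mul1r ?mul0r ?normr0 ?normr1.
Qed.

(** The indicator of a radial set of mass m is tested at the level l: an admissible c satisfies l
    (rho m)^(1/p) <= c m^(1/p). *)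
Lemma weak_const_ge a p l rho m A (E : 'rV[R]_d -> bool) : 0 < p -> 0 < l -> 0 <= rho -> 0 < m ->
  measurable_fun setT A ->
  mass a (fun y => A (norm2 y)) = m%:E ->
  (forall x, E x -> (l%:E < maxop a (radial (fun t => (A t)%:R)) x)%E) ->
  ((rho * m)%:E <= mass a E)%E ->
  ((l * rho `^ p^-1)%:E <= weak_const d a p)%E.
Proof.
move=> p0 l0 rho0 m0 mA mE HE Em.
apply: le_ereal_inf_tmp => _ [c [c0 Hc] <-].
have mA' : measurable_fun setT (fun t => (A t)%:R : R) by exact: measurable_natb.
have LE : Lpnorm a p (fun x : 'rV[R]_d => (radial (fun t => (A t)%:R) x)%:E) = (m%:E `^ p^-1)%E.
  rewrite -mE /Lpnorm; congr (_ `^ _)%E; apply: eq_intd => y.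
  rewrite EFinM; congr (_ * _)%E; rewrite /radial.
  by case: (A (norm2 y)); rewrite abse_EFin poweR_EFin ?normr0 ?normr1 ?powR1 ?powR0 ?gt_eqF.
have mf : (m%:E `^ p^-1 < +oo)%E by rewrite poweR_EFin ltry.
have := Hc _ mA'; rewrite LE => /(_ mf l l0) H.
have mp : 0 < m `^ p^-1 by exact: powR_gt0.
have pi0 : 0 <= p^-1 by rewrite invr_ge0 ltW.
have : ((l * (rho * m) `^ p^-1)%:E <= (c * m `^ p^-1)%:E)%E.
  rewrite [X in (_ <= X)%E]EFinM -poweR_EFin; apply: le_trans H.
  rewrite EFinM -poweR_EFin; apply: lee_wpmul2l; first by rewrite lee_fin ltW.
  apply: gt0_ler_poweR => //.
  - by rewrite in_itv/= leey andbT lee_fin mulr_ge0// ltW.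
  - by rewrite in_itv/= leey andbT muE mass_ge0.
  by apply: (le_trans Em); rewrite muE; apply: le_mass.
by rewrite !lee_fin powRM ?(ltW m0)// mulrA ler_pM2r.
Qed.

End lower_bound_tools.

(** * Mass estimates for pieces of balls *)

Section shells.
Variable R : realType.
Variable d : nat.
Hypothesis d_gt0 : (0 < d)%N.
Implicit Types (x y : 'rV[R]_d) (a r p l : R) (A : R -> bool).
Local Notation V := (unit_ball_volume R d).

(** Small balls around points of the open unit ball have average 1. This trivial bound settles a <=
    0 and the finitely many small dimensions. *)
Lemma half_le_weak_const a p : a < d%:R -> 1 <= p -> ((2^-1)%:E <= weak_const d a p)%E.
Proof.
move=> ad p1; have p0 : 0 < p by exact: lt_le_trans p1.
have mA : measurable_fun setT (fun t : R => t < 1) by exact: measurable_fun_ltr.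
have mAn : measurable_fun setT (fun y : 'rV[R]_d => norm2 y < 1).
  by apply: (measurableT_comp mA); exact: (@measurable_norm2 R d).
have n0 : 0 < d%:R - a by rewrite subr_gt0.
have m0 : 0 < d%:R / (d%:R - a) * V by rewrite mulr_gt0 ?V_gt0// divr_gt0// ltr0n.
have mE : mass a (fun y : 'rV[R]_d => norm2 y < 1) = (d%:R / (d%:R - a) * V)%:E.
  by rewrite mass_centered_lt// powR1 mul1r.
have := @weak_const_ge R d a p 2^-1 1 _ (fun t => t < 1) (fun x => (norm2 x < 1) && (x != 0))
  p0 _ ler01 m0 mA mE; rewrite powR1 mulr1; apply; first by rewrite invr_gt0.
- move=> x /andP[x1]; rewrite -norm2_gt0 => x0.
  pose r := Num.min (norm2 x) (1 - norm2 x) / 2.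
  have r0 : 0 < r by rewrite divr_gt0// lt_min x0 subr_gt0.
  have rx : r < norm2 x.
    rewrite /r; have : Num.min (norm2 x) (1 - norm2 x) <= norm2 x by rewrite ge_min lexx.
    lra.
  have r1 : norm2 x + r < 1.
    rewrite /r; have : Num.min (norm2 x) (1 - norm2 x) <= 1 - norm2 x.
      by rewrite ge_min lexx orbT.
    lra.
  have M0 := mass_ballb_gt0 d_gt0 a r0 rx.
  have Mf := mass_ballb_fin d_gt0 a r0 rx.
  apply: (@lt_maxop _ _ _ _ _ r) => //.
  apply: (@lt_le_trans _ _ (mass a (ballb x r))); last first.
    apply: le_mass => y yB; rewrite yB /=.
    by have /andP[_ h] := ballb_norm2 rx yB; exact: le_lt_trans r1.
  rewrite -(fineK Mf) -EFinM lte_fin; have : 0 < fine (mass a (ballb x r)).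
    by rewrite fine_gt0// M0 -ge0_fin_numE// mass_ge0.
  lra.
- by rewrite mul1r -mE mass_null0.
Qed.

(** The largest possible weight times the volume of a ball containing the set. Both are given
    through squares relative to T, whence the halved exponents. *)
Lemma shell_mass a (b : 'rV[R]_d -> bool) (c : 'rV[R]_d) (q r T : R) :
  0 <= a -> 0 < q -> 0 < r -> 0 < T -> measurable_fun setT b ->
  (forall y, b y -> q * T <= norm2 y ^+ 2 /\ norm2 (y - c) ^+ 2 <= r * T) ->
  (mass a b <= (q `^ (- a / 2) * r `^ (d%:R / 2) * T `^ ((d%:R - a) / 2) * V)%:E)%E.
Proof.
move=> a0 q0 r0 T0 mb H.
have sqrt_pow (u e : R) : 0 < u -> Num.sqrt u `^ e = u `^ (e / 2).
  by move=> u0; rewrite -powR12_sqrt ?ltW// -powRrM mulrC.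
have R0 : 0 < Num.sqrt (r * T) by rewrite sqrtr_gt0 mulr_gt0.
have rT0 : 0 <= r * T by rewrite mulr_ge0// ltW.
have qT0 : 0 <= q * T by rewrite mulr_ge0// ltW.
have Q0 : 0 < Num.sqrt (q * T) by rewrite sqrtr_gt0 mulr_gt0.
apply: (@le_trans _ _ ((Num.sqrt (q * T) `^ (- a))%:E * vol (ballb c (Num.sqrt (r * T))))%E).
  apply: mass_le_vol => //; first exact: measurable_ballb.
  move=> y y0 /H[h1 h2]; split.
    rewrite /wt !powRN lef_pV2 ?posrE ?powR_gt0 ?norm2_gt0//.
    rewrite ge0_ler_powR// ?nnegrE ?norm2_ge0 ?(ltW Q0)//.
    by rewrite -(@ler_pXn2r _ 2)// ?nnegrE ?norm2_ge0 ?(ltW Q0)// (sqr_sqrtr qT0).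
  by rewrite /ballb -(@ler_pXn2r _ 2)// ?nnegrE ?norm2_ge0 ?(ltW R0)// (sqr_sqrtr rT0).
rewrite vol_ballb// -EFinM lee_fin -powR_mulrn ?(ltW R0)// !sqrt_pow ?mulr_gt0//.
rewrite !powRM ?(ltW q0) ?(ltW r0) ?(ltW T0)// mulrDl (@powRD _ T); last by apply/implyP => _; rewrite gt_eqF.
rewrite le_eqVlt; apply/orP; left; apply/eqP; ring.
Qed.

Lemma mass_union_le a (N : nat) (b : 'rV[R]_d -> bool) (s : nat -> 'rV[R]_d -> bool) (C : R) :
  measurable_fun setT b -> (forall j, measurable_fun setT (s j)) ->
  (forall y, b y -> exists2 j, (j < N)%N & s j y) ->
  (forall j, (j < N)%N -> (mass a (s j) <= C%:E)%E) -> (mass a b <= (N%:R * C)%:E)%E.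
Proof.
move=> mb ms; elim: N b mb => [|N IH] b mb H HC.
  rewrite mul0r; apply: (@le_trans _ _ (mass a (fun=> false : bool))).
    by apply: le_mass => y /H[].
  by rewrite /mass (eq_intd (G := fun=> 0%E)) ?intd0// => y; rewrite mul0r.
pose b1 y := b y && ~~ s N y.
have mb1 : measurable_fun setT b1 by apply: measurable_and => //; apply: measurable_neg.
apply: (@le_trans _ _ (mass a b1 + mass a (s N))%E).
  by apply: mass_le_add => // y; rewrite /b1 => ->; case: (s N y).
rewrite -natr1 mulrDl mul1r EFinD; apply: leeD; last exact: HC.
apply: IH => //; last by move=> j jN; apply: HC; exact: ltnW.
move=> y /andP[/H[j jN sj] sN]; exists j => //.
move: jN; rewrite ltnS leq_eqVlt => /orP[/eqP jN|//].
by rewrite jN in sj; rewrite sj in sN.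
Qed.

End shells.

(** * Elementary inequalities for powers *)

Section powR_lemmas.
Variable R : realType.
Implicit Types x y p : R.

Lemma ler_powRl x y p : 0 <= p -> 0 <= x -> x <= y -> x `^ p <= y `^ p.
Proof. by move=> p0 x0 xy; rewrite ge0_ler_powR// nnegrE// (le_trans x0). Qed.

Lemma powR_le1 x p : 0 <= p -> 0 <= x <= 1 -> x `^ p <= 1.
Proof. by move=> p0 /andP[x0 x1]; rewrite (le_trans (ler_powRl p0 x0 x1))// powR1. Qed.

Lemma powRNV x p : 0 <= x -> x `^ (- p) = x^-1 `^ p.
Proof. by move=> x0; rewrite -powR_inv1// -powRrM mulN1r. Qed.

Lemma exp1D_le2 (z : R) (n : nat) : 0 <= z -> n%:R * z <= 2^-1 -> (1 + z) ^+ n <= 2.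
Proof.
move=> z0 nz; apply: (@le_trans _ _ (expR z ^+ n)).
  by rewrite lerXn2r ?nnegrE ?expR_ge0 ?addr_ge0// expR_ge1Dx.
rewrite -expRM_natl mulrC -[expR _]invrK -expRN -[leRHS]invrK lef_pV2 ?posrE ?expR_gt0//.
by apply: le_trans (expR_ge1Dx _); rewrite mulrC; lra.
Qed.

End powR_lemmas.

(** * The mass of a ball reaching slightly beyond the origin *)

Section ball_through_origin.
Variable R : realType.
Variable d : nat.
Hypothesis d_gt0 : (0 < d)%N.
Implicit Types (x y : 'rV[R]_d) (a r p l : R) (A : R -> bool).
Local Notation V := (unit_ball_volume R d).

Lemma ballb_dot x r y : ballb x r y ->
  norm2 y ^+ 2 + norm2 x ^+ 2 - r ^+ 2 <= 2 * dot y x.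
Proof.
move=> h; have : norm2 (y - x) ^+ 2 <= r ^+ 2.
  by rewrite lerXn2r// nnegrE ?norm2_ge0// (le_trans (norm2_ge0 _) h).
rewrite sqr_norm2B; lra.
Qed.

Lemma sqr_norm2B_scale x y (c : R) :
  norm2 (y - c *: x) ^+ 2 = norm2 y ^+ 2 - c * (2 * dot y x) + c ^+ 2 * norm2 x ^+ 2.
Proof.
rewrite sqr_norm2B dotZr norm2Z exprMn real_normK ?num_real//; ring.
Qed.

(* The radius (4/5)^(1/2) of the smallest ball around [11/20 x] that contains the
   part of the ball with |y|^2 <= 27/25 |x|^2 is what produces the base
   (5/4)^(1/2) of the exponential bound. *)
Lemma ball_through_origin_mass a x (eps : R) : 0 < a -> a <= d%:R / 2 ->
  4^-1 <= norm2 x <= 1 -> 0 < eps -> d%:R * eps <= 20^-1 / 25 ->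
  (mass a (ballb x (norm2 x + eps)%R) <= (6 * (4 / 5) `^ (a / 2) * V)%:E)%E.
Proof.
move=> a0 ad; set t := norm2 x => /andP[t4 t1] eps0 epsE.
have d1 : 1 <= d%:R :> R by rewrite ler1n.
have eps4 : eps <= 20^-1 / 25 by apply: le_trans epsE; rewrite ler_peMl// ltW.
set u := (4 / 5) `^ (a / 2); have a0' := ltW a0.
have t0 : 0 < t by lra.
pose T := t ^+ 2; have T0 : 0 < T by rewrite exprn_gt0.
have T1 : T <= 1 by rewrite exprn_ile1// ltW.
have n0 : 0 <= (d%:R - a) / 2 by lra.
have Tn : T `^ ((d%:R - a) / 2) <= 1 by rewrite powR_le1// T1 ltW.
have Tn0 : 0 <= T `^ ((d%:R - a) / 2) by exact: powR_ge0.
have V0 := ltW (V_gt0 R d_gt0).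
have u0 : 0 <= u by exact: powR_ge0.
have an0 : 0 <= a / 2 by rewrite divr_ge0.
have dn0 : 0 <= d%:R / 2 :> R by rewrite divr_ge0.
(* The excess of the squared radius over T; the smallness of [eps] and t >= 1/4 make it a small
   fraction of T. *)
have e' : 2 * t * eps + eps ^+ 2 <= 1 / 50 * T.
  rewrite /T; nra.
have yx y : ballb x (t + eps) y -> norm2 y ^+ 2 - 1 / 50 * T <= 2 * dot y x.
  by move=> /ballb_dot; rewrite -/t; move: e'; rewrite /T; nra.
have mB := measurable_ballb x (t + eps).
have mn := @measurable_norm2 R d.
have mn2 : measurable_fun setT (fun y : 'rV[R]_d => norm2 y ^+ 2).
  exact: measurable_funX.
have mle (c : R) : measurable_fun setT (fun y : 'rV[R]_d => norm2 y ^+ 2 <= c).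
  exact: measurable_fun_ler.
have mge (c : R) : measurable_fun setT (fun y : 'rV[R]_d => c <= norm2 y ^+ 2).
  exact: measurable_fun_ler.
(* The ball is cut by |y|^2 / T at 4/5, 27/25 and 5/4. Beyond 5/4 the small weight suffices, within
   4/5 the centred ball is small, and in the two middle pieces weight and volume share the gain. *)
pose b1 y := ballb x (t + eps) y && (5 / 4 * T <= norm2 y ^+ 2).
pose b2 y := [&& ballb x (t + eps) y, norm2 y ^+ 2 <= 27 / 25 * T & 4 / 5 * T <= norm2 y ^+ 2].
pose b3 y := [&& ballb x (t + eps) y, norm2 y ^+ 2 <= 5 / 4 * T & 27 / 25 * T <= norm2 y ^+ 2].
pose b4 (y : 'rV[R]_d) := norm2 y <= Num.sqrt (4 / 5 * T).
have m1 : measurable_fun setT b1 by exact: measurable_and.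
have m2 : measurable_fun setT b2 by apply: measurable_and => //; exact: measurable_and.
have m3 : measurable_fun setT b3 by apply: measurable_and => //; exact: measurable_and.
have m4 : measurable_fun setT b4 by exact: measurable_fun_ler.
have rescale (c k : R) : 0 <= c -> c <= k * u ->
    c * T `^ ((d%:R - a) / 2) * V <= k * u * V.
  move=> c0 ck; rewrite ler_wpM2r//; apply: le_trans ck.
  by rewrite -[leRHS]mulr1 ler_wpM2l.
have M1 : (mass a b1 <= (2 * u * V)%:E)%E.
  (* As t >= 1/4, the radius t + eps is at most (1 + 4 eps) t, and d eps is so small that (1 + z)^d
     <= 2. *)
  pose z := 4 * eps.
  have z0 : 0 < 1 + z by rewrite addr_gt0// mulr_gt0.
  apply: (le_trans (@shell_mass R d d_gt0 a b1 x (5 / 4) ((1 + z) ^+ 2) T a0' _ _ T0 m1 _)).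
  - by rewrite divr_gt0.
  - by rewrite exprn_gt0.
  - move=> y /andP[yB ->]; split => //.
    rewrite /T -exprMn lerXn2r// ?nnegrE ?norm2_ge0//; first by rewrite mulr_ge0// ltW.
    apply: (le_trans yB); rewrite /z mulrDl mul1r lerD2l.
    have : 0 <= eps * (4 * t - 1) by apply: mulr_ge0; [exact: ltW|move: t4; clear -d_gt0; lra].
    by clear -d_gt0; lra.
  rewrite lee_fin; apply: rescale; first by rewrite mulr_ge0// powR_ge0.
  rewrite mulNr powRNV// invf_div mulrC ler_wpM2r//.
  rewrite -powR_mulrn ?(ltW z0)// -powRrM mulrCA divff// mulr1 powR_mulrn ?(ltW z0)//.
  apply: exp1D_le2; first by rewrite mulr_ge0// ltW.
  by rewrite /z mulrCA; move: epsE; clear -d_gt0; lra.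
have M2 : (mass a b2 <= (1 * u * V)%:E)%E.
  apply: (le_trans (@shell_mass R d d_gt0 a b2 ((11 / 20) *: x) (4 / 5) (4 / 5) T a0' _ _ T0 m2 _)).
  - by rewrite divr_gt0.
  - by rewrite divr_gt0.
  - move=> y /and3P[yB h1 h2]; split => //; rewrite sqr_norm2B_scale.
    by move: (yx y yB) h1 h2 T0; rewrite -/t -/T; clear -d_gt0; lra.
  rewrite lee_fin; apply: rescale; first by rewrite mulr_ge0// powR_ge0.
  (* The exponents combine to (4/5)^((d - a) / 2), and d - a >= a. *)
  rewrite -powRD; last by apply/implyP => _; rewrite gt_eqF// divr_gt0.
  rewrite mul1r; apply: ger_powR; first by apply/andP; split; clear -d_gt0; lra.
  by move: ad; clear -d_gt0; lra.
have M3 : (mass a b3 <= (1 * u * V)%:E)%E.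
  apply: (le_trans (@shell_mass R d d_gt0 a b3 ((5 / 8) *: x) (27 / 25) (7 / 8) T a0' _ _ T0 m3 _)).
  - by rewrite divr_gt0.
  - by rewrite divr_gt0.
  - move=> y /and3P[yB h1 h2]; split => //; rewrite sqr_norm2B_scale.
    by move: (yx y yB) h1 h2 T0; rewrite -/t -/T; clear -d_gt0; lra.
  rewrite lee_fin; apply: rescale; first by rewrite mulr_ge0// powR_ge0.
  rewrite mulNr powRNV// invf_div mul1r.
  (* As d >= 2 a, the volume factor (7/8)^(d/2) is at most (49/64)^(a/2), and (25/27)(49/64) <=
     4/5. *)
  apply: (@le_trans _ _ ((25 / 27) `^ (a / 2) * (49 / 64) `^ (a / 2))).
    rewrite ler_wpM2l ?powR_ge0//.
    apply: (@le_trans _ _ ((7 / 8) `^ (2 * (a / 2)))).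
      by apply: ger_powR; [apply/andP; split; clear -d_gt0; lra|move: ad; clear -d_gt0; lra].
    rewrite powRrM powR_mulrn//.
    rewrite (_ : (7 / 8) ^+ 2 = 49 / 64)//; by field.
  by rewrite -powRM//; apply: ler_powRl => //; clear -d_gt0; lra.
have M4 : (mass a b4 <= (2 * u * V)%:E)%E.
  have q0 : 0 < 4 / 5 * T by rewrite mulr_gt0// divr_gt0.
  have da : a < d%:R by move: a0 ad d1; clear -d_gt0; lra.
  rewrite mass_centered ?sqrtr_gt0// lee_fin ler_wpM2r// mulrC.
  apply: ler_pM.
  - by rewrite divr_ge0// subr_ge0 ltW.
  - exact: powR_ge0.
  - by rewrite ler_pdivrMr ?subr_gt0//; move: ad; clear -d_gt0; lra.
  rewrite -powR12_sqrt ?(ltW q0)// -powRrM [2^-1 * _]mulrC powRM ?(ltW T0)//.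
  rewrite -[leRHS]mulr1; apply: ler_pM => //.
  by apply: ger_powR; [apply/andP; split; clear -d_gt0; lra|move: ad; clear -d_gt0; lra].
have -> : ((6 * u * V)%:E = (2 * u * V)%:E + ((1 * u * V)%:E + ((1 * u * V)%:E + (2 * u * V)%:E)))%E.
  by rewrite -!EFinD; congr EFin; ring.
have m34 : measurable_fun setT (fun y => b3 y || b4 y) by exact: measurable_or.
have m234 : measurable_fun setT (fun y => b2 y || (b3 y || b4 y)) by exact: measurable_or.
apply: (@le_trans _ _ (mass a b1 + (mass a b2 + (mass a b3 + mass a b4)))%E); last first.
  by rewrite !leeD.
apply: (@le_trans _ _ (mass a b1 + mass a (fun y => b2 y || (b3 y || b4 y)))%E).
  apply: mass_le_add => // y yB; rewrite /b1 /b2 /b3 yB /=.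
  have [h1|h1] := leP (5 / 4 * T) (norm2 y ^+ 2) => //=.
  have [h2|h2] := leP (27 / 25 * T) (norm2 y ^+ 2); first by rewrite (ltW h1) orbT.
  rewrite (ltW h2) /=; have [//|h3] := leP (4 / 5 * T) (norm2 y ^+ 2).
  rewrite /b4 andbF/= -(@ler_pXn2r _ 2)// ?nnegrE ?norm2_ge0 ?sqrtr_ge0//.
  by rewrite (@sqr_sqrtr _ (4 / 5 * T)) ?(ltW h3)// mulr_ge0// ltW.
apply: leeD2l; apply: (@le_trans _ _ (mass a b2 + mass a (fun y => b3 y || b4 y))%E).
  exact: mass_le_add.
by apply: leeD2l; exact: mass_le_add.
Qed.

End ball_through_origin.

(** * Lower bound for exponents at most d / 2 *)

Section weak_type_lower_bound.
Variable R : realType.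
Variable d : nat.
Hypothesis d_gt0 : (0 < d)%N.
Local Notation V := (unit_ball_volume R d).

Lemma sqrt5_half : Num.sqrt 5 / 2 = (5 / 4) `^ 2^-1 :> R.
Proof.
rewrite powR12_sqrt ?divr_ge0// sqrtrM// sqrtrV//.
rewrite (_ : 4 = 2 ^+ 2 :> R); last by ring.
by rewrite sqrtr_sqr ger0_norm.
Qed.

(** For x in the annulus 1/4 <= |x| <= 1 the ball of radius |x| + eps contains the whole support, so
    its average is at least m / (6 u V), with u = (4/5)^(a/2). The annulus has mass at least V / 2.
    Halving the level for a strict inequality gives 1/24 = 1 / (6 * 2 * 2). *)
Lemma weak_const_ge_sqrt5 (a : R) : a <= d%:R / 2 ->
  ((24^-1 * (Num.sqrt 5 / 2) `^ a)%:E <= weak_const d a 1)%E.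
Proof.
move=> ad; have d1 : 1 <= d%:R :> R by rewrite ler1n.
have ad' : a < d%:R by lra.
rewrite sqrt5_half -powRrM mulrC [_^-1 * a]mulrC.
have [a0|a0] := leP a 0.
  apply: le_trans (half_le_weak_const d_gt0 ad' (lexx _)); rewrite lee_fin.
  have : (5 / 4) `^ (a / 2) <= (5 / 4 : R) `^ 0.
    by apply: ler_powR; lra.
  by rewrite powRr0; lra.
set n := d%:R - a; have n0 : 0 < n by rewrite subr_gt0.
pose u : R := (4 / 5) `^ (a / 2).
have u0 : 0 < u by rewrite powR_gt0// divr_gt0.
have V0 := V_gt0 R d_gt0.
pose eps : R := d%:R^-1 * (20^-1 / 25).
have eps0 : 0 < eps by rewrite mulr_gt0 ?divr_gt0 ?invr_gt0// ltr0n.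
have epsE : d%:R * eps <= 20^-1 / 25 by rewrite mulVKf// gt_eqF// ltr0n.
pose m := eps `^ n * (d%:R / n) * V.
have m0 : 0 < m by rewrite !mulr_gt0 ?powR_gt0 ?invr_gt0// ltr0n.
have mA : measurable_fun setT (fun t : R => t <= eps) by exact: measurable_fun_ler.
have mE : mass a (fun y : 'rV[R]_d => norm2 y <= eps) = m%:E by rewrite mass_centered.
pose E (x : 'rV[R]_d) := (4^-1 <= norm2 x) && (norm2 x <= 1).
have mn := @measurable_norm2 R d.
have mEE : measurable_fun setT E by apply: measurable_and; exact: measurable_fun_ler.
pose l := m / (12 * u * V).
have uV0 : 0 < 12 * u * V by rewrite !mulr_gt0.
have l0 : 0 < l by rewrite divr_gt0.
have rho0 : 0 <= V / (2 * m) by apply: divr_ge0; lra.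
have := @weak_const_ge R d a 1 l (V / (2 * m)) m (fun t => t <= eps) E ltr01 l0 rho0 m0 mA mE.
rewrite invr1 powRr1// (_ : l * _ = (5 / 4) `^ (a / 2) * 24^-1); last first.
  have -> : (5 / 4 : R) `^ (a / 2) = u^-1.
    by rewrite -powRN powRNV ?divr_ge0// invf_div.
  by rewrite /l; field; rewrite !gt_eqF.
apply.
- move=> x /andP[x4 x1]; have x0 : 0 < norm2 x by lra.
  have r0 : 0 < norm2 x + eps by rewrite addr_gt0.
  have B := @ball_through_origin_mass R d d_gt0 a x eps a0 ad _ eps0 epsE.
  have {}B := B _; rewrite x4 x1 in B; have {}B := B isT.
  have mB : (m%:E <= mass a (fun y => ballb x (norm2 x + eps)%R y && (norm2 y <= eps)%R))%E.
    rewrite -mE; apply: le_mass => y ye; rewrite ye andbT /ballb.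
    have := ler_norm2D y (- x); rewrite norm2N; lra.
  have mB' : (m%:E <= mass a (ballb x (norm2 x + eps)%R))%E.
    by apply: (le_trans mB); apply: le_mass => y /andP[].
  have Bf : mass a (ballb x (norm2 x + eps)%R) \is a fin_num.
    by rewrite ge0_fin_numE ?mass_ge0// (le_lt_trans B)// ltry.
  apply: (@lt_maxop _ _ _ _ _ (norm2 x + eps)) => //.
    by apply: lt_le_trans mB'; rewrite lte_fin.
  apply: lt_le_trans mB; rewrite -(fineK Bf) -EFinM lte_fin.
  move: B; rewrite -{1}(fineK Bf) lee_fin => B.
  apply: (@le_lt_trans _ _ (l * (6 * u * V))); first by rewrite ler_pM2l.
  by rewrite (_ : l * _ = m / 2) /l; [lra|field; rewrite !gt_eqF].
- have -> : V / (2 * m) * m = V / 2 by field; rewrite gt_eqF.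
  have q0 : 0 < 4^-1 :> R by rewrite invr_gt0.
  have M1 : mass a (fun y : 'rV[R]_d => norm2 y <= 1) = (d%:R / n * V)%:E.
    by rewrite mass_centered// powR1 mul1r.
  have M2 : mass a (fun y : 'rV[R]_d => norm2 y <= 4^-1) = (4^-1 `^ n * (d%:R / n) * V)%:E.
    by rewrite mass_centered.
  have M : (mass a (fun y : 'rV[R]_d => (norm2 y <= 1)%R) <=
      mass a E + mass a (fun y : 'rV[R]_d => (norm2 y <= 4^-1)%R))%E.
    apply: mass_le_add => //; first exact: measurable_fun_ler.
    by move=> y y1; rewrite /E y1 andbT; case: leP => //= /ltW ->.
  (* Removing the inner ball costs at most half of the mass, because d - a >= 1/2. *)
  have M3 : (4^-1 : R) `^ n <= 2^-1.
    apply: (@le_trans _ _ (4^-1 `^ 2^-1)).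
      by apply: ger_powR; [apply/andP; split; lra|rewrite /n; lra].
    rewrite powR12_sqrt ?(ltW q0)// (_ : 4^-1 = 2^-1 ^+ 2 :> R); last by field.
    by rewrite sqrtr_sqr ger0_norm.
  have dn : 1 <= d%:R / n by rewrite ler_pdivlMr// mul1r /n; lra.
  move: M; rewrite M1 M2 -leeBlDr// -EFinB; apply: le_trans; rewrite lee_fin.
  have : 4^-1 `^ n * (d%:R / n) * V <= 2^-1 * (d%:R / n) * V.
    by rewrite ler_pM2r// ler_pM2r// divr_gt0// ltr0n.
  have : 1 * V <= d%:R / n * V by rewrite ler_pM2r.
  by lra.
Qed.

End weak_type_lower_bound.

(** * The exponent inequality behind the exponential growth *)

Section analytic.
Variable R : realType.
Implicit Types (w b q : R).

(** Through ln (1 + w) >= w / (1 + w), which is the upper bound for the logarithm applied to 1 / (1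
    + w). *)
Lemma ln1D_ge w : - 2^-1 <= w -> w - 2 * w ^+ 2 <= ln (1 + w).
Proof.
move=> w2; have w0 : 0 < 1 + w by lra.
apply: (@le_trans _ _ (w / (1 + w))).
  rewrite ler_pdivlMr//.
  suff : 0 <= w ^+ 2 * (1 + 2 * w) by lra.
  by rewrite mulr_ge0 ?sqr_ge0//; lra.
rewrite -[ln _]opprK -lnV// lerNr.
rewrite (_ : ln _ = ln (1 + - (w / (1 + w)))); last first.
  by congr ln; field; rewrite gt_eqF.
by apply: le_ln1Dx; rewrite ltrN2 ltr_pdivrMr//; lra.
Qed.

Lemma norm_mul_le (x y : R) : -1 <= x <= 1 -> 0 <= y -> - y <= x * y <= y.
Proof.
move=> /andP[x1 x2] y0; apply/andP; split.
  by rewrite -mulN1r ler_wpM2r.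
by rewrite -[leRHS]mul1r ler_wpM2r.
Qed.

(* Expanding logarithms to first order in [q], the exponents of the two sides
   differ by [q * (b - (1 - tau) / 2) ^+ 2], and [b - (1 - tau) / 2 >= g / 2]. *)
Lemma shell_exponent b g q tau D : b = g + 2^-1 -> 0 < g < 2^-1 ->
  64 * q = g ^+ 2 -> - g <= tau <= 1 -> 0 <= D <= q * g ^+ 2 / 16 ->
  (1 + tau * q) `^ (- b) * (q * (1 + D) - (1 - tau) ^+ 2 * q ^+ 2 / 4) <=
  expR (- (q * g ^+ 2 / 16)) *
  ((1 - 2 * g * q + q * g ^+ 2 / 16) `^ (- b) * (q - b ^+ 2 * q ^+ 2)).
Proof.
move=> bE /andP[g0 g2] qE /andP[tg t1] /andP[D0 D1].
have b0 : 0 < b by lra.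
have b1 : b <= 1 by lra.
have gg0 : 0 < g ^+ 2 by rewrite exprn_gt0.
have gg : g ^+ 2 <= 4^-1.
  have : g ^+ 2 <= 2^-1 ^+ 2 by rewrite lerXn2r ?nnegrE ?(ltW g0) ?(ltW g2).
  by lra.
move: gg0 gg qE D1; set G := g ^+ 2 => gg0 gg qE D1.
have q0 : 0 < q by lra.
have q1 : q <= 2^-1 / 128 by lra.
have /andP[tq1 tq2] : - q <= tau * q <= q.
  by apply: norm_mul_le (ltW q0); apply/andP; split; lra.
have /andP[_ gq] : - q <= (2 * g) * q <= q.
  by apply: norm_mul_le (ltW q0); apply/andP; split; lra.
have gq0 : 0 <= 2 * g * q by rewrite !mulr_ge0// ltW.
have /andP[_ qG] : - q <= (4 * G) * q <= q.
  by apply: norm_mul_le (ltW q0); apply/andP; split; lra.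
have qG0 : 0 <= q * G by rewrite mulr_ge0// ltW.
have b20 : 0 <= b ^+ 2 by exact: sqr_ge0.
have b21 : b ^+ 2 <= 1 by rewrite exprn_ile1// ltW.
pose c := b ^+ 2 * q.
have c0 : 0 <= c by rewrite mulr_ge0// ltW.
have cq : c <= q by rewrite ler_piMl// ltW.
pose k := (1 - tau) ^+ 2.
have k4 : k <= 4.
  have : k <= 2 ^+ 2 by rewrite lerXn2r ?nnegrE ?subr_ge0//; move: tg g2; clear; lra.
  by clear; lra.
have kq : k * q <= 4 * q by rewrite ler_pM2r.
have r0 : 0 < 1 + D - k * q / 4 by move: D0 kq q1; clear; lra.
have rE : q * (1 + D) - k * q ^+ 2 / 4 = q * (1 + D - k * q / 4) by field.
have hE : q - b ^+ 2 * q ^+ 2 = q * (1 - c) by rewrite /c; ring.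
have h0 : 0 < 1 - c by move: cq q1; clear; lra.
have t1q : 0 < 1 + tau * q by move: tq1 q1; clear; lra.
have w1 : 0 < 1 - 2 * g * q + q * G / 16 by move: gq qG0 q1; clear; lra.
rewrite -/k rE hE -ler_ln ?posrE; last 2 first.
- by rewrite !mulr_gt0 ?powR_gt0.
- by rewrite !mulr_gt0 ?powR_gt0 ?expR_gt0.
rewrite !lnM ?posrE ?mulr_gt0 ?powR_gt0 ?expR_gt0// expRK !ln_powR.
have L1 : tau * q - 2 * (tau * q) ^+ 2 <= ln (1 + tau * q) by apply: ln1D_ge; move: tq1 q1; clear; lra.
have L2 : ln (1 + D - k * q / 4) <= D - k * q / 4.
  by rewrite -addrA; apply: le_ln1Dx; move: r0; clear; lra.
have L3 : - c - 2 * c ^+ 2 <= ln (1 - c).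
  by have := @ln1D_ge (- c); rewrite sqrrN; apply; move: cq q1; clear; lra.
have L4 : ln (1 - 2 * g * q + q * G / 16) <= - (2 * g * q) + q * G / 16.
  by rewrite -addrA; apply: le_ln1Dx; move: w1; clear; lra.
have L1' := ler_wpM2l (ltW b0) L1.
have L4' := ler_wpM2l (ltW b0) L4.
have key : 0 <= q * ((b - (1 - tau) / 2 - g / 2) * (b - (1 - tau) / 2 + g / 2)).
  by apply: mulr_ge0; [exact: ltW|apply: mulr_ge0; move: bE g0 tg t1; clear; lra].
have e1 : 0 <= (q - tau * q) * (q + tau * q).
  by apply: mulr_ge0; move: tq1 tq2; clear; lra.
have e1' : b * (tau * q) ^+ 2 <= (tau * q) ^+ 2 by rewrite ler_piMl// sqr_ge0.
have e2 : 0 <= (q - c) * (q + c) by apply: mulr_ge0; move: c0 cq q0; clear; lra.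
have e3 : b * (q * G) <= q * G by rewrite ler_piMl.
(* The choice 64 q = g^2 turns the errors of second order in q into small multiples of q g^2, below
   the main gain. *)
have qq : 64 * (q * q) = q * G by rewrite -qE; ring.
have gE : b * (2 * g * q) = 2 * c - b * q by rewrite /c bE; field.
have keyE : q * ((b - (1 - tau) / 2 - g / 2) * (b - (1 - tau) / 2 + g / 2)) =
   c - b * q + b * (tau * q) + k * q / 4 - q * G / 4.
  by rewrite /c /k /G; field.
rewrite keyE in key.
move: L1' L2 L3 L4' key e1 e1' e2 e3 qq gE D1; clear; lra.
Qed.

End analytic.

(** * Concentration of a ball near its equator *)

Section slabs.
Variable R : realType.
Variable d : nat.
Hypothesis d_gt0 : (0 < d)%N.
Implicit Types (x y c : 'rV[R]_d) (a r : R).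
Local Notation V := (unit_ball_volume R d).

Lemma vol_reflect (b : 'rV[R]_d -> bool) c : measurable_fun setT b ->
  vol b = vol (fun y => b (-1 *: y + c)).
Proof.
move=> mb; have n1 : (-1 : R) != 0 by rewrite oppr_eq0 oner_eq0.
have mG : measurable_fun setT (fun y => (b y)%:R%:E : \bar R).
  by apply/measurable_EFinP; exact: measurable_natb.
have mGc : measurable_fun setT (fun y => (b (y + c))%:R%:E : \bar R).
  by apply: (measurableT_comp mG); exact: measurable_rVD.
rewrite /vol -[LHS](intd_shift c)//.
have := @intd_scale _ _ (-1) (fun y => (b (y + c))%:R%:E) n1 mGc.
by rewrite normrN1 expr1n mul1e => <-.
Qed.


Lemma vol_le_add (b b1 b2 : 'rV[R]_d -> bool) :
  measurable_fun setT b1 -> measurable_fun setT b2 ->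
  (forall y, b y -> b1 y || b2 y) -> (vol b <= vol b1 + vol b2)%E.
Proof. by rewrite !vol_mass; exact: mass_le_add. Qed.

(** The reflection through the centre exchanges the two halves, which together cover the ball. *)
Lemma half_ball_vol c x r : 0 < r ->
  ((2^-1 * (r ^+ d * V))%:E <= vol (fun y => ballb c r y && (0 <= dot (y - c) x)%R))%E.
Proof.
move=> r0.
have mB := measurable_ballb c r.
have mdot : measurable_fun setT (fun y => dot (y - c) x).
  apply: (@measurable_dot R d _ _ (fun y => y - c) (fun=> x)) => //.
  exact: measurable_rVD.
have mp : measurable_fun setT (fun y => ballb c r y && (0 <= dot (y - c) x)).
  by apply: measurable_and => //; exact: measurable_fun_ler.
have mm : measurable_fun setT (fun y => ballb c r y && (dot (y - c) x <= 0)).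
  by apply: measurable_and => //; exact: measurable_fun_ler.
set P := vol _.
have PE : vol (fun y => ballb c r y && (dot (y - c) x <= 0)) = P.
  rewrite (vol_reflect (c + c) mm); congr (intd _); apply/funext => y.
  have yE : -1 *: y + (c + c) - c = - (y - c) by rewrite scaleN1r addrA addrK opprB addrC.
  by rewrite /ballb yE norm2N -[- (y - c)]scaleN1r dotZl mulN1r oppr_le0.
have : (vol (ballb c r) <= P + P)%E.
  rewrite -{2}PE; apply: vol_le_add => // y yB; rewrite yB /=.
  by case: leP => // /ltW.
have P0 : (0 <= P)%E by apply: intd_ge0 => y; rewrite lee_fin.
rewrite vol_ballb//; have := P0; case: P {PE P0} => [p| |]//= _.
- by rewrite -EFinD !lee_fin; lra.
- by move=> _; rewrite leey.
Qed.

(** The part of the half ball beyond thickness e lies in a ball of squared radius h - e^2 around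
    (lam + e) x, all relative to |x|. By hypothesis it has at most a quarter of the volume, so a
    quarter of the ball remains in the slab; there the weight is bounded below. *)
Lemma slab_mass a (b : 'rV[R]_d -> bool) x (lam h q e : R) : 0 <= a -> x != 0 ->
  measurable_fun setT b -> 0 < e -> e ^+ 2 < h -> 0 < q ->
  (h - e ^+ 2) `^ (d%:R / 2) <= 4^-1 * h `^ (d%:R / 2) ->
  (forall y, norm2 (y - lam *: x) ^+ 2 <= h * norm2 x ^+ 2 ->
     0 <= dot y x - lam * norm2 x ^+ 2 <= e * norm2 x ^+ 2 ->
     norm2 y ^+ 2 <= q * norm2 x ^+ 2 /\ b y) ->
  ((4^-1 * (q `^ (- a / 2) * h `^ (d%:R / 2) * (norm2 x ^+ 2) `^ ((d%:R - a) / 2) * V))%:E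
    <= mass a b)%E.
Proof.
move=> a0; rewrite -norm2_gt0 => s0 mb e0 eh q0 he H.
set s := norm2 x in s0 H *; set T := s ^+ 2 in H *.
have T0 : 0 < T by rewrite exprn_gt0.
have V0 := V_gt0 R d_gt0.
have h0 : 0 < h by apply: lt_trans eh; rewrite exprn_gt0.
have u0 : 0 < h - e ^+ 2 by rewrite subr_gt0.
have sqrt_pow (u : R) : 0 < u -> (Num.sqrt u * s) ^+ d = u `^ (d%:R / 2) * s ^+ d.
  by move=> u0'; rewrite exprMn -powR12_sqrt ?(ltW u0')// -[(u `^ _) ^+ d]powR_mulrn ?powR_ge0// -powRrM [2^-1 * _]mulrC.
have sqrt_gt (u : R) : 0 < u -> 0 < Num.sqrt u * s by move=> u0'; rewrite mulr_gt0// sqrtr_gt0.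
have ballE c (u : R) y : 0 < u -> ballb c (Num.sqrt u * s) y = (norm2 (y - c) ^+ 2 <= u * T).
  move=> u0'; rewrite /ballb -(@ler_pXn2r _ 2)// ?nnegrE ?norm2_ge0 ?(ltW (sqrt_gt _ u0'))//.
  by rewrite exprMn (sqr_sqrtr (ltW u0')).
have dE y : dot (y - lam *: x) x = dot y x - lam * T.
  by rewrite dotDl -scaleNr dotZl -sqr_norm2 mulNr.
pose S y := [&& ballb (lam *: x) (Num.sqrt h * s) y, 0 <= dot (y - lam *: x) x &
  dot (y - lam *: x) x <= e * T].
have mdot : measurable_fun setT (fun y => dot (y - lam *: x) x).
  apply: (@measurable_dot R d _ _ (fun y => y - lam *: x) (fun=> x)) => //.
  exact: measurable_rVD.
have mS : measurable_fun setT S.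
  apply: measurable_and; first exact: measurable_ballb.
  by apply: measurable_and; exact: measurable_fun_ler.
have volS : ((4^-1 * (h `^ (d%:R / 2) * s ^+ d * V))%:E <= vol S)%E.
  have H1 := half_ball_vol (lam *: x) x (sqrt_gt _ h0).
  have H2 : (vol (fun y => ballb (lam *: x) (Num.sqrt h * s)%R y && (0 <= dot (y - lam *: x) x)%R)
      <= vol S + vol (ballb ((lam + e) *: x) (Num.sqrt (h - e ^+ 2) * s)%R))%E.
    apply: vol_le_add => //; first exact: measurable_ballb.
    move=> y /andP[]; rewrite /S !ballE// => yB y0; rewrite yB y0 /=; case: leP => //= ye.
    have -> : y - (lam + e) *: x = (y - lam *: x) - e *: x.
      by rewrite scalerDl opprD addrA.
    rewrite sqr_norm2B_scale; have : 0 <= e * (dot (y - lam *: x) x - e * T).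
      by rewrite mulr_ge0 ?(ltW e0)// subr_ge0 ltW.
    rewrite -/s -/T; lra.
  move: H2; rewrite vol_ballb ?sqrt_gt// -leeBlDr//.
  apply: le_trans; rewrite leeBrDr//; apply: le_trans H1; rewrite -EFinD lee_fin !sqrt_pow//.
  have : (h - e ^+ 2) `^ (d%:R / 2) * (s ^+ d * V) <= 4^-1 * h `^ (d%:R / 2) * (s ^+ d * V).
    by rewrite ler_pM2r// mulr_gt0// exprn_gt0.
  lra.
have qT0 : 0 < q * T by rewrite mulr_gt0.
have : (vol S <= ((q * T) `^ (a / 2))%:E * mass a b)%E.
  apply: vol_le_mass => //; first exact: powR_ge0.
  move=> y y0 /and3P[]; rewrite ballE// dE => h1 h2 h3.
  have /(_ _)[|yq yb] := H y h1; first by rewrite h2.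
  split => //; rewrite /wt powRN ler_pdivlMr ?powR_gt0 ?norm2_gt0// mul1r.
  have -> : norm2 y `^ a = (norm2 y ^+ 2) `^ (a / 2).
    by rewrite -powR_mulrn ?norm2_ge0// -powRrM mulrCA divff// mulr1.
  by apply: ler_powRl => //; rewrite ?sqr_ge0 ?divr_ge0.
move=> /(le_trans volS).
rewrite [X in (X <= _)%E -> _](_ : _ = ((q * T) `^ (a / 2))%:E * (4^-1 * (q `^ (- a / 2) * h `^ (d%:R / 2) * T `^ ((d%:R - a) / 2) * V))%:E)%E.
  by rewrite lee_pmul2l// lte_fin powR_gt0.
rewrite -EFinM; congr EFin.
have -> : s ^+ d = T `^ (d%:R / 2).
  by rewrite /T -[s ^+ 2]powR_mulrn ?(ltW s0)// -powRrM mulrCA divff// mulr1 powR_mulrn ?(ltW s0).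
rewrite mulrDl (@powRD _ T); last by apply/implyP => _; rewrite gt_eqF.
rewrite mulNr !powRN powRM ?(ltW q0) ?(ltW T0)//; field.
by rewrite !gt_eqF ?powR_gt0.
Qed.

End slabs.

(** * Most of the mass of a small ball lies inside the unit ball *)

Section exponential_growth.
Variable R : realType.

Lemma exists_shell (u : nat -> R) (w : R) (N : nat) : u 0%N <= w ->
  exists j, [/\ (j <= N)%N, u j <= w & j = N \/ w <= u j.+1].
Proof.
move=> u0; elim: N => [|N [j [jN uj H]]]; first by exists 0%N; split => //; left.
case: H => [jE|H]; last by exists j; split; [exact: ltnW|done|right].
have [h|/ltW h] := leP w (u N.+1).
  by exists j; split; [exact: ltnW|done|right; rewrite jE].
by exists N.+1; split => //; left.
Qed.

Variables (b g q : R) (N : nat).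
Hypotheses (bE : b = g + 2^-1) (g_itv : 0 < g < 2^-1) (qE : 64 * q = g ^+ 2).
Hypothesis NE : 16 * (1 + g) <= q * g ^+ 2 * N%:R.
(** Relative to |x|, [e] is the thickness of the slab next to (1 - b q) x, and [h] = q - (b q)^2 the
    squared radius of the section of the ball through that point. Squared norms in the slab are at
    most [qG] = (1 - b q)^2 + 2 e + h, with 2 b - 1 = 2 g. The levels [tau j] climb from - g to 1 in
    N steps of size [D], and [NE] makes D as small as [shell_exponent] requires. *)
Let e := q * g ^+ 2 / 32.
Let h := q - b ^+ 2 * q ^+ 2.
Let qG := 1 - 2 * g * q + q * g ^+ 2 / 16.
Let D := (1 + g) / N%:R.
Let tau (j : nat) := - g + j%:R * D.

Let g0 : 0 < g. Proof. by case/andP: g_itv. Qed.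
Let g2 : g < 2^-1. Proof. by case/andP: g_itv. Qed.
Let gg0 : 0 < g ^+ 2. Proof. exact: exprn_gt0. Qed.
Let gg : g ^+ 2 <= 4^-1.
Proof.
have : g ^+ 2 <= 2^-1 ^+ 2 by rewrite lerXn2r ?nnegrE ?(ltW g0) ?(ltW g2).
by lra.
Qed.
Let q0 : 0 < q. Proof. by move: gg0; rewrite -qE; lra. Qed.
Let q1 : q <= 2^-1 / 128. Proof. by move: gg; rewrite -qE; lra. Qed.
Let b0 : 0 < b. Proof. by move: g0; rewrite bE; lra. Qed.
Let b1 : b < 1. Proof. by move: g2; rewrite bE; lra. Qed.
Let qgg0 : 0 < q * g ^+ 2. Proof. exact: mulr_gt0. Qed.
Let N0 : 0 < N%:R :> R.
Proof.
have : 0 < q * g ^+ 2 * N%:R by apply: lt_le_trans NE; have := g0; lra.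
by rewrite pmulr_rgt0.
Qed.
Let D0 : 0 < D. Proof. by rewrite divr_gt0// addr_gt0. Qed.
Let DE : D <= q * g ^+ 2 / 16.
Proof. by rewrite ler_pdivrMr//; have := NE; lra. Qed.
Let tauN : tau N = 1.
Proof. by rewrite /tau /D mulrC divfK ?gt_eqF//; ring. Qed.
Let tau_itv j : (j <= N)%N -> - g <= tau j <= 1.
Proof.
move=> jN; rewrite -tauN /tau lerDl mulr_ge0 ?(ltW D0)//= lerD2l.
by rewrite ler_pM2r// ler_nat.
Qed.
Let gq : g * q <= 2^-1 * q. Proof. by rewrite ler_pM2r// ltW. Qed.
Let bb1 : b ^+ 2 <= 1. Proof. by rewrite exprn_ile1// ltW. Qed.
Let bbq : b ^+ 2 * q ^+ 2 <= 2^-1 / 128 * q.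
Proof.
rewrite expr2 mulrA; rewrite ler_pM2r//; apply: le_trans q1.
by rewrite ler_piMl// ltW.
Qed.
Let h0 : 0 < h. Proof. by rewrite /h; have := bbq; have := q0; lra. Qed.
Let ee : q * g ^+ 2 <= 4^-1 * q. Proof. by rewrite mulrC ler_pM2r. Qed.
Let e0 : 0 < e. Proof. by rewrite divr_gt0. Qed.
Let qG0 : 0 < qG.
Proof. by rewrite /qG; have := qgg0; have := gq; have := q1; have := q0; lra. Qed.
Let eh : e ^+ 2 < h.
Proof.
have e1 : e <= q by rewrite /e; have := ee; have := q0; lra.
have : e ^+ 2 <= q * q by rewrite expr2 ler_pM// ltW.
have : q * q <= 2^-1 / 128 * q by rewrite ler_pM2r.
rewrite /h; have := bbq; have := q0; lra.
Qed.

Variable d : nat.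
Hypothesis d_gt0 : (0 < d)%N.
Local Notation V := (unit_ball_volume R d).
Implicit Types x y : 'rV[R]_d.
Local Notation a := (b * d%:R).

Hypothesis d_large1 : (h - e ^+ 2) `^ (d%:R / 2) <= 4^-1 * h `^ (d%:R / 2).
Hypothesis d_large2 : N.+1%:R * expR (- (q * g ^+ 2 / 16)) `^ (d%:R / 2) <= 4^-1.

(* The part of the ball outside the unit ball is cut into thin shells
   [1 + tau j * q <= |y|^2 / |x|^2 <= 1 + tau j.+1 * q], each contained in a small
   ball, and compared with a slab of the ball inside the unit ball. *)
Lemma third_lt_maxop x : x != 0 -> (1 - g * q) * norm2 x ^+ 2 < 1 ->
  ((3^-1)%:E < maxop a (radial (fun t => (t < 1)%R%:R)) x)%E.
Proof.
move=> x0; have s0 : 0 < norm2 x by rewrite norm2_gt0.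
set s := norm2 x in s0 *; set T := s ^+ 2 => T1.
have T0 : 0 < T by rewrite exprn_gt0.
have V0 := V_gt0 R d_gt0.
have a0 : 0 <= a by rewrite mulr_ge0// ltW.
pose r := Num.sqrt q * s.
have r0 : 0 < r by rewrite mulr_gt0// sqrtr_gt0.
have r2 : r ^+ 2 = q * T by rewrite exprMn (sqr_sqrtr (ltW q0)).
have rs : r < s.
  rewrite gtr_pMl// -(@ltr_pXn2r _ 2)// ?nnegrE ?sqrtr_ge0// (sqr_sqrtr (ltW q0)) expr1n.
  by have := q1; lra.
have ballE y : ballb x r y = (norm2 (y - x) ^+ 2 <= q * T).
  by rewrite /ballb -(@ler_pXn2r _ 2)// ?nnegrE ?norm2_ge0 ?(ltW r0)// r2.
have xbE y : norm2 (y - x) ^+ 2 = norm2 y ^+ 2 - 2 * dot y x + T.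
  by have := sqr_norm2B_scale x y 1; rewrite scale1r mul1r expr1n mul1r.
have mB := measurable_ballb x r.
have mn := @measurable_norm2 R d.
have mn2 : measurable_fun setT (fun y : 'rV[R]_d => norm2 y ^+ 2) by exact: measurable_funX.
have mle (c : R) : measurable_fun setT (fun y : 'rV[R]_d => norm2 y ^+ 2 <= c).
  exact: measurable_fun_ler.
have mge (c : R) : measurable_fun setT (fun y : 'rV[R]_d => c <= norm2 y ^+ 2).
  exact: measurable_fun_ler.
have mlt : measurable_fun setT (fun y : 'rV[R]_d => norm2 y < 1).
  exact: measurable_fun_ltr.
pose good y := ballb x r y && (norm2 y < 1).
pose bad y := ballb x r y && ~~ (norm2 y < 1).
have mgood : measurable_fun setT good by exact: measurable_and.
have mbad : measurable_fun setT bad by apply: measurable_and => //; exact: measurable_neg.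
pose Q := (qG `^ (- b) * h) `^ (d%:R / 2) * T `^ ((d%:R - a) / 2) * V.
have powE (u v : R) : 0 < u -> 0 <= v -> u `^ (- a / 2) * v `^ (d%:R / 2) = (u `^ (- b) * v) `^ (d%:R / 2).
  move=> u0 v0; rewrite powRM ?powR_ge0// -powRrM; congr (u `^ _ * _); ring.
have Hgood : ((4^-1 * Q)%:E <= mass a good)%E.
  rewrite /Q -powE ?(ltW h0)//.
  apply: (@slab_mass R d d_gt0 a good x (1 - b * q) h qG e a0 x0 mgood e0 eh qG0 d_large1).
  move=> y; rewrite -/s -/T sqr_norm2B_scale -/s -/T => h1 /andP[h2 h3].
  have bq1 : 0 <= 1 - b * q.
    have : b * q <= q by rewrite ler_piMl// ltW.
    by have := q1; lra.
  have bq0 : 0 <= b * q by rewrite mulr_ge0// ltW.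
  have H2 := mulr_ge0 bq0 h2.
  have H3 : 0 <= (1 - b * q) * (e * T - (dot y x - (1 - b * q) * T)).
    by rewrite mulr_ge0// subr_ge0.
  have H4 : 0 <= b * q * (e * T) by rewrite !mulr_ge0// ltW.
  have yq : norm2 y ^+ 2 <= qG * T.
    have -> : qG = h + 2 * e + (1 - b * q) ^+ 2 by rewrite /qG /h /e bE; field.
    lra.
  split => //; rewrite /good ballE xbE; apply/andP; split.
    move: h1 H2; rewrite /h; lra.
  (* The slab lies inside the unit ball because [qG] <= 1 - g q and (1 - g q) |x|^2 < 1. *)
  rewrite -(@ltr_pXn2r _ 2)// ?nnegrE ?norm2_ge0// expr1n.
  apply: le_lt_trans T1; apply: (le_trans yq); rewrite ler_pM2r// /qG.
  have : q * g * g <= 2^-1 * (q * g) by rewrite mulrC ler_pM2r ?mulr_gt0// ltW.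
  have : 0 < q * g by rewrite mulr_gt0.
  lra.
pose X := expR (- (q * g ^+ 2 / 16)) `^ (d%:R / 2).
have Q0 : 0 < Q by rewrite !mulr_gt0 ?powR_gt0// mulr_gt0// powR_gt0.
(* The centre on the line through x that minimizes the bound on the distance to the points of the
   ball at the inner edge of the shell, where |y|^2 = (1 + tau j q) |x|^2. *)
pose lam j := 1 - (1 - tau j) * q / 2.
pose S j y := [&& ballb x r y, (1 + tau j * q) * T <= norm2 y ^+ 2 &
  (j == N) || (norm2 y ^+ 2 <= (1 + tau j.+1 * q) * T)].
have mS j : measurable_fun setT (S j).
  apply: measurable_and => //; apply: measurable_and => //.
  by apply: measurable_or => //; exact: measurable_cst.
have Hshell j : (j < N.+1)%N -> (mass a (S j) <= (X * Q)%:E)%E.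
  rewrite ltnS => jN; have /andP[t1 t2] := tau_itv jN.
  have tq1 : 0 < 1 + tau j * q.
    have : - g * q <= tau j * q by rewrite ler_pM2r.
    by have := gq; have := q1; lra.
  set k := (1 - tau j) * q / 2.
  have k0 : 0 <= k by rewrite !mulr_ge0 ?subr_ge0// ltW.
  have k1 : k <= q.
    have : (1 - tau j) * q <= 2 * q by rewrite ler_pM2r//; have := g2; lra.
    by rewrite /k; lra.
  have kk : k * k <= 2^-1 * q.
    apply: (@le_trans _ _ (q * q)); first exact: ler_pM.
    by rewrite ler_pM2r//; have := q1; lra.
  have Dq : 0 <= q * D by rewrite mulr_ge0 ?ltW.
  have rpos : 0 < q * (1 + D) - (1 - tau j) ^+ 2 * q ^+ 2 / 4.
    have -> : (1 - tau j) ^+ 2 * q ^+ 2 / 4 = k * k by rewrite /k; field.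
    by have := q0; lra.
  apply: (le_trans (@shell_mass R d d_gt0 a (S j) (lam j *: x) (1 + tau j * q)
    (q * (1 + D) - (1 - tau j) ^+ 2 * q ^+ 2 / 4) T a0 tq1 rpos T0 (mS j) _)).
    move=> y /and3P[yB h1 h2]; split => //; rewrite sqr_norm2B_scale -/s -/T.
    move: yB; rewrite ballE xbE => yB.
    have -> : (1 - tau j) ^+ 2 * q ^+ 2 / 4 = k * k by rewrite /k; field.
    rewrite /lam -/k.
    have k1' : k <= 1 by have := q1; lra.
    have H1 : 0 <= (1 - k) * (q * T - (norm2 y ^+ 2 - 2 * dot y x + T)).
      by apply: mulr_ge0; rewrite subr_ge0.
    (* The last shell has no outer bound, but [tau N = 1] puts its centre at x itself, so that it is
       contained in the given ball. *)
    case/orP: h2 => [/eqP jE|h2].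
      have kE : k = 0 by rewrite /k jE tauN subrr !mul0r.
      rewrite kE in H1 *; have : 0 <= q * D * T by rewrite mulr_ge0// ltW.
      lra.
    have tE : tau j.+1 = tau j + D by rewrite /tau -natr1; ring.
    rewrite tE in h2.
    have H2 : 0 <= k * ((1 + (tau j + D) * q) * T - norm2 y ^+ 2) by rewrite mulr_ge0// subr_ge0.
    have H3 : 0 <= (1 - k) * (q * D * T).
      by apply: mulr_ge0; [rewrite subr_ge0|apply: mulr_ge0 => //; exact: ltW].
    have kE : tau j * q = q - 2 * k by rewrite /k; field.
    rewrite (_ : 1 + (tau j + D) * q = 1 + q - 2 * k + q * D) in H2; last by rewrite mulrDl kE; ring.
    lra.
  rewrite powE ?(ltW rpos)// lee_fin /Q [X * _]mulrA ler_pM2r// [X * _]mulrA ler_pM2r ?powR_gt0//.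
  rewrite /X -powRM ?expR_ge0 ?mulr_ge0 ?powR_ge0 ?(ltW h0)//.
  apply: ler_powRl; first by rewrite divr_ge0.
    by apply: mulr_ge0; [exact: powR_ge0|exact: ltW].
  by apply: shell_exponent => //; [rewrite t1 t2|rewrite (ltW D0) DE].
have Hbad : (mass a bad <= (N.+1%:R * (X * Q))%:E)%E.
  apply: (@mass_union_le R d a N.+1 bad S) => // y /andP[yB]; rewrite -leNgt => y1.
  have y1' : (1 + tau 0%N * q) * T <= norm2 y ^+ 2.
    rewrite /tau mul0r addr0; apply: (@le_trans _ _ 1); first by rewrite mulNr ltW.
    by rewrite exprn_ege1.
  have [j [jN h1 h2]] := @exists_shell (fun j => (1 + tau j * q) * T) _ N y1'.
  exists j => //; rewrite /S yB h1 /=.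
  by case: h2 => [->|->]; rewrite ?eqxx ?orbT.
have badgood : (mass a bad <= mass a good)%E.
  apply: (le_trans Hbad); apply: le_trans Hgood; rewrite lee_fin mulrA ler_pM2r//.
have Bsum : (mass a (ballb x r) <= mass a good + mass a bad)%E.
  by apply: mass_le_add => // y yB; rewrite /good /bad yB; case: (norm2 y < 1).
have M0 := mass_ballb_gt0 d_gt0 a r0 rs.
have Mf := mass_ballb_fin d_gt0 a r0 rs.
apply: (@lt_maxop _ _ _ _ _ r) => //.
have goodB : (mass a good <= mass a (ballb x r))%E by apply: le_mass => y /andP[].
have gf : mass a good \is a fin_num.
  by rewrite ge0_fin_numE ?mass_ge0// (le_lt_trans goodB)// -ge0_fin_numE ?mass_ge0.
(* At least half of the mass is inside the unit ball, so 1/3 is exceeded strictly. *)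
have B2 : (mass a (ballb x r) <= mass a good + mass a good)%E.
  by apply: (le_trans Bsum); exact: leeD2l.
move: B2 M0; rewrite -/(mass a good) -(fineK Mf) -(fineK gf) -EFinD lee_fin lte_fin => B2 M0.
by rewrite -EFinM lte_fin; lra.
Qed.

End exponential_growth.

(** * Choice of the constants for exponential growth *)

Section exponential_growth_constants.
Variable R : realType.

Lemma expRN_le (M z : R) : 0 < M -> M <= z -> expR (- z) <= M^-1.
Proof.
move=> M0 Mz; rewrite expRN lef_pV2 ?posrE ?expR_gt0//.
by apply: (le_trans Mz); apply: le_trans (expR_ge1Dx _); rewrite lerDr.
Qed.

Lemma expRN_powR (c y : R) : expR (- c) `^ y = expR (- (y * c)).
Proof. by rewrite /powR gt_eqF ?expR_gt0// expRK mulrN. Qed.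

(** [third_lt_maxop] applies on the punctured ball of radius rho = (1 - g q)^(-1/2), whose mass is
    rho^(d - a) times that of the unit ball; here d - a = (1 - b) d. *)
Lemma weak_const_ge_exp (b : R) : 2^-1 < b < 1 ->
  exists2 rho : R, 1 < rho & exists d0 : nat, forall d : nat, (0 < d)%N -> (d0 <= d)%N ->
    forall p : R, 1 <= p ->
    ((3^-1 * (rho `^ ((1 - b) / p)) ^+ d)%:E <= weak_const d (b * d%:R) p)%E.
Proof.
move=> /andP[b2 b1]; pose g := b - 2^-1.
have bE : b = g + 2^-1 by rewrite subrK.
have g0 : 0 < g by rewrite subr_gt0.
have g2 : g < 2^-1 by rewrite /g; lra.
have gi : 0 < g < 2^-1 by rewrite g0.
pose q := g ^+ 2 / 64.
have qE : 64 * q = g ^+ 2 by rewrite mulrC divfK.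
have gg0 : 0 < g ^+ 2 by rewrite exprn_gt0.
have gg1 : g ^+ 2 <= 1 by rewrite exprn_ile1 ?(ltW g0)//; lra.
have q0 : 0 < q by rewrite divr_gt0.
have q1 : q <= 2^-1 by lra.
have c0 : 0 < q * g ^+ 2 by rewrite mulr_gt0.
have [N NE] : exists N : nat, 16 * (1 + g) <= q * g ^+ 2 * N%:R.
  exists (Num.bound (16 * (1 + g) / (q * g ^+ 2))).
  rewrite -ler_pdivrMl// [leLHS]mulrC; apply: ltW; apply: archi_boundP.
  by apply: divr_ge0; [lra|exact: ltW].
have gq1 : g * q < 1.
  have : g * q <= 2^-1 * 2^-1 by rewrite ler_pM// ltW.
  lra.
have gq0 : 0 < g * q by rewrite mulr_gt0.
have k0 : 0 < 1 - g * q by rewrite subr_gt0.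
pose e := q * g ^+ 2 / 32; pose h := q - b ^+ 2 * q ^+ 2.
have b0 : 0 < b by lra.
have h0 : 0 < h.
  rewrite /h subr_gt0 expr2 mulrA gtr_pMl//.
  have : b ^+ 2 * q <= 1 * q by rewrite ler_pM2r// exprn_ile1 ?(ltW b0) ?(ltW b1).
  lra.
have e0 : 0 < e by rewrite divr_gt0.
(* Thresholds for d: exp (- z) <= 1 / M once z >= M, with M = 4 (N + 1) to absorb the N + 1 shells
   and M = 4 for the concentration in the slab. *)
pose D1 : R := 2 / (q * g ^+ 2 / 16) * (4 * N.+1%:R); pose D2 : R := 8 * h / e ^+ 2.
have c16 : 0 < q * g ^+ 2 / 16 by rewrite divr_gt0.
have D10 : 0 < D1 by rewrite mulr_gt0 ?mulr_gt0 ?ltr0n// invr_gt0.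
have e20 : 0 < e ^+ 2 by rewrite exprn_gt0.
have D20 : 0 < D2 by rewrite divr_gt0 ?mulr_gt0.
have eh0 : 0 < h - e ^+ 2.
  have e1 : e <= 32^-1 * q.
    have : q * g ^+ 2 <= q * 1 by rewrite ler_pM2l.
    rewrite /e; lra.
  have e2 : e ^+ 2 <= (32^-1 * q) * 2^-1.
    by rewrite expr2 ler_pM ?(ltW e0)//; lra.
  have : b ^+ 2 * q ^+ 2 <= q * 2^-1.
    have -> : b ^+ 2 * q ^+ 2 = b ^+ 2 * q * q by ring.
    have : b ^+ 2 * q * q <= 1 * q * 2^-1.
      apply: ler_pM; [by rewrite mulr_ge0 ?sqr_ge0 ?(ltW q0)|exact: ltW| |done].
      by rewrite ler_pM2r// exprn_ile1 ?(ltW b0) ?(ltW b1).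
    by rewrite mul1r.
  rewrite /h; lra.
pose rho : R := Num.sqrt (1 - g * q)^-1.
have rho0 : 0 < rho by rewrite sqrtr_gt0 invr_gt0.
have rho2 : rho ^+ 2 = (1 - g * q)^-1 by rewrite sqr_sqrtr// invr_ge0 ltW.
have rho1 : 1 < rho.
  rewrite -(@ltr_pXn2r _ 2)// ?nnegrE ?(ltW rho0)// expr1n rho2 invf_gt1// ltrBlDr ltrDl//.
exists rho => //; exists (Num.bound (D1 + D2)) => d d_gt0 dD p p1.
have {}dD : D1 + D2 <= d%:R.
  apply: (@le_trans _ _ (Num.bound (D1 + D2))%:R); last by rewrite ler_nat.
  by apply: ltW; apply: archi_boundP; rewrite addr_ge0 ?ltW.
have dh0 : 0 <= d%:R / 2 :> R by rewrite divr_ge0.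
have L1 : (h - e ^+ 2) `^ (d%:R / 2) <= 4^-1 * h `^ (d%:R / 2).
  have eh : h - e ^+ 2 <= expR (- (e ^+ 2 / h)) * h.
    apply: (@le_trans _ _ ((1 - e ^+ 2 / h) * h)); last by rewrite ler_pM2r// expR_ge1Dx.
    by rewrite mulrBl divfK ?gt_eqF// mul1r.
  apply: (le_trans (ler_powRl dh0 (ltW eh0) eh)); rewrite powRM ?expR_ge0 ?(ltW h0)//.
  rewrite ler_wpM2r ?powR_ge0// expRN_powR; apply: expRN_le => //.
  rewrite (_ : 4 = D2 / 2 * (e ^+ 2 / h)).
    by rewrite ler_pM2r ?divr_gt0// ler_pM2r//; have := D10; lra.
  by rewrite /D2; field; rewrite !gt_eqF.
have L2 : N.+1%:R * expR (- (q * g ^+ 2 / 16)) `^ (d%:R / 2) <= 4^-1.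
  have N0 : 0 < N.+1%:R :> R by rewrite ltr0n.
  rewrite expRN_powR; apply: (@le_trans _ _ (N.+1%:R * (4 * N.+1%:R)^-1)); last first.
    by rewrite invfM mulrCA divff ?mulr1// gt_eqF.
  rewrite ler_pM2l//; apply: expRN_le; first by rewrite mulr_gt0.
  rewrite (_ : 4 * _ = D1 / 2 * (q * g ^+ 2 / 16)).
    by rewrite ler_pM2r// ler_pM2r//; have := D20; lra.
  by rewrite /D1; field; rewrite !gt_eqF.
pose a := b * d%:R.
have dR0 : 0 < d%:R :> R by rewrite ltr0n.
have ad : a < d%:R by rewrite gtr_pMl.
have n0 : 0 < d%:R - a by rewrite subr_gt0.
have mA : measurable_fun setT (fun t : R => t < 1) by exact: measurable_fun_ltr.
have m0 : 0 < d%:R / (d%:R - a) * unit_ball_volume R d by rewrite mulr_gt0 ?V_gt0// divr_gt0.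
have mE : mass a (fun y : 'rV[R]_d => norm2 y < 1) = (d%:R / (d%:R - a) * unit_ball_volume R d)%:E.
  by rewrite mass_centered_lt// powR1 mul1r.
have p0 : 0 < p by exact: lt_le_trans p1.
have mn := @measurable_norm2 R d.
have := @weak_const_ge R d a p 3^-1 (rho `^ (d%:R - a)) _ (fun t => t < 1)
  (fun x => (norm2 x < rho) && (x != 0)) p0 _ _ m0 mA mE.
rewrite -powRrM (_ : (d%:R - a) / p = (1 - b) / p * d%:R); last by rewrite /a; ring.
rewrite powRrM powR_mulrn ?powR_ge0//; apply => //.
- move=> x /andP[xrho x0]; apply: (third_lt_maxop bE gi qE NE d_gt0 L1 L2) => //.
  have : norm2 x ^+ 2 < rho ^+ 2 by rewrite ltrXn2r// ?nnegrE ?norm2_ge0 ?(ltW rho0).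
  by rewrite rho2 -(ltr_pM2l k0) divff// gt_eqF.
- rewrite -mass_null0//; last exact: measurable_fun_ltr.
  by rewrite mass_centered_lt// lee_fin mulrA.
Qed.

End exponential_growth_constants.

(** * Assembly of the three assertions *)

Theorem theorem3p1 (R : realType) :
  (* 1) alpha_d = alpha * d with 1/2 < alpha < 1 *)
  (forall alpha : R, 2^-1 < alpha < 1 ->
    forall p : R, 1 <= p ->
      exists b : R, 1 < b /\ exists K : R, 0 < K /\
        forall d : nat, (1 <= d)%N ->
          ((K * b ^+ d)%:E <= weak_const d (alpha * d%:R) p)%E) /\
  (* 2) alpha_d <= d/2 *)
  (forall alpha : nat -> R, (forall d : nat, (1 <= d)%N -> alpha d <= d%:R / 2) ->
    (exists K : R, 0 < K /\
      forall d : nat, (1 <= d)%N ->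
        ((K * (Num.sqrt 5 / 2) `^ (alpha d))%:E <= weak_const d (alpha d) 1)%E) /\
    ((forall M : R, forall N : nat, exists d : nat, (N <= d)%N /\ M < alpha d) ->
      forall M : R, forall N : nat, exists d : nat,
        [/\ (N <= d)%N, (1 <= d)%N & (M%:E < weak_const d (alpha d) 1)%E])) /\
  (* 3) sup_d alpha_d <= alpha < oo *)
  (forall alpha : R,
    (exists C : R, forall d : nat, (1 <= d)%N -> forall a : R, a <= alpha ->
        (weak_const d a 1 <= C%:E)%E) /\
    (forall p : R, 1 < p -> exists C : R,
      forall d : nat, (1 <= d)%N -> forall a : R, a <= alpha ->
        (strong_const d a p <= C%:E)%E)).
Proof.
split; last split.
- move=> alpha al p p1; have [rho rho1 [d0 H]] := weak_const_ge_exp al.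
  have /andP[al2 al1] := al.
  have p0 : 0 < p by exact: lt_le_trans p1.
  pose b := rho `^ ((1 - alpha) / p).
  have b1 : 1 < b.
    have c0 : 0 < (1 - alpha) / p by rewrite divr_gt0// subr_gt0.
    by rewrite /b /powR gt_eqF ?(lt_trans ltr01)// expR_gt1 mulr_gt0// ln_gt0.
  have b0 : 0 < b by exact: lt_trans b1.
  (* The factor b^(-d0) keeps K b^d below 1/3 for the dimensions d <= d0, where the trivial lower
     bound 1/2 is used. *)
  exists b; split => //; exists (3^-1 * (b ^+ d0)^-1); split.
    by rewrite mulr_gt0 ?invr_gt0 ?exprn_gt0.
  move=> d d_gt0; have [dd|/ltnW dd] := leqP d0 d.
    apply: le_trans (H d d_gt0 dd p p1); rewrite lee_fin -mulrA ler_pM2l ?invr_gt0//.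
    by rewrite ler_piMl ?exprn_ge0 ?(ltW b0)// invf_le1 ?exprn_gt0// exprn_ege1// ltW.
  have dR0 : 0 < d%:R :> R by rewrite ltr0n.
  apply: (le_trans _ (@half_le_weak_const R d d_gt0 (alpha * d%:R) p _ p1)); last first.
    by rewrite gtr_pMl.
  rewrite lee_fin -mulrA; have : (b ^+ d0)^-1 * b ^+ d <= 1.
    by rewrite mulrC ler_pdivrMr ?exprn_gt0// mul1r ler_weXn2l// ltW.
  lra.
- move=> alpha ad; have H d : (1 <= d)%N ->
      ((24^-1 * (Num.sqrt 5 / 2) `^ (alpha d))%:E <= weak_const d (alpha d) 1)%E.
    by move=> d1; apply: weak_const_ge_sqrt5 => //; exact: ad.
  split; first by exists 24^-1; split; rewrite ?invr_gt0.
  move=> ub M N; pose L : R := ln (Num.sqrt 5 / 2).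
  have s1 : 1 < Num.sqrt 5 / 2 :> R.
    rewrite ltr_pdivlMr// mul1r -(@ltr_pXn2r _ 2)// ?nnegrE ?sqrtr_ge0// sqr_sqrtr//.
    by rewrite -natrX ltr_nat.
  have L0 : 0 < L by rewrite ln_gt0.
  (* The power is exp (alpha_d L) >= 1 + alpha_d L, so alpha_d > 24 M / L makes 1/24 of it exceed
     M. *)
  have [d [dN Md]] := ub (24 * M / L) (maxn N 1).
  move: dN; rewrite geq_max => /andP[Nd d1]; exists d; split => //.
  apply: lt_le_trans (H d d1); rewrite lte_fin /powR gt_eqF ?(lt_trans ltr01)// -/L.
  have := expR_ge1Dx (alpha d * L); move: Md; rewrite ltr_pdivrMr//; lra.
(* The upper bounds are stated for a nonnegative bound on the exponents, whence the maximum with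
   0. *)
- move=> alpha; pose A := Num.max alpha 0.
  have A0 : 0 <= A by rewrite le_max lexx orbT.
  have aA a : a <= alpha -> a <= A by move=> h; rewrite le_max h.
  split; first by exists (4 * (2 * 16 `^ A + 1)) => d d1 a /aA; exact: weak_type_bound.
  by move=> p p1; eexists => d d1 a /aA aA'; exact: (strong_type_bound d1 A0 aA' p1).
Qed.
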